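(* Let $\mu$ be a finite positive Borel measure on $(-1,1)$ that is regular. Let $p>0$. Let $I$ be a closed subinterval of $(-1,1)$ in which $\mu$ is absolutely continuous, and $w$ is bounded above and below by positive constants, and moreover $w$ is Riemann integrable in $I$. Then if $I'$ is a closed subinterval of the interior $I^0$ of $I$, $$\lim_{n\to\infty}\int_{I'}\left|\frac{\widetilde K_n\left(x+\frac{a}{\widetilde K_n(x,x)},\,x+\frac{b}{\widetilde K_n(x,x)}\right)}{\widetilde K_n(x,x)}-\frac{\sin\pi(a-b)}{\pi(a-b)}\right|^p dx=0,$$ uniformly for $a,b$ in compact subsets of the real line.
   Context: For a finite positive Borel measure $\mu$ on $(-1,1)$ with infinite support, the orthonormal polynomials are $p_n(x)=\gamma_n x^n+\cdots$, $\gamma_n>0$, $n\ge 0$, with $\int_{-1}^1 p_np_m\,d\mu=\delta_{mn}$. The measure $\mu$ is called regular (on $[-1,1]$) if $\lim_{n\to\infty}\gamma_n^{1/n}=2$. The function $w=d\mu/dx$ denotes (a fixed version of) the density of the absolutely continuous part of $\mu$. The reproducing kernel is $K_n(x,y)=\sum_{k=0}^{n-1}p_k(x)p_k(y)$ and the normalized kernel is $\widetilde K_n(x,y)=w(x)^{1/2}w(y)^{1/2}K_n(x,y)$. When $a=b$, $\frac{\sin\pi(a-b)}{\pi(a-b)}$ is interpreted as $1$. *)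

(* Defs.v *)
From HB Require Import structures.
From mathcomp Require Export all_boot all_order all_algebra.
From mathcomp Require Export all_classical all_reals all_analysis.
Export Order.TTheory GRing.Theory Num.Theory.
Export numFieldNormedType.Exports.

Set Implicit Arguments.
Unset Strict Implicit.
Unset Printing Implicit Defensive.

#[global] Open Scope classical_set_scope.
#[global] Open Scope ring_scope.

Definition measure_support (R : realType)
    (mu : set (measurableTypeR R) -> \bar R) : set R :=
  [set x | forall U : set R, open U -> U x -> (0 < mu U)%E].

Definition orthonormal_polynomials (R : realType)
    (mu : {measure set (measurableTypeR R) -> \bar R})
    (p : nat -> {poly R}) : Prop :=
  (forall n, size (p n) = n.+1 /\ 0 < lead_coef (p n)) /\
  (forall n m : nat,
     (\int[mu]_(x in `](-1)%R, 1%R[) ((p n).[x] * (p m).[x])%:E)%E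
     = ((n == m)%:R)%:E).

(* The orthonormal polynomials of a measure are unique when they exist, so the
   existential quantifier merely names them. *)
Definition regular_measure (R : realType)
    (mu : {measure set (measurableTypeR R) -> \bar R}) : Prop :=
  exists2 p : nat -> {poly R}, orthonormal_polynomials mu p &
    lead_coef (p n) `^ n%:R^-1 @[n --> \oo] --> (2 : R).

Definition mutually_singular (R : realType)
    (mu nu : set (measurableTypeR R) -> \bar R) : Prop :=
  exists N : set (measurableTypeR R),
    [/\ measurable N, mu N = 0%E & nu (~` N) = 0%E].

(* Lebesgue decomposition of [mu] on [-1 < x < 1]; the values of [w] outside
   that interval are irrelevant. *)
Definition ac_density (R : realType)
    (mu : {measure set (measurableTypeR R) -> \bar R}) (w : R -> R) : Prop :=
  [/\ measurable_fun (`]-1, 1[ : set R) w,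
      forall x, x \in (`]-1, 1[ : interval R) -> 0 <= w x
    & exists nu : {measure set (measurableTypeR R) -> \bar R},
        mutually_singular lebesgue_measure nu /\
        forall A : set (measurableTypeR R), measurable A ->
          A `<=` (`]-1, 1[ : set R) ->
          mu A = (\int[lebesgue_measure]_(x in A) (w x)%:E + nu A)%E].

(* A subdivision [a < s_0 < ... < s_k = b] is the sequence [s], as in
   [itv_partition]; [t i] is the tag of the i-th cell. *)
Definition riemann_integrable (R : realType) (a b : R) (f : R -> R) : Prop :=
  exists l : R, forall e : R, 0 < e -> exists2 d : R, 0 < d &
    forall (s : seq R) (t : nat -> R), itv_partition a b s ->
      let x := nth b (a :: s) in
      (forall i, (i < size s)%N ->
         [/\ x i.+1 - x i < d, x i <= t i & t i <= x i.+1]) ->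
      `|\sum_(0 <= i < size s) f (t i) * (x i.+1 - x i) - l| < e.

Definition reproducing_kernel (R : realType) (p : nat -> {poly R}) (n : nat)
    (x y : R) : R :=
  \sum_(0 <= k < n) (p k).[x] * (p k).[y].

Definition normalized_kernel (R : realType) (p : nat -> {poly R}) (w : R -> R)
    (n : nat) (x y : R) : R :=
  Num.sqrt (w x) * Num.sqrt (w y) * reproducing_kernel p n x y.

Definition sine_kernel (R : realType) (a b : R) : R :=
  if a == b then 1 else sin (pi * (a - b)) / (pi * (a - b)).

(* Main.v *)
(* Lubinsky's comparison method, with the arcsine measure as reference: its
   orthonormal polynomials are multiples of the Chebyshev polynomials and its
   kernel is a sum of Dirichlet kernels, which produces the sine kernel.
   Write L and E for integration of polynomials against mu and the arcsine
   measure.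

   Near a continuity point x0 of w, mu is nearly kappa times the arcsine measure,
   kappa = pi w(x0) sqrt(1 - x0^2).  Far from x0 the arcsine kernel KE_n(x,.) is
   bounded, so L (KE_n(x,.)^2) <= (1 + o(1)) kappa n.  Conversely, multiplying
   K_n(x,.) by (1 - ((t - x) / 2)^2)^m, m = o(n), makes it negligible away from x0,
   because regularity makes the p_n subexponential on [-1, 1]; hence
   K_n(x,x) <= (1 + o(1)) n / kappa.  Expanding the square,
   L ((K_n(x,.) - KE_n(x,.) / kappa)^2) = o(n), and the reproducing property gives
   K_n = KE_n / kappa + o(n) near x0.  Riemann integrability gives continuity of w
   almost everywhere, and dominated convergence concludes, along parameters a_n, b_n
   that are as bad as possible for each n.

   Subexponential growth is obtained without potential theory.  Parametrise the
   complement of [-1, 1] by z = (u + 1/u) / 2.  Orthogonality bounds |p_n(z)| below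
   by c |u|^n, while the product of |p_n| over all u with a given u^M is at most
   about (gamma_n / 2^n)^M |u|^(nM); so gamma_n^(1/n) -> 2 forces
   |p_n(z)| <= C |u|^n e^(eps n).  As the zeros lie in [-1, 1], |p_n| at a point of
   [-1, 1] is at most its value at the points vertically above. *)

Require Import Defs.
From HB Require Import structures.
From mathcomp Require Import measurable_realfun ring lra complex.
Import ComplexField.Normc.

Set Implicit Arguments.
Unset Strict Implicit.
Unset Printing Implicit Defensive.

(** * Growth of orthonormal polynomials of a regular measure *)

(** Both measures act only as real linear functionals on polynomials, nonnegative on those that are
    nonnegative on [-1, 1]. Cauchy-Schwarz, the reproducing property and the growth estimates are
    then algebra, with complex polynomials split into pairs of real ones; measure theory enters only
    to compare the two functionals and in the final limit.

    The obstacle is that w is continuous only almost everywhere: the comparison gives K_n - KE_n /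
    kappa = o(n) near one continuity point at a time, with no uniformity in x. The bounds m <= w <=
    M are therefore used in a second, cruder comparison on all of [c, d]. Its outcome, K_n(x,x) of
    exact order n near [c', d'], keeps the shifted points inside [c, d] and provides the dominating
    constant.

    In the localization the exponent is m = n %/ k with k fixed by eta: the extra degree 2m costs a
    factor 1 + O(eta), and the geometric decay in m beats the growth rho^(2n) of the kernel because
    rho > 1 may be chosen after k. *)

Lemma exists_divided_difference (R : rcfType) (z : R[i]) (f : {poly R}) :
  let fz := (map_poly (real_complex R) f).[z] in
  exists g h : {poly R},
    [/\ (size g <= (size f).-1)%N, (size h <= (size f).-1)%N,
        f - (complex.Re fz)%:P = ('X - (complex.Re z)%:P) * g + (complex.Im z)%:P * h
      & - (complex.Im fz)%:P = ('X - (complex.Re z)%:P) * h - (complex.Im z)%:P * g].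
Proof.
case: z => a b.
elim/poly_ind: f => [|f c [g [h [sg sh]]]] /=.
  exists 0, 0; rewrite !size_poly0 rmorph0 horner0 /=.
  by split=> //; rewrite polyC0 ?oppr0 ?subr0 ?mulr0 ?addr0 ?subr0.
have -> : (map_poly (real_complex R) (f * 'X + c%:P)).[Complex a b]
   = (map_poly (real_complex R) f).[Complex a b] * Complex a b + Complex c 0.
  by rewrite rmorphD rmorphM /= map_polyX map_polyC hornerD hornerM hornerX hornerC.
set fz := (map_poly _ f).[_].
case: fz => u v /= e1 e2.
(* With g + i h the quotient of f - f(z) by X - z, the identity X f - z f(z) = (X - z) f + z (f -
   f(z)) shows that the quotient for f X + c is f + z (g + i h). *)
exists (f + a%:P * g - b%:P * h), (a%:P * h + b%:P * g).
have sf : (size f <= (size (f * 'X + c%:P)%R).-1)%N.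
  by rewrite size_MXaddC; case: ifP => // /andP[/eqP-> _]; rewrite size_poly0.
have sm (k : R) (q : {poly R}) : (size q <= (size f).-1)%N ->
    (size (k%:P * q)%R <= (size (f * 'X + c%:P)%R).-1)%N.
  move=> sq; apply: leq_trans sf; rewrite mul_polyC.
  by apply: leq_trans (size_scale_leq _ _) (leq_trans sq (leq_pred _)).
split.
- apply: leq_trans (size_polyD _ _) _; rewrite geq_max size_polyN sm // andbT.
  by apply: leq_trans (size_polyD _ _) _; rewrite geq_max sf sm.
- by apply: leq_trans (size_polyD _ _) _; rewrite geq_max !sm.
- move: e1 e2; rewrite !(polyCD, polyCB, polyCN, polyCM) => e1 e2.
  have -> : f = u%:P + (('X - a%:P) * g + b%:P * h) by rewrite -e1; ring.
  have -> : v%:P = - (('X - a%:P) * h - b%:P * g) by rewrite -e2; ring.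
  rewrite ?polyC0; ring.
- move: e1 e2; rewrite !(polyCD, polyCB, polyCN, polyCM) => e1 e2.
  have -> : f = u%:P + (('X - a%:P) * g + b%:P * h) by rewrite -e1; ring.
  have -> : v%:P = - (('X - a%:P) * h - b%:P * g) by rewrite -e2; ring.
  rewrite ?polyC0; ring.
Qed.

Definition positive_on_unit (R : realFieldType) (L : {poly R} -> R) :=
  forall f : {poly R}, (forall x, -1 <= x <= 1 -> 0 <= f.[x]) -> 0 <= L f.

Section PositiveFunctional.
Variables (R : rcfType) (L : {scalar {poly R}}).
Hypothesis L_ge0 : positive_on_unit L.

Lemma functional_mono (f g : {poly R}) :
  (forall x, -1 <= x <= 1 -> f.[x] <= g.[x]) -> L f <= L g.
Proof.
move=> fg; rewrite -subr_ge0 -linearB; apply: L_ge0 => x /fg.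
by rewrite hornerD hornerN subr_ge0.
Qed.

Lemma functional_sqr_ge0 (f : {poly R}) : 0 <= L (f ^+ 2).
Proof. by apply: L_ge0 => x _; rewrite horner_exp sqr_ge0. Qed.

Lemma functional_CauchySchwarz (f g : {poly R}) :
  L (f * g) ^+ 2 <= L (f ^+ 2) * L (g ^+ 2).
Proof.
have key (s : R) : 0 <= L (f ^+ 2) * s ^+ 2 + 2 * L (f * g) * s + L (g ^+ 2).
  have := functional_sqr_ge0 (s *: f + g).
  have -> : (s *: f + g) ^+ 2 = (s ^+ 2) *: f ^+ 2 + ((2 * s) *: (f * g) + g ^+ 2).
    rewrite -!mul_polyC !(polyCM, polyC_exp); ring.
  rewrite !linearP /=; lra.
(* If L (f^2) = 0, the quadratic degenerates to an affine function of s that stays nonnegative, so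
   its slope is 0. *)
have := functional_sqr_ge0 f; rewrite le_eqVlt => /orP[/eqP f0|fp].
  have h (s : R) : 0 <= 2 * L (f * g) * s + L (g ^+ 2).
    by have := key s; rewrite -f0 mul0r add0r.
  rewrite -f0 mul0r; suff -> : L (f * g) = 0 by rewrite expr0n.
  apply/eqP; apply: contraT => nz.
  have := h (- (L (g ^+ 2) + 1) / (2 * L (f * g))).
  rewrite mulrC divfK ?mulf_neq0 ?pnatr_eq0 //; lra.
have := key (- L (f * g) / L (f ^+ 2)).
have -> : L (f ^+ 2) * (- L (f * g) / L (f ^+ 2)) ^+ 2 +
    2 * L (f * g) * (- L (f * g) / L (f ^+ 2)) + L (g ^+ 2)
  = (L (f ^+ 2) * L (g ^+ 2) - L (f * g) ^+ 2) / L (f ^+ 2).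
  by field; rewrite gt_eqF.
by rewrite pmulr_lge0 ?invr_gt0 // subr_ge0.
Qed.

End PositiveFunctional.

Definition complex_horner (R : rcfType) (f : {poly R}) (z : R[i]) : R[i] :=
  (map_poly (real_complex R) f).[z].

Lemma sqr_normc_ReIm (R : rcfType) (z : R[i]) :
  normc z ^+ 2 = complex.Re z ^+ 2 + complex.Im z ^+ 2.
Proof. by case: z => a b /=; rewrite sqr_sqrtr // addr_ge0 ?sqr_ge0. Qed.

Section OrthogonalLowerBound.
Variables (R : rcfType) (L : {scalar {poly R}}).
Hypothesis L_ge0 : positive_on_unit L.

Lemma functionalC (c : R) (f : {poly R}) : L (c%:P * f) = c * L f.
Proof. by rewrite mul_polyC linearZ. Qed.

(** As V is a nonnegative weight, the barycenter L (X V) / L V lies in [-1, 1]; the distance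
    hypothesis is applied at this single point. *)
Lemma sqr_dist_le_moment (a b dlt : R) (V : {poly R}) :
  (forall t : R, -1 <= t <= 1 -> dlt ^+ 2 <= (t - a) ^+ 2 + b ^+ 2) ->
  (forall t : R, -1 <= t <= 1 -> 0 <= V.[t]) ->
  dlt ^+ 2 * L V ^+ 2 <= L (('X - a%:P) * V) ^+ 2 + L (b%:P * V) ^+ 2.
Proof.
move=> hd hV.
have := L_ge0 hV; rewrite le_eqVlt => /orP[/eqP <-|Vp].
  by rewrite expr0n mulr0 addr_ge0 ?sqr_ge0.
have h1 : 0 <= L V - L ('X * V).
  rewrite -linearB; apply: L_ge0 => t t1.
  have := hV t t1; rewrite !hornerE; case/andP: t1; nra.
have h2 : 0 <= L V + L ('X * V).
  rewrite -linearD; apply: L_ge0 => t t1.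
  have := hV t t1; rewrite !hornerE; case/andP: t1; nra.
rewrite mulrBl linearB /= !functionalC.
set v := L V in Vp h1 h2 *; set x := L ('X * V) in h1 h2 *.
have /hd : -1 <= x / v <= 1.
  by rewrite ler_pdivlMr // ler_pdivrMr //; apply/andP; split; lra.
rewrite -(ler_pM2r (_ : 0 < v ^+ 2)) ?exprn_gt0 //.
move=> /le_trans; apply; rewrite le_eqVlt; apply/orP; left; apply/eqP.
by field; rewrite gt_eqF.
Qed.

(* Write q S(z) - q(z) S = (X - z)(R1 + i R2). As q is orthogonal to R1 and R2,
   integrating against R1 - i R2 bounds the norm of R1 + i R2 by |q(z)| |S| / dlt;
   S(z) is then recovered from q S(z) = q(z) S + (X - z)(R1 + i R2). *)
Lemma orthogonal_lower_bound (n : nat) (q S : {poly R}) (z : R[i]) (dlt Q : R) :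
  (size q <= n.+1)%N -> (size S <= n.+1)%N ->
  (forall f : {poly R}, (size f <= n)%N -> L (q * f) = 0) -> L (q ^+ 2) = 1 ->
  0 < dlt ->
  (forall t : R, -1 <= t <= 1 ->
     dlt ^+ 2 <= (t - complex.Re z) ^+ 2 + complex.Im z ^+ 2 <= Q) ->
  normc (complex_horner S z) ^+ 2 <=
    2 * normc (complex_horner q z) ^+ 2 * L (S ^+ 2) * (1 + Q / dlt ^+ 2).
Proof.
move=> sq sS qorth q1 dlt0 hz.
rewrite !sqr_normc_ReIm.
have [g [h [sg sh]]] := exists_divided_difference z q.
have [g' [h' [sg' sh']]] := exists_divided_difference z S.
rewrite -/(complex_horner q z) -/(complex_horner S z).
move: hz; set a := complex.Re z; set b := complex.Im z.
set p1 := complex.Re (complex_horner q z); set p2 := complex.Im (complex_horner q z).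
set s1 := complex.Re (complex_horner S z); set s2 := complex.Im (complex_horner S z).
move=> hz e1 e2 e1' e2'.
pose R1 := s1%:P * g - s2%:P * h - p1%:P * g' + p2%:P * h'.
pose R2 := s2%:P * g + s1%:P * h - p1%:P * h' - p2%:P * g'.
have sm (c : R) (f : {poly R}) (k : nat) : (size f <= k.-1)%N -> (k <= n.+1)%N ->
    (size (c%:P * f)%R <= n)%N.
  move=> sf kn; rewrite mul_polyC; apply: leq_trans (size_scale_leq _ _) _.
  by apply: leq_trans sf _; case: k kn.
have szD (f1 f2 : {poly R}) : (size f1 <= n)%N -> (size f2 <= n)%N -> (size (f1 + f2)%R <= n)%N.
  by move=> l1 l2; apply: leq_trans (size_polyD _ _) _; rewrite geq_max l1.
have szB (f1 f2 : {poly R}) : (size f1 <= n)%N -> (size f2 <= n)%N -> (size (f1 - f2)%R <= n)%N.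
  by move=> l1 l2; apply: szD; rewrite ?size_polyN.
have sR1 : (size R1 <= n)%N.
  by apply: szD (szB _ _ (szB _ _ _ _) _) _;
    [exact: sm sg sq|exact: sm sh sq|exact: sm sg' sS|exact: sm sh' sS].
have sR2 : (size R2 <= n)%N.
  by apply: szB (szB _ _ (szD _ _ _ _) _) _;
    [exact: sm sg sq|exact: sm sh sq|exact: sm sh' sS|exact: sm sg' sS].
have qE : q = p1%:P + (('X - a%:P) * g + b%:P * h) by rewrite -e1'; ring.
have p2E : p2%:P = - (('X - a%:P) * h - b%:P * g) by rewrite -e2'; ring.
have SE : S = s1%:P + (('X - a%:P) * g' + b%:P * h') by rewrite -e1; ring.
have s2E : s2%:P = - (('X - a%:P) * h' - b%:P * g') by rewrite -e2; ring.
have I1 : ('X - a%:P) * R1 + b%:P * R2 = s1%:P * q - p1%:P * S.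
  by rewrite /R1 /R2 p2E s2E qE SE; ring.
have I2 : ('X - a%:P) * R2 - b%:P * R1 = s2%:P * q - p2%:P * S.
  by rewrite /R1 /R2 p2E s2E qE SE; ring.
clear e1 e2 e1' e2' qE p2E SE s2E.
clearbody R1 R2.
pose V := R1 ^+ 2 + R2 ^+ 2.
have V0 t : -1 <= t <= 1 -> 0 <= V.[t].
  by rewrite /V !hornerE addr_ge0 ?sqr_ge0.
(* U1 + i U2 is R1 + i R2 times the conjugate of q(z). Orthogonality of q removes every other term
   from the two moments of V. *)
pose U1 := p1%:P * R1 + p2%:P * R2; pose U2 := p1%:P * R2 - p2%:P * R1.
have J1 : L (('X - a%:P) * V) = - L (S * U1).
  have -> : ('X - a%:P) * V = (s1%:P * (q * R1) + s2%:P * (q * R2)) - S * U1.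
    transitivity (R1 * (('X - a%:P) * R1 + b%:P * R2) + R2 * (('X - a%:P) * R2 - b%:P * R1)).
      by rewrite /V; ring.
    by rewrite I1 I2 /U1; ring.
  by rewrite linearB linearD /= !functionalC !qorth // !mulr0 addr0 add0r.
have J2 : L (b%:P * V) = - L (S * U2).
  have -> : b%:P * V = (s1%:P * (q * R2) - s2%:P * (q * R1)) - S * U2.
    transitivity (R2 * (('X - a%:P) * R1 + b%:P * R2) - R1 * (('X - a%:P) * R2 - b%:P * R1)).
      by rewrite /V; ring.
    by rewrite I1 I2 /U2; ring.
  by rewrite !linearB /= !functionalC !qorth // !mulr0 subr0 add0r.
have UE : L (U1 ^+ 2) + L (U2 ^+ 2) = (p1 ^+ 2 + p2 ^+ 2) * L V.
  rewrite -functionalC -linearD; congr (L _).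
  by rewrite /U1 /U2 /V polyCD !polyC_exp; ring.
have := sqr_dist_le_moment (fun t t1 => proj1 (andP (hz t t1))) V0.
rewrite J1 J2 !sqrrN => main.
have c1 := functional_CauchySchwarz L_ge0 S U1.
have c2 := functional_CauchySchwarz L_ge0 S U2.
have {main c1 c2 UE J1 J2 U1 U2} rho : dlt ^+ 2 * L V ^+ 2 <= L (S ^+ 2) * ((p1 ^+ 2 + p2 ^+
  2) * L V).
  by rewrite -UE mulrDr; lra.
have V00 : 0 <= L V by exact: L_ge0.
have S00 : 0 <= L (S ^+ 2) by exact: functional_sqr_ge0.
have d20 : 0 < dlt ^+ 2 by rewrite exprn_gt0.
have {}rho : L V <= (p1 ^+ 2 + p2 ^+ 2) * L (S ^+ 2) / dlt ^+ 2.
  rewrite ler_pdivlMr //.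
  move: V00; rewrite le_eqVlt => /orP[/eqP<-|Vp].
    by rewrite mul0r mulr_ge0 // addr_ge0 ?sqr_ge0.
  rewrite -(ler_pM2r Vp); apply: le_trans (le_trans _ rho) _; rewrite le_eqVlt; apply/orP;
    left; apply/eqP; ring.
(* Pointwise, S(z) q = q(z) S + (t - z)(R1 + i R2) and |u + v|^2 <= 2 |u|^2 + 2 |v|^2; then L (q^2)
   = 1 leaves |S(z)|^2 on the left. *)
have : L ((s1 ^+ 2 + s2 ^+ 2)%:P * q ^+ 2) <=
       L ((2 * (p1 ^+ 2 + p2 ^+ 2))%:P * S ^+ 2 + (2 * Q)%:P * V).
  apply: functional_mono => // t t1.
  have /andP[_ tQ] := hz t t1.
  have E1 : s1 * q.[t] = p1 * S.[t] + ((t - a) * R1.[t] + b * R2.[t]).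
    by have H := congr1 (horner^~ t) I1; rewrite !hornerE in H; lra.
  have E2 : s2 * q.[t] = p2 * S.[t] + ((t - a) * R2.[t] - b * R1.[t]).
    by have H := congr1 (horner^~ t) I2; rewrite !hornerE in H; lra.
  have tV := V0 t t1.
  rewrite !(hornerD, hornerM, hornerC, horner_exp).
  have -> : (s1 ^+ 2 + s2 ^+ 2) * q.[t] ^+ 2 = (s1 * q.[t]) ^+ 2 + (s2 * q.[t]) ^+ 2 by ring.
  rewrite {}E1 {}E2.
  have VE : V.[t] = R1.[t] ^+ 2 + R2.[t] ^+ 2 by rewrite /V !hornerE.
  have : ((t - a) ^+ 2 + b ^+ 2) * V.[t] <= Q * V.[t] by rewrite ler_wpM2r.
  rewrite ?VE.
  set y1 := R1.[t]; set y2 := R2.[t]; set s := S.[t].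
  have := sqr_ge0 (p1 * s - ((t - a) * y1 + b * y2)).
  have := sqr_ge0 (p2 * s - ((t - a) * y2 - b * y1)).
  rewrite !expr2; lra.
rewrite functionalC q1 mulr1 linearD /= !functionalC => /le_trans; apply.
have Q0 : 0 <= Q.
  have /hz/andP[h1 h2] : -1 <= (0 : R) <= 1 by rewrite lerN10 ler01.
  by apply: le_trans h2; apply: le_trans h1; rewrite sqr_ge0.
have : Q * L V <= Q * ((p1 ^+ 2 + p2 ^+ 2) * L (S ^+ 2) / dlt ^+ 2) by rewrite ler_wpM2l.
have -> : Q * ((p1 ^+ 2 + p2 ^+ 2) * L (S ^+ 2) / dlt ^+ 2) =
  (p1 ^+ 2 + p2 ^+ 2) * L (S ^+ 2) * (Q / dlt ^+ 2) by ring.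
set Y := Q / dlt ^+ 2; lra.
Qed.

End OrthogonalLowerBound.

(** * Chebyshev polynomials and the Joukowski map *)

Fixpoint chebyshev (R : nzRingType) (n : nat) : {poly R} :=
  if n is n1.+1 then
    if n1 is n2.+1 then 2%:P * 'X * chebyshev R n1 - chebyshev R n2 else 'X
  else 1.
Section Joukowski.
Variable R : rcfType.
Implicit Types (u v : R[i]) (r t : R).

Definition joukowski u : R[i] := (u + u^-1) / 2.

Lemma normcX u n : normc (u ^+ n) = normc u ^+ n.
Proof. by elim: n => [|n IH]; rewrite ?normc1 // !exprS normcM IH. Qed.

Lemma normc_ge0 u : 0 <= normc u.
Proof. by case: u => a b; rewrite sqrtr_ge0. Qed.

Lemma normc_real t : normc t%:C%C = `|t|.
Proof. by rewrite /normc /= expr0n addr0 sqrtr_sqr. Qed.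

Lemma normc_half u : normc (u / 2) = normc u / 2.
Proof.
rewrite normcM normcV; congr (_ / _).
have -> : (2 : R[i]) = (2 : R)%:C%C by rewrite rmorph_nat.
by rewrite normc_real ger0_norm.
Qed.

Lemma normc_prod (I : Type) (s : seq I) (F : I -> R[i]) :
  normc (\prod_(i <- s) F i) = \prod_(i <- s) normc (F i).
Proof. by apply: (big_morph (@normc R)); [exact: normcM | exact: normc1]. Qed.

Lemma ler_normcB u v : normc u - normc v <= normc (u - v).
Proof.
rewrite lerBlDr; apply: le_trans (le_normcD _ _).
by rewrite subrK.
Qed.

Lemma ler_normcBD u v : normc (u - v) <= normc u + normc v.
Proof. by rewrite -(normcN v); exact: le_normcD. Qed.

(** For t = cos s take v = exp (i s), whose inverse is its conjugate. *)
Lemma exists_unit_joukowski t : -1 <= t <= 1 ->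
  exists2 v, normc v = 1 & t%:C%C = joukowski v.
Proof.
move=> /andP[t1 t2].
have h : 0 <= 1 - t ^+ 2 by nra.
have e : t ^+ 2 + Num.sqrt (1 - t ^+ 2) ^+ 2 = 1 by rewrite sqr_sqrtr //; ring.
exists (Complex t (Num.sqrt (1 - t ^+ 2))); first by rewrite /= e sqrtr1.
rewrite /joukowski; set v := Complex _ _.
have -> : v^-1 = Complex t (- Num.sqrt (1 - t ^+ 2)).
  by apply/eqP; rewrite eq_complex /= e !divr1 !eqxx.
have -> : v + Complex t (- Num.sqrt (1 - t ^+ 2)) = t%:C%C * 2.
  apply/eqP; rewrite mulr_natr mulr2n eq_complex /= subrr addr0 !eqxx //.
by rewrite mulfK // pnatr_eq0.
Qed.

Lemma joukowskiB u v : u != 0 -> v != 0 ->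
  joukowski v - joukowski u = (v - u) * (1 - (u * v)^-1) / 2.
Proof. by move=> u0 v0; rewrite /joukowski; field; rewrite u0 v0. Qed.

Lemma joukowskiB' u v : u != 0 -> v != 0 ->
  joukowski v - joukowski u = (v - u) * (u - v^-1) / u / 2.
Proof. by move=> u0 v0; rewrite /joukowski; field; rewrite u0 v0. Qed.

Lemma normc_gt0_neq0 u : 0 < normc u -> u != 0.
Proof. by apply: contraTneq => ->; rewrite normc0 ltxx. Qed.

Lemma joukowski_dist u r t : normc u = r -> 1 < r -> -1 <= t <= 1 ->
  (r - 1) * (1 - r^-1) / 2 <= normc (t%:C%C - joukowski u) <= (r + 1) * (1 + r^-1) / 2.
Proof.
move=> ur r1 t1; have [v v1 ->] := exists_unit_joukowski t1.
have r0 : 0 < r by apply: lt_trans r1.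
rewrite joukowskiB ?normc_gt0_neq0 ?ur ?v1 // normc_half.
have rV : r^-1 < 1 by rewrite invf_lt1.
have rV0 : 0 < r^-1 by rewrite invr_gt0.
have e1 : normc (u * v)^-1 = r^-1 by rewrite normcV normcM ur v1 mulr1.
have := ler_normcB 1 (u * v)^-1; have := ler_normcBD 1 (u * v)^-1.
have := ler_normcB u v; have := ler_normcBD v u.
have -> : normc (u - v) = normc (v - u) by rewrite -normcN opprB.
rewrite normcM normc1 e1 ur v1 => h1 h2 h3 h4.
by apply/andP; split; rewrite ler_pM2r ?invr_gt0 //; apply: ler_pM => //; lra.
Qed.

Lemma sqr_dist_normc (z : R[i]) t :
  (t - complex.Re z) ^+ 2 + complex.Im z ^+ 2 = normc (t%:C%C - z) ^+ 2.
Proof. by rewrite sqr_normc_ReIm; case: z => a b /=; rewrite sub0r sqrrN. Qed.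

End Joukowski.

Lemma nat_ind2 (P : nat -> Prop) :
  P 0%N -> P 1%N -> (forall n, P n -> P n.+1 -> P n.+2) -> forall n, P n.
Proof.
move=> P0 P1 PS n; suff: P n /\ P n.+1 by case.
by elim: n => [//|n [Pn Pn1]]; split=> //; exact: PS.
Qed.

Lemma map_chebyshev (R S : nzRingType) (f : {rmorphism R -> S}) n :
  map_poly f (chebyshev R n) = chebyshev S n.
Proof.
elim/nat_ind2: n => [||n IH IH1]; rewrite ?rmorph1 ?map_polyX //.
by rewrite [chebyshev R _.+2]/= rmorphB !rmorphM /= map_polyX map_polyC /= IH IH1 rmorph_nat.
Qed.

Lemma size_chebyshev (R : numDomainType) n : size (chebyshev R n) = n.+1.
Proof.
elim/nat_ind2: n => [||n IH IH1]; rewrite ?size_poly1 ?size_polyX //.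
rewrite [chebyshev R _.+2]/=.
have s2 : size (2%:P * 'X * chebyshev R n.+1 : {poly R}) = n.+3.
  rewrite -mulrA mul_polyC size_scale ?pnatr_eq0 // mulrC size_mulX ?IH1 //.
  by rewrite -size_poly_gt0 IH1.
by rewrite size_polyDl ?size_polyN s2 // IH.
Qed.

Lemma chebyshev_joukowski (R : rcfType) (u : R[i]) n : u != 0 ->
  complex_horner (chebyshev R n) (joukowski u) = (u ^+ n + u ^- n) / 2.
Proof.
move=> u0; rewrite /complex_horner map_chebyshev.
have n2 : (2 : R[i]) != 0 by rewrite pnatr_eq0.
elim/nat_ind2: n => [||n IH IH1].
- by rewrite hornerC !expr0 invr1; field.
- by rewrite hornerX !expr1.
- rewrite [chebyshev _ _.+2]/= hornerD hornerN IH.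
  rewrite !hornerM hornerX hornerC IH1 /joukowski.
  have -> : u ^- n.+2 = u ^- n * u^-1 * u^-1 by rewrite !exprS; field; rewrite u0 expf_neq0.
  have -> : u ^- n.+1 = u ^- n * u^-1 by rewrite !exprS; field; rewrite u0 expf_neq0.
  rewrite !exprS; field; rewrite ?n2 ?u0 ?expf_neq0 //.
Qed.

Lemma chebyshev_cos (R : realType) (t : R) n :
  (chebyshev R n).[cos t] = cos (n%:R * t).
Proof.
elim/nat_ind2: n => [||n IH IH1].
- by rewrite hornerC mul0r cos0.
- by rewrite hornerX mul1r.
- rewrite [chebyshev _ _.+2]/= hornerD hornerN IH.
  rewrite !hornerM hornerX hornerC IH1.
  have -> : n.+2%:R * t = n.+1%:R * t + t by rewrite -(natr1 n.+1); ring.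
  have -> : n%:R * t = n.+1%:R * t - t by rewrite -(natr1 n); ring.
  rewrite cosB cosD; ring.
Qed.

Lemma chebyshev_bounded (R : realType) (x : R) n : -1 <= x <= 1 ->
  -1 <= (chebyshev R n).[x] <= 1.
Proof.
move=> x1; rewrite -(acosK (x1 : x \in `[-1, 1])) chebyshev_cos.
by rewrite cos_geN1 cos_le1.
Qed.

(** For n >= 1 one has r^-n <= r^(n-2), so the term u^-n costs at most the factor 1 - r^-2. For n =
    0 the difference r^n - r^-n vanishes, and the value 1 is used directly. *)
Lemma normc_chebyshev_ge (R : rcfType) (u : R[i]) r n : normc u = r -> 1 < r ->
  (1 - r ^- 2) / 2 * r ^+ n <= normc (complex_horner (chebyshev R n) (joukowski u)).
Proof.
move=> ur r1; have r0 : 0 < r by apply: lt_trans r1.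
have u0 : u != 0 by apply: normc_gt0_neq0; rewrite ur.
rewrite chebyshev_joukowski //.
have rV : 0 < r^-1 < 1 by rewrite invr_gt0 r0 invf_lt1.
case: n => [|n].
  rewrite !expr0 invr1 -(natrD _ 1 1) divff ?pnatr_eq0 // normc1 mulr1.
  rewrite -exprVn expr2; nra.
rewrite normc_half mulrAC ler_pM2r ?invr_gt0 // mulrBl mul1r.
have := ler_normcB (u ^+ n.+1) (- u ^- n.+1).
rewrite normcN normcV !normcX ur opprK; apply: le_trans.
rewrite lerD2l lerN2 -!exprVn.
have : r^-1 ^+ n <= 1 by rewrite exprn_ile1 //; lra.
have : 1 <= r ^+ n by rewrite exprn_ege1 // ltW.
have -> : r^-1 ^+ 2 * r ^+ n.+1 = r^-1 * r ^+ n by rewrite !exprS; field; rewrite gt_eqF.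
rewrite exprS ler_pM2l //; last lra. lra.
Qed.

Lemma poly_expansion (F : fieldType) (p : nat -> {poly F}) :
  (forall n, size (p n) = n.+1) -> forall n (f : {poly F}), (size f <= n)%N ->
  exists c : nat -> F, f = \sum_(k < n) c k *: p k.
Proof.
move=> sp; elim=> [|n IH] f sf.
  exists (fun=> 0); rewrite big_ord0.
  by apply/eqP; rewrite -size_poly_eq0 -leqn0.
pose a := f`_n / lead_coef (p n).
have ln : lead_coef (p n) != 0 by rewrite lead_coef_eq0 -size_poly_eq0 sp.
have /IH[c cE] : (size (f - a *: p n)%R <= n)%N.
  apply/leq_sizeP => j; rewrite leq_eqVlt => /orP[/eqP<-|nj].
    rewrite coefB coefZ.
    have -> : (p n)`_n = lead_coef (p n) by rewrite lead_coefE sp.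
    by rewrite divfK // subrr.
  rewrite coefB coefZ !nth_default ?mulr0 ?subrr ?sp //.
  exact: leq_trans sf _.
exists (fun k => if k == n then a else c k).
rewrite big_ord_recr /= eqxx -[LHS](subrK (a *: p n)) cE; congr (_ + _).
by apply: eq_bigr => i _; rewrite ltn_eqF.
Qed.

(** * Orthonormal families: expansion, lower bound off [-1, 1], location of the zeros *)

Definition orthonormal_for (R : numDomainType) (L : {poly R} -> R)
    (p : nat -> {poly R}) :=
  (forall n, size (p n) = n.+1 /\ 0 < lead_coef (p n)) /\
  forall n m, L (p n * p m) = (n == m)%:R.

Section Orthonormal.
Variables (R : realType) (L : {scalar {poly R}}) (p : nat -> {poly R}).
Hypothesis L_ge0 : positive_on_unit L.
Hypothesis p_on : orthonormal_for L p.

Lemma orthonormal_expansion n (f : {poly R}) : (size f <= n)%N ->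
  f = \sum_(k < n) L (p k * f) *: p k.
Proof.
have [sp op] := p_on.
move=> /(poly_expansion (fun k => proj1 (sp k)))[c cE].
rewrite {1}cE; apply: eq_bigr => k _; congr (_ *: _).
rewrite cE mulr_sumr linear_sum /= (bigD1 k) //= big1 ?addr0.
  by rewrite -scalerAr linearZ /= op eqxx mulr1.
by move=> i ik; rewrite -scalerAr linearZ /= op eq_sym val_eqE (negbTE ik) mulr0.
Qed.

Lemma orthonormal_low n (f : {poly R}) : (size f <= n)%N -> L (p n * f) = 0.
Proof.
move=> sf; rewrite (orthonormal_expansion sf) mulr_sumr linear_sum big1 //= => i _.
by rewrite -scalerAr linearZ /= p_on.2 gtn_eqF ?mulr0.
Qed.

(** This is [orthogonal_lower_bound] with S the n-th Chebyshev polynomial: L (S^2) <= L 1 since |S|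
    <= 1 on [-1, 1], while S has size r^n at the point. The constants [dlt] and [Q] come from
    [joukowski_dist] and depend on r only. *)
Lemma normc_orthonormal_ge r : 1 < r -> exists2 c : R, 0 < c &
  forall n u, normc u = r -> c * r ^+ n <= normc (complex_horner (p n) (joukowski u)).
Proof.
move=> r1; have r0 : 0 < r by apply: lt_trans r1.
have rV : 0 < r^-1 < 1 by rewrite invr_gt0 r0 invf_lt1.
pose dlt := (r - 1) * (1 - r^-1) / 2; pose Q := ((r + 1) * (1 + r^-1) / 2) ^+ 2.
have dlt0 : 0 < dlt by rewrite divr_gt0 // mulr_gt0 //; lra.
have L10 : 0 <= L 1 by apply: L_ge0 => x _; rewrite hornerC.
pose D := 2 * (L 1 + 1) * (1 + Q / dlt ^+ 2).
have DQ : 0 < 1 + Q / dlt ^+ 2.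
  by rewrite ltr_pwDl // divr_ge0 ?sqr_ge0.
have D0 : 0 < D by rewrite !mulr_gt0 //; lra.
pose c1 := (1 - r ^- 2) / 2.
have c10 : 0 < c1 by rewrite divr_gt0 // subr_gt0 -exprVn; rewrite expr2; nra.
exists (c1 / Num.sqrt D); first by rewrite divr_gt0 // sqrtr_gt0.
move=> n u ur.
have main := @orthogonal_lower_bound R L L_ge0 n (p n) (chebyshev R n)
  (joukowski u) dlt Q.
have sp : size (p n) = n.+1 by apply: (p_on.1 n).1.
have := normc_chebyshev_ge n ur r1; rewrite -/c1 => hT.
have {main} := main _ _ _ _ dlt0.
rewrite sp size_chebyshev => /(_ (ltnSn n) (ltnSn n) (@orthonormal_low n)).
rewrite expr2 p_on.2 eqxx => /(_ erefl).
have dQ t : -1 <= t <= 1 -> dlt ^+ 2 <= (t - complex.Re (joukowski u)) ^+ 2 +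
    complex.Im (joukowski u) ^+ 2 <= Q.
  move=> t1; rewrite sqr_dist_normc; have /andP[h1 h2] := joukowski_dist ur r1 t1.
  by rewrite !ler_pXn2r ?nnegrE ?normc_ge0 ?h1 ?h2 ?(ltW dlt0) // (le_trans _ h2) // normc_ge0.
move=> /(_ dQ).
have LT : L (chebyshev R n ^+ 2) <= L 1.
  apply: functional_mono => // x x1; rewrite horner_exp hornerC.
  by have := chebyshev_bounded n x1; nra.
set q := normc (complex_horner (p n) _) => hq.
have q0 : 0 <= q by exact: normc_ge0.
have hqD : (c1 * r ^+ n) ^+ 2 <= q ^+ 2 * D.
  apply: (le_trans (_ : _ <= normc (complex_horner (chebyshev R n) (joukowski u)) ^+ 2)).
    by rewrite ler_pXn2r ?nnegrE ?normc_ge0 // mulr_ge0 ?exprn_ge0 // ltW.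
  apply: (le_trans hq).
  have : L (chebyshev R n ^+ 2) * (1 + Q / dlt ^+ 2) <= (L 1 + 1) * (1 + Q / dlt ^+ 2).
    by rewrite ler_pM2r //; lra.
  have : 0 <= q ^+ 2 by rewrite sqr_ge0.
  by rewrite /D => qq h; have := ler_wpM2l qq h; lra.
rewrite mulrAC ler_pdivrMr ?sqrtr_gt0 //.
have c1r : 0 <= c1 * r ^+ n by apply: mulr_ge0; [exact: ltW | rewrite exprn_ge0 // ltW].
rewrite -(@ler_pXn2r _ 2) ?nnegrE ?c1r // ?mulr_ge0 ?sqrtr_ge0 //.
by rewrite [leRHS]exprMn sqr_sqrtr // ltW.
Qed.

(** At a zero at positive distance from [-1, 1], [orthogonal_lower_bound] with S = 1 would read 1 <=
    0. This excludes nonreal zeros and real zeros outside the interval at once. *)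
Lemma orthonormal_root n (z : R[i]) : complex_horner (p n) z = 0 ->
  complex.Im z = 0 /\ -1 <= complex.Re z <= 1.
Proof.
move=> pz0; apply: contrapT => nz.
have [dlt dlt0 hd] : exists2 dlt : R, 0 < dlt &
    forall t, -1 <= t <= 1 -> dlt ^+ 2 <= (t - complex.Re z) ^+ 2 + complex.Im z ^+ 2.
  have [b0|b0] := eqVneq (complex.Im z) 0; last first.
    exists `|complex.Im z|; first by rewrite normr_gt0.
    by move=> t _; rewrite real_normK ?num_real // lerDr sqr_ge0.
  have [a1|a1] := ltP 1 (complex.Re z).
    exists (complex.Re z - 1); first by rewrite subr_gt0.
    by move=> t /andP[t1 t2]; rewrite b0 expr0n addr0 !expr2; nra.
  have [a2|a2] := ltP (complex.Re z) (-1).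
    exists (- 1 - complex.Re z); first by rewrite subr_gt0.
    by move=> t /andP[t1 t2]; rewrite b0 expr0n addr0 !expr2; nra.
  by exfalso; apply: nz; rewrite b0 a1 a2.
pose Q := (1 + `|complex.Re z|) ^+ 2 + complex.Im z ^+ 2.
have hQ t : -1 <= t <= 1 -> (t - complex.Re z) ^+ 2 + complex.Im z ^+ 2 <= Q.
  move=> t1; rewrite lerD2r -[leLHS]real_normK ?num_real //.
  rewrite ler_pXn2r ?nnegrE // ?addr_ge0 // (le_trans (ler_normB _ _)) // lerD2r.
  by rewrite ler_norml.
have := @orthogonal_lower_bound R L L_ge0 n (p n) 1 z dlt Q.
have sp : size (p n) = n.+1 by apply: (p_on.1 n).1.
rewrite sp size_poly1 expr2 p_on.2 eqxx.
move=> /(_ (ltnSn n) isT (@orthonormal_low n) erefl dlt0).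
rewrite pz0 normc0 expr0n mulr0 !mul0r /complex_horner rmorph1 hornerC normc1 expr1n.
rewrite ler10 => /(_ _)/negP; apply => // t t1.
by rewrite hd ?hQ.
Qed.

Lemma orthonormal_factor n : exists rs : seq R,
  [/\ size rs = n, forall x, x \in rs -> -1 <= x <= 1 &
      forall z, complex_horner (p n) z =
        (lead_coef (p n))%:C%C * \prod_(x <- rs) (z - x%:C%C)].
Proof.
pose q := map_poly (real_complex R) (p n).
have [rs0 qE] := closed_field_poly_normal q.
have lq : lead_coef q = (lead_coef (p n))%:C%C by rewrite lead_coef_map.
have sq : size q = n.+1 by rewrite size_map_poly (p_on.1 n).1.
have l0 : lead_coef q != 0 by rewrite lead_coef_eq0 -size_poly_eq0 sq.
have rsR z : z \in rs0 -> z = (complex.Re z)%:C%C /\ -1 <= complex.Re z <= 1.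
  move=> zr; have : root q z by rewrite qE rootZ // root_prod_XsubC.
  move=> /rootP /orthonormal_root [z1 z2]; split=> //.
  by case: z z1 {z2 zr} => a b /= ->.
exists (map (@complex.Re R) rs0); split.
- rewrite size_map; apply/eqP; rewrite -eqSS -sq qE size_scale //.
  by rewrite size_prod_XsubC.
- by move=> x /mapP[z /rsR[_ ?] ->].
- move=> z; rewrite /complex_horner -/q qE hornerZ -lq horner_prod big_map; congr (_ * _).
  apply: eq_big_seq => x /rsR[xE _].
  by rewrite hornerXsubC {1}xE.
Qed.

End Orthonormal.

(** * Upper bounds from products over the solutions of u^M = u0^M *)

Section BigProd.
Variables (R : numDomainType) (I : eqType).

Lemma prodr_seq_le (s : seq I) (F : I -> R) b :
  (forall i, i \in s -> 0 <= F i <= b) -> \prod_(i <- s) F i <= b ^+ size s.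
Proof.
elim: s => [|i s IH] h; rewrite ?big_nil // big_cons exprS.
have [i0 ib] := andP (h i (mem_head _ _)).
have hs j : j \in s -> 0 <= F j <= b by move=> js; apply: h; rewrite in_cons js orbT.
apply: ler_pM => //; last exact: IH.
by rewrite big_seq; apply: prodr_ge0 => j /hs /andP[].
Qed.

Lemma prodr_seq_ge (s : seq I) (F : I -> R) a : 0 <= a ->
  (forall i, i \in s -> a <= F i) -> a ^+ size s <= \prod_(i <- s) F i.
Proof.
move=> a0; elim: s => [|i s IH] h; rewrite ?big_nil // big_cons exprS.
have hs j : j \in s -> a <= F j by move=> js; apply: h; rewrite in_cons js orbT.
by apply: ler_pM; rewrite ?exprn_ge0 //; [apply: h; rewrite mem_head | exact: IH].
Qed.

End BigProd.

Lemma prodr_const_size (R : pzSemiRingType) (I : Type) (s : seq I) (b : R) :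
  \prod_(i <- s) b = b ^+ size s.
Proof. by elim: s => [|i s IH]; rewrite ?big_nil // big_cons IH exprS. Qed.

(* For |v| = 1 and u running over the M-th roots of u0 ^ M, the differences
   joukowski v - joukowski u = (v - u) (u - 1/v) / (2 u) multiply up to
   (v^M - u0^M) (v^-M - u0^M) / (2^M prod u), up to sign. *)
Lemma prod_joukowski_le (R : rcfType) (u0 : R[i]) (r x : R) (us : seq R[i]) :
  normc u0 = r -> 1 < r ->
  'X^(size us) - (u0 ^+ size us)%:P = \prod_(u <- us) ('X - u%:P) ->
  (forall u, u \in us -> normc u = r) -> -1 <= x <= 1 ->
  \prod_(u <- us) normc (joukowski u - x%:C%C) <=
    (r / 2) ^+ size us * (1 + r ^- size us) ^+ 2.
Proof.
move=> u0r r1 usE usr x1; have [v v1 ->] := exists_unit_joukowski x1.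
have r0 : 0 < r by apply: lt_trans r1.
have v0 : v != 0 by apply: normc_gt0_neq0; rewrite v1.
have ev (w : R[i]) : normc w = 1 ->
    \prod_(u <- us) normc (w - u) <= 1 + r ^+ size us.
  move=> w1; rewrite -normc_prod.
  have -> : \prod_(u <- us) (w - u) = w ^+ size us - u0 ^+ size us.
    have := congr1 (horner^~ w) usE; rewrite horner_prod.
    under eq_bigr do rewrite hornerXsubC.
    by move=> <-; rewrite hornerD hornerN hornerXn hornerC.
  by apply: le_trans (ler_normcBD _ _) _; rewrite !normcX w1 u0r expr1n.
rewrite (eq_big_seq (fun u => normc (v - u) * normc (v^-1 - u) * (r^-1 / 2))); last first.
  move=> u uu; have u0' : u != 0 by apply: normc_gt0_neq0; rewrite usr.
  rewrite -normcN opprB joukowskiB' // normc_half !normcM normcV (usr _ uu).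
  by rewrite -(normcN (u - _)) opprB -!mulrA.
rewrite big_split big_split /= prodr_const_size.
have -> : (r / 2) ^+ size us * (1 + r ^- size us) ^+ 2 =
   (1 + r ^+ size us) * (1 + r ^+ size us) * (r^-1 / 2) ^+ size us.
  by rewrite !exprMn !exprVn; field; rewrite !expf_neq0 ?gt_eqF.
apply: ler_wpM2r; first by rewrite exprn_ge0 // divr_ge0 // invr_ge0 ltW.
apply: ler_pM; try by apply: prodr_ge0 => i _; rewrite normc_ge0.
  exact: ev.
by apply: ev; rewrite normcV v1 invr1.
Qed.

(** The circle |u| = r is mapped to an ellipse with horizontal semi-axis (r + 1/r) / 2 >= 1, so its
    vertical projection covers [-1, 1]; k is the cosine of the argument of u. *)
Lemma exists_joukowski_above (R : rcfType) (r y : R) : 1 < r -> -1 <= y <= 1 ->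
  exists2 u : R[i], normc u = r & complex.Re (joukowski u) = y.
Proof.
move=> r1 /andP[y1 y2]; have r0 : 0 < r by apply: lt_trans r1.
have rV0 : 0 < r^-1 by rewrite invr_gt0.
have A1 : 1 <= (r + r^-1) / 2.
  have -> : (r + r^-1) / 2 = 1 + (r - 1) ^+ 2 * r^-1 / 2.
    by field; rewrite gt_eqF.
  by rewrite lerDl divr_ge0 // mulr_ge0 ?sqr_ge0 // ltW.
pose k := y / ((r + r^-1) / 2).
have k1 : -1 <= k <= 1.
  rewrite /k ler_pdivlMr ?ler_pdivrMr; lra.
have k2 : 0 <= 1 - k ^+ 2 by nra.
pose s := Num.sqrt (1 - k ^+ 2).
have ks : k ^+ 2 + s ^+ 2 = 1 by rewrite sqr_sqrtr //; ring.
have e : (r * k) ^+ 2 + (r * s) ^+ 2 = r ^+ 2 by rewrite -[RHS]mulr1 -ks; ring.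
exists (Complex (r * k) (r * s)); first by rewrite /= e sqrtr_sqr gtr0_norm.
have -> : joukowski (Complex (r * k) (r * s)) =
  (Complex (r * k) (r * s) + Complex (r * k / r ^+ 2) (- (r * s) / r ^+ 2)) * (2^-1)%:C%C.
  rewrite /joukowski; congr ((_ + _) * _).
    by apply/eqP; rewrite eq_complex /= e mulNr !eqxx.
  by rewrite fmorphV rmorph_nat.
rewrite /= mulr0 subr0 /k; field.
by rewrite gt_eqF //= gt_eqF // ltr_wpDl // sqr_ge0.
Qed.

Section Regularity.
Variables (R : realType) (L : {scalar {poly R}}) (p : nat -> {poly R}).
Hypothesis L_ge0 : positive_on_unit L.
Hypothesis p_on : orthonormal_for L p.

(* A discrete Harnack inequality: the product of |p n| over the points joukowski u
   with u ^ M.+1 fixed is controlled by the leading coefficient, and each of the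
   other factors is bounded below by normc_orthonormal_ge. *)
Lemma normc_orthonormal_le r M : 1 < r -> exists2 C : R, 0 < C &
  forall n u, normc u = r -> normc (complex_horner (p n) (joukowski u)) <=
    C * ((lead_coef (p n) / 2 ^+ n) ^+ M.+1 * r ^+ n * ((1 + r ^- M.+1) ^+ 2) ^+ n).
Proof.
move=> r1; have r0 : 0 < r by apply: lt_trans r1.
have [c c0 hc] := normc_orthonormal_ge L_ge0 p_on r1.
exists (c ^- M); first by rewrite invr_gt0 exprn_gt0.
move=> n u0 u0r.
have [us usE] := closed_field_poly_normal ('X^(M.+1) - (u0 ^+ M.+1)%:P).
rewrite lead_coefXnsubC // scale1r in usE.
have sus : size us = M.+1.
  by apply/eqP; rewrite -eqSS -(size_prod_XsubC us id) -usE size_XnsubC.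
have rootE u : (u \in us) = (u ^+ M.+1 == u0 ^+ M.+1).
  by rewrite -root_prod_XsubC -usE rootE !hornerE subr_eq0.
have usr u : u \in us -> normc u = r.
  rewrite rootE => /eqP /(congr1 (@normc R)); rewrite !normcX u0r => /eqP.
  by rewrite eqrXn2 ?normc_ge0 ?(ltW r0) // => /eqP.
have u0us : u0 \in us by rewrite rootE.
rewrite -sus in usE.
have [rs [srs rs1 pE]] := orthonormal_factor L_ge0 p_on n.
have l0 : 0 < lead_coef (p n) := (p_on.1 n).2.
pose B := (r / 2) ^+ M.+1 * (1 + r ^- M.+1) ^+ 2.
have up : \prod_(u <- us) normc (complex_horner (p n) (joukowski u)) <=
    lead_coef (p n) ^+ M.+1 * B ^+ n.
  under eq_bigr do rewrite pE normcM normc_real gtr0_norm // normc_prod.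
  rewrite big_split /= prodr_const_size sus ler_wpM2l ?exprn_ge0 ?(ltW l0) //.
  rewrite exchange_big /= -srs; apply: prodr_seq_le => x xrs.
  rewrite prodr_ge0 => [|u _]; last exact: normc_ge0.
  by have := prod_joukowski_le u0r r1 usE usr (rs1 x xrs); rewrite sus.
have := up; rewrite (big_rem u0) //= => {}up.
have lo : (c * r ^+ n) ^+ M <=
   \prod_(u <- rem u0 us) normc (complex_horner (p n) (joukowski u)).
  have -> : M = size (rem u0 us) by rewrite size_rem // sus.
  apply: prodr_seq_ge => [|u /mem_rem /usr]; last exact: hc.
  by rewrite mulr_ge0 ?exprn_ge0 // ltW.
have cr0 : 0 < (c * r ^+ n) ^+ M by rewrite exprn_gt0 // mulr_gt0 // exprn_gt0.
rewrite -(ler_pM2r cr0); apply: le_trans (le_trans _ up) _.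
  by apply: ler_wpM2l => //; exact: normc_ge0.
rewrite le_eqVlt; apply/orP; left; apply/eqP.
rewrite /B; clear up lo cr0 B; move: ((1 + r ^- M.+1) ^+ 2) => E.
have -> : ((r / 2) ^+ M.+1 * E) ^+ n = (r ^+ n) ^+ M.+1 / (2 ^+ n) ^+ M.+1 * E ^+ n.
  by rewrite !exprMn !exprVn [r ^+ _ ^+ _]exprAC [2 ^+ _ ^+ _]exprAC.
have -> : (lead_coef (p n) / 2 ^+ n) ^+ M.+1 = lead_coef (p n) ^+ M.+1 / (2 ^+ n) ^+ M.+1.
  by rewrite exprMn exprVn.
rewrite [(c * _) ^+ M]exprMn [(r ^+ n) ^+ M.+1]exprS.
by field; rewrite !expf_neq0 ?gt_eqF.
Qed.

Lemma orthonormal_le_above n y z : complex.Re z = y ->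
  `|(p n).[y]| <= normc (complex_horner (p n) z).
Proof.
have [rs [_ rs1 pE]] := orthonormal_factor L_ge0 p_on n => zy.
have -> : `|(p n).[y]| = normc (complex_horner (p n) y%:C%C).
  by rewrite /complex_horner horner_map normc_real.
rewrite !pE !normcM !normc_prod; apply: ler_wpM2l; first exact: normc_ge0.
apply: ler_prod => x _; rewrite normc_ge0 /=.
rewrite -(@ler_pXn2r _ 2) ?nnegrE ?normc_ge0 // !sqr_normc_ReIm -zy.
by case: z {zy} => a b /=; rewrite !subr0 expr0n /= addr0 sqr_sqrtr ?sqr_ge0 // lerDl sqr_ge0.
Qed.

Hypothesis p_regular : forall rho : R, 1 < rho ->
  \forall n \near \oo, lead_coef (p n) <= (2 * rho) ^+ n.

Lemma orthonormal_subexponential rho : 1 < rho -> exists2 C : R, 0 < C &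
  forall n y, -1 <= y <= 1 -> `|(p n).[y]| <= C * rho ^+ n.
Proof.
move=> rho1; have rho0 : 0 < rho by apply: lt_trans rho1.
have lr : 0 < ln rho by rewrite ln_gt0.
(* One factor r^n is spent on |u|^n, one on the power of the leading coefficient, one on the error
   (1 + r^-(M+1))^(2n). *)
pose r := expR (ln rho / 3).
have r1 : 1 < r by rewrite expR_gt1 divr_gt0.
have r0 : 0 < r by rewrite expR_gt0.
have r3 : r ^+ 3 = rho by rewrite -expRM_natl mulrC divfK ?pnatr_eq0 // lnK.
(* For q = r^-(M+1) <= 1 one has (1 + q)^2 <= 1 + 3 q, so 3 q <= r - 1 is enough; Bernoulli's
   inequality provides such an M. *)
have [M hM] : exists M, (1 + r ^- M.+1) ^+ 2 <= r.
  have [M hM] : exists M, 3 * r ^- M.+1 <= r - 1.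
    have hb k : 1 + k%:R * (r - 1) <= r ^+ k.
      elim: k => [|k IH]; first by rewrite mul0r addr0.
      rewrite exprS -natr1; have := ler_wpM2l (ltW r0) IH.
      have : 0 <= k%:R * (r - 1) ^+ 2 by rewrite mulr_ge0 ?sqr_ge0.
      lra.
    have [M hM] : exists M : nat, 3 / (r - 1) ^+ 2 < M%:R.
      by eexists; apply: archi_boundP; rewrite divr_ge0 ?sqr_ge0.
    exists M; rewrite ler_pdivrMr ?exprn_gt0 //.
    rewrite ltr_pdivrMr ?exprn_gt0 ?subr_gt0 // expr2 in hM.
    have r10 : 0 <= r - 1 by lra.
    have := ler_wpM2l r10 (hb M.+1); rewrite -natr1.
    have : 0 <= (r - 1) * (r - 1) by rewrite mulr_ge0.
    lra.
  exists M.
  have : 0 < r ^- M.+1 by rewrite invr_gt0 exprn_gt0.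
  have : r ^- M.+1 <= 1 by rewrite invf_le1 ?exprn_gt0 // exprn_ege1 // ltW.
  nra.
(* The leading coefficient enters to the power M + 1, so regularity is used at the rate s with
   s^(M+1) = r, once M is fixed. *)
pose s := expR (ln r / M.+1%:R).
have s1 : 1 < s by rewrite expR_gt1 divr_gt0 // ln_gt0.
have sM : s ^+ M.+1 = r by rewrite -expRM_natl mulrC divfK ?pnatr_eq0 // lnK.
have [C C0 hC] := normc_orthonormal_le M r1.
have [N _ hN] := p_regular s1.
(* The sums of absolute coefficients cover the finitely many n < N that the asymptotic bound does
   not reach. *)
pose C' := C + \sum_(k < N) \sum_(i < size (p k)) `|(p k)`_i|.
have S0 : 0 <= \sum_(k < N) \sum_(i < size (p k)) `|(p k)`_i|.
  by apply: sumr_ge0 => k _; exact: sumr_ge0.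
exists C'; first by rewrite ltr_wpDr.
move=> n y y1; have rn1 : 1 <= rho ^+ n by rewrite exprn_ege1 // ltW.
have [nN|Nn] := ltnP n N.
  apply: (@le_trans _ _ (\sum_(i < size (p n)) `|(p n)`_i|)).
    rewrite horner_coef; apply: le_trans (ler_norm_sum _ _ _) _.
    apply: ler_sum => i _; rewrite normrM ler_piMr // normrX exprn_ile1 //.
    by rewrite ler_norml.
  apply: (@le_trans _ _ C').
    rewrite /C' (bigD1 (Ordinal nN)) //= addrCA lerDl addr_ge0 ?(ltW C0) //.
    by apply: sumr_ge0 => k _; exact: sumr_ge0.
  by rewrite ler_peMr // addr_ge0 // ltW.
have [u ur uy] := exists_joukowski_above r1 y1.
apply: le_trans (orthonormal_le_above n uy) _.
apply: le_trans (hC n u ur) _.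
have a0 : 0 <= lead_coef (p n) / 2 ^+ n.
  by rewrite divr_ge0 ?exprn_ge0 // ltW // (p_on.1 n).2.
have ha : (lead_coef (p n) / 2 ^+ n) ^+ M.+1 <= r ^+ n.
  rewrite -sM -exprM mulnC exprM lerXn2r ?nnegrE ?exprn_ge0 ?(ltW (lt_trans _ s1)) //.
  by rewrite ler_pdivrMr ?exprn_gt0 // -exprMn mulrC hN.
have hb : ((1 + r ^- M.+1) ^+ 2) ^+ n <= r ^+ n.
  by rewrite lerXn2r ?nnegrE ?sqr_ge0 // ltW.
apply: ler_pM; rewrite ?(ltW C0) ?lerDl //.
  by do ?[exact: a0|exact: sqr_ge0|apply: mulr_ge0|apply: exprn_ge0|exact: ltW].
have -> : rho ^+ n = r ^+ n * r ^+ n * r ^+ n by rewrite -r3 exprAC !exprS expr0 mulr1 mulrA.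
by apply: ler_pM => //; [by do ?[exact: a0|apply: mulr_ge0|apply: exprn_ge0|exact: ltW]
  |by rewrite exprn_ge0 ?sqr_ge0|by rewrite ler_pM2r // exprn_gt0].
Qed.

End Regularity.

(** * Reproducing kernels and the Chebyshev kernel *)

Definition kernel_poly (R : realType) (p : nat -> {poly R}) n x : {poly R} :=
  \sum_(0 <= k < n) (p k).[x] *: p k.

Lemma horner_kernel_poly (R : realType) (p : nat -> {poly R}) n x y :
  (kernel_poly p n x).[y] = reproducing_kernel p n x y.
Proof. by rewrite horner_sum; apply: eq_bigr => k _; rewrite hornerZ. Qed.

Section ReproducingKernel.
Variables (R : realType) (L : {scalar {poly R}}) (p : nat -> {poly R}).
Hypothesis L_ge0 : positive_on_unit L.
Hypothesis p_on : orthonormal_for L p.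
Local Notation K := (reproducing_kernel p).

Lemma size_kernel_poly n x : (size (kernel_poly p n x) <= n)%N.
Proof.
rewrite /kernel_poly big_nat; elim/big_ind: _ => [|f g sf sg|k /andP[_ kn]].
- by rewrite size_poly0.
- by apply: leq_trans (size_polyD _ _) _; rewrite geq_max sf sg.
- by apply: leq_trans (size_scale_leq _ _) _; rewrite (p_on.1 k).1.
Qed.

Lemma kernel_poly_reproducing n (f : {poly R}) x : (size f <= n)%N ->
  L (kernel_poly p n x * f) = f.[x].
Proof.
move=> sf; rewrite {2}(orthonormal_expansion p_on sf) horner_sum.
rewrite /kernel_poly mulr_suml linear_sum /= big_mkord; apply: eq_bigr => k _.
by rewrite -scalerAl linearZ hornerZ /= mulrC.
Qed.

Lemma kernel_poly_sqr n x : L (kernel_poly p n x ^+ 2) = K n x x.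
Proof.
by rewrite expr2 kernel_poly_reproducing ?size_kernel_poly // horner_kernel_poly.
Qed.

(** The extremal property of K_n(x,x), the inverse of the Christoffel function. Applied to L it
    bounds the kernel of mu from below; applied to E with a localized test polynomial it leads to
    the upper bound. *)
Lemma sqr_horner_le n (f : {poly R}) x : (size f <= n)%N ->
  f.[x] ^+ 2 <= K n x x * L (f ^+ 2).
Proof.
move=> sf; rewrite -(kernel_poly_reproducing x sf) -kernel_poly_sqr.
exact: functional_CauchySchwarz.
Qed.

Lemma kernel_diag_ge0 n x : 0 <= K n x x.
Proof. by apply: sumr_ge0 => k _; rewrite -expr2 sqr_ge0. Qed.

Lemma sqr_kernel_le n x y : K n x y ^+ 2 <= K n x x * K n y y.
Proof.
rewrite -horner_kernel_poly mulrC -(kernel_poly_sqr n x).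
exact/sqr_horner_le/size_kernel_poly.
Qed.

(* Expanding L ((K_n(x,.) - g)^2) by the reproducing property. *)
Lemma sqr_kernel_sub_le n (g : {poly R}) x y : (size g <= n)%N ->
  (K n x y - g.[y]) ^+ 2 <= K n y y * (K n x x - 2 * g.[x] + L (g ^+ 2)).
Proof.
move=> sg; rewrite -horner_kernel_poly -hornerN -hornerD.
have sk := size_kernel_poly n x.
apply: le_trans (@sqr_horner_le n _ y _) _.
  by apply: leq_trans (size_polyD _ _) _; rewrite size_polyN geq_max sk.
rewrite le_eqVlt; apply/orP; left; apply/eqP; congr (_ * _).
rewrite sqrrB linearD linearB /= kernel_poly_sqr linearMn /=.
by rewrite kernel_poly_reproducing // mulr_natl.
Qed.

End ReproducingKernel.

(** Orthonormal for the arcsine probability measure: the square of a Chebyshev polynomial has mean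
    1/2, except in degree 0. *)
Definition chebyshev_on (R : realType) n : {poly R} :=
  (if n == 0%N then 1 else Num.sqrt 2) *: chebyshev R n.

Section ChebyshevKernel.
Variable R : realType.
Implicit Types (x y a b : R).
Local Notation K := (reproducing_kernel (@chebyshev_on R)).

Lemma chebyshev_onM k x y :
  (chebyshev_on R k).[x] * (chebyshev_on R k).[y] =
  (if k == 0%N then 1 else 2) * ((chebyshev R k).[x] * (chebyshev R k).[y]).
Proof.
rewrite /chebyshev_on; case: eqP => _; rewrite !hornerZ; first ring.
have : Num.sqrt 2 ^+ 2 = 2 :> R by rewrite sqr_sqrtr.
by move: (Num.sqrt 2) => s <-; ring.
Qed.

Lemma chebyshev_ChristoffelDarboux n x y :
  (x - y) * K n.+1 x y =
    (chebyshev R n.+1).[x] * (chebyshev R n).[y] -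
    (chebyshev R n).[x] * (chebyshev R n.+1).[y].
Proof.
elim: n => [|n IH].
  rewrite /reproducing_kernel big_nat1 chebyshev_onM /= !hornerC !hornerX; ring.
have TE : chebyshev R n.+2 = 2%:P * 'X * chebyshev R n.+1 - chebyshev R n by [].
rewrite {1}/reproducing_kernel big_nat_recr // mulrDr -/(K n.+1 x y) IH chebyshev_onM TE.
rewrite !(hornerD, hornerN, hornerM, hornerC, hornerX).
rewrite [n.+1 == _]/=; ring.
Qed.

Lemma chebyshev_kernel_off_diag n x y dlt : -1 <= x <= 1 -> -1 <= y <= 1 ->
  0 < dlt -> dlt <= `|x - y| -> `|K n x y| <= 2 / dlt.
Proof.
move=> x1 y1 d0 dxy; rewrite ler_pdivlMr //.
case: n => [|n].
  by rewrite /reproducing_kernel big_nil normr0 mul0r.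
apply: (@le_trans _ _ (`|K n.+1 x y| * `|x - y|)); first by rewrite ler_wpM2l.
rewrite -normrM mulrC chebyshev_ChristoffelDarboux.
have b k z : -1 <= z <= 1 -> `|(chebyshev R k).[z]| <= 1.
  by move=> z1; rewrite ler_norml chebyshev_bounded.
apply: le_trans (ler_normB _ _) _; rewrite !normrM.
have m1 (u v : R) : 0 <= u <= 1 -> 0 <= v <= 1 -> u * v <= 1 by move=> *; nra.
have := m1 `|(chebyshev R n.+1).[x]| `|(chebyshev R n).[y]|.
have := m1 `|(chebyshev R n).[x]| `|(chebyshev R n.+1).[y]|.
rewrite !normr_ge0 !b // => /(_ isT isT) h1 /(_ isT isT) h2.
lra.
Qed.

(** From 2 cos u cos v = cos (u - v) + cos (u + v). The term k = 0 has weight 1 instead of 2, so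
    only the first sum contains it. *)
Lemma chebyshev_kernel_cos n a b :
  K n (cos a) (cos b) = \sum_(0 <= k < n) cos (k%:R * (a - b)) +
                        \sum_(1 <= k < n) cos (k%:R * (a + b)).
Proof.
have mc (u v : R) : 2 * (cos u * cos v) = cos (u - v) + cos (u + v).
  by rewrite cosB cosD; ring.
case: n => [|n]; first by rewrite /reproducing_kernel !big_geq // addr0.
rewrite /reproducing_kernel !(big_ltn (_ : 0 < n.+1)%N) // -addrA -big_split /=.
congr (_ + _).
  by rewrite chebyshev_onM /= !hornerC mul0r cos0 !mulr1.
apply: eq_big_nat => k /andP[k0 _].
by rewrite chebyshev_onM gtn_eqF // !chebyshev_cos mc -mulrBr -mulrDr.
Qed.

Lemma cos_sum_le n a : sin (a / 2) != 0 ->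
  `|\sum_(1 <= k < n) cos (k%:R * a)| <= `|sin (a / 2)|^-1.
Proof.
move=> s0.
have ms (u v : R) : 2 * sin u * cos v = sin (v + u) - sin (v - u).
  by rewrite sinB sinD; ring.
have E m : 2 * sin (a / 2) * \sum_(1 <= k < m.+1) cos (k%:R * a) =
    sin (m%:R * a + a / 2) - sin (a / 2).
  elim: m => [|m IH]; first by rewrite big_geq // mulr0 mul0r add0r subrr.
  rewrite big_nat_recr //= mulrDr IH ms.
  have -> : m.+1%:R * a - a / 2 = m%:R * a + a / 2 by rewrite -natr1; field.
  ring.
case: n => [|n]; first by rewrite big_geq // normr0 invr_ge0.
have : `|2 * sin (a / 2) * \sum_(1 <= k < n.+1) cos (k%:R * a)| <= 2.
  rewrite E; apply: le_trans (ler_normB _ _) _.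
  have b u : `|sin u| <= 1 :> R by rewrite ler_norml sin_geN1 sin_le1.
  by have := b (n%:R * a + a / 2); have := b (a / 2); lra.
rewrite !normrM ger0_norm // -mulrA => h.
by rewrite -[leRHS]mul1r ler_pdivlMr ?normr_gt0 // mulrC; lra.
Qed.

(** At x = cos s the first sum of [chebyshev_kernel_cos] is exactly n, and the second has angle 2 s,
    hence is at most 1 / |sin s| whatever n. *)
Lemma chebyshev_kernel_diag n x : -1 < x < 1 ->
  `|K n x x - n%:R| <= (Num.sqrt (1 - x ^+ 2))^-1.
Proof.
move=> /andP[x1 x2]; have xI : x \in `[-1, 1] by rewrite in_itv /= !ltW.
have s0 : 0 < Num.sqrt (1 - x ^+ 2) by rewrite sqrtr_gt0; nra.
rewrite -{1 2}(acosK xI) chebyshev_kernel_cos subrr.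
under eq_bigr do rewrite mulr0 cos0.
rewrite sumr_const_nat subn0 addrC addKr.
have e : sin ((acos x + acos x) / 2) = Num.sqrt (1 - x ^+ 2).
  have -> : (acos x + acos x) / 2 = acos x by field.
  by rewrite sin_acos // !ltW.
by have := @cos_sum_le n (acos x + acos x); rewrite e (gtr0_norm s0) => /(_ (lt0r_neq0 s0)).
Qed.

End ChebyshevKernel.

(** * Localization and the upper bound on the diagonal *)

Section KernelUpperBound.
Variables (R : realType) (L E : {scalar {poly R}}) (p : nat -> {poly R}).
Hypotheses (L_ge0 : positive_on_unit L) (E_ge0 : positive_on_unit E).
Hypothesis p_on : orthonormal_for L p.
Hypothesis E_on : orthonormal_for E (@chebyshev_on R).
Hypothesis p_sub : forall rho : R, 1 < rho -> exists2 C : R, 0 < C &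
  forall n y, -1 <= y <= 1 -> `|(p n).[y]| <= C * rho ^+ n.
Variables (J : set R) (tau D dlt : R).
Hypotheses (tau0 : 0 < tau) (dlt0 : 0 < dlt) (dlt1 : dlt <= 1).
Hypothesis E_le : forall (f : {poly R}) B, 0 <= B ->
  (forall x, -1 <= x <= 1 -> 0 <= f.[x]) ->
  (forall x, -1 <= x <= 1 -> ~ J x -> f.[x] <= B) -> E f <= tau * L f + B.

Local Notation theta := (1 - dlt ^+ 2 / 4).
Local Notation K := (reproducing_kernel p).
Local Notation KE := (reproducing_kernel (@chebyshev_on R)).

(* Apply the bound for E-kernels to K_n(x,.) (1 - ((t-x)/2)^2)^m, which is
   tiny outside J. *)
Lemma kernel_diag_le_peak n m x S : -1 <= x <= 1 ->
  (forall t, `|t - x| < dlt -> J t) ->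
  KE (n + 2 * m) x x <= (n + 2 * m)%:R + D ->
  (forall t, -1 <= t <= 1 -> K n t t <= S) ->
  K n x x <= ((n + 2 * m)%:R + D) * (tau + theta ^+ (2 * m) * S).
Proof.
move=> x1 xJ hN hS.
have k0 : 0 <= K n x x by exact: kernel_diag_ge0.
have S0 : 0 <= S := le_trans k0 (hS x x1).
have d21 : dlt ^+ 2 <= 1 by rewrite exprn_ile1 // ltW.
have th0 : 0 <= theta by lra.
have KE0 : 0 <= KE (n + 2 * m) x x by exact: kernel_diag_ge0.
have X0 : 0 <= tau + theta ^+ (2 * m) * S.
  by rewrite addr_ge0 ?(ltW tau0) // mulr_ge0 // exprn_ge0.
move: (k0); rewrite le_eqVlt => /orP[/eqP<-|kp].
  by rewrite mulr_ge0 // (le_trans KE0).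
(* Since |t - x| <= 2, halving keeps h in [0, 1] on [-1, 1]; [theta] is the bound for h at distance
   at least dlt from x. *)
pose h : {poly R} := 1 - ((2^-1)%:P * ('X - x%:P)) ^+ 2.
have hE t : h.[t] = 1 - ((t - x) / 2) ^+ 2 by rewrite /h !hornerE; ring.
have h01 t : -1 <= t <= 1 -> 0 <= h.[t] <= 1.
  rewrite hE => t1; have /andP[s1 s2] : -1 <= (t - x) / 2 <= 1.
    by move: t1 x1 => /andP[? ?] /andP[? ?]; apply/andP; split; lra.
  have : 0 <= ((t - x) / 2) ^+ 2 by rewrite sqr_ge0.
  have : ((t - x) / 2) ^+ 2 <= 1 by rewrite expr2; nra.
  lra.
have hth t : -1 <= t <= 1 -> ~ J t -> h.[t] <= theta.
  move=> t1 Jt; have : dlt <= `|t - x| by rewrite leNgt; apply/negP => /xJ.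
  rewrite hE -(@ler_pXn2r _ 2) ?nnegrE ?normr_ge0 ?(ltW dlt0) // real_normK ?num_real //.
  by rewrite exprMn exprVn => hh; lra.
pose G := kernel_poly p n x * h ^+ m.
have sG : (size G <= n + 2 * m)%N.
  apply: leq_trans (size_polyMleq _ _) _.
  have sh : (size h <= 3)%N.
    apply: leq_trans (size_polyD _ _) _; rewrite size_poly1 size_polyN geq_max /=.
    apply: leq_trans (size_poly_exp_leq _ _) _.
    by rewrite mul_polyC size_scale ?invr_eq0 ?pnatr_eq0 // size_XsubC.
  have shm : (size (h ^+ m)%R <= (2 * m).+1)%N.
    apply: leq_trans (size_poly_exp_leq _ _) _.
    by rewrite ltnS leq_mul2r -subn1 leq_subLR sh orbT.
  by rewrite -subn1 leq_subLR add1n -addnS leq_add // (size_kernel_poly p_on).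
have Gx : G.[x] = K n x x.
  rewrite hornerM horner_exp hE horner_kernel_poly subrr mul0r expr0n /=.
  by rewrite subr0 expr1n mulr1.
(* G takes the value K_n(x,x) at x, and E (G^2) is at most a multiple of K_n(x,x): inside J because
   h <= 1, outside because K_n(x,t)^2 <= K_n(x,x) S. One factor K_n(x,x) then cancels. *)
have := sqr_horner_le E_ge0 E_on x sG.
rewrite Gx expr2 => main.
have LG : L (G ^+ 2) <= K n x x.
  rewrite -(kernel_poly_sqr p_on) ; apply: functional_mono => // t t1.
  rewrite !horner_exp hornerM exprMn ler_piMr ?sqr_ge0 //.
  have /andP[a b] := h01 t t1.
  by rewrite horner_exp exprn_ile1 ?exprn_ge0 ?exprn_ile1.
have EG : E (G ^+ 2) <= tau * K n x x + theta ^+ (2 * m) * S * K n x x.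
  apply: (@le_trans _ _ (tau * L (G ^+ 2) + theta ^+ (2 * m) * S * K n x x)); last first.
    by rewrite lerD2r ler_pM2l.
  apply: E_le.
  - by rewrite !mulr_ge0 ?exprn_ge0.
  - by move=> t _; rewrite horner_exp sqr_ge0.
  - move=> t t1 Jt; rewrite horner_exp hornerM exprMn horner_exp -exprM mulnC mulrC -mulrA.
    apply: ler_pM; rewrite ?sqr_ge0 //.
    + by apply: exprn_ge0; case/andP: (h01 t t1).
    + by apply: lerXn2r; rewrite ?nnegrE // ?hth //; case/andP: (h01 t t1).
    + rewrite horner_kernel_poly mulrC; apply: le_trans (sqr_kernel_le L_ge0 p_on n x t) _.
      by rewrite ler_wpM2l // hS.
have : K n x x * K n x x <= ((n + 2 * m)%:R + D) * (tau * K n x x + theta ^+ (2 * m) * S * K n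
  x x).
  apply: le_trans main _; apply: ler_pM => //.
  exact: functional_sqr_ge0.
by rewrite -mulrDl mulrA ler_pM2r.
Qed.

Lemma kernel_diag_upper eta : 0 < eta -> eta < 1 ->
  \forall n \near \oo, forall x, -1 <= x <= 1 ->
    (forall t, `|t - x| < dlt -> J t) ->
    (forall k, KE k x x <= k%:R + D) ->
    K n x x <= (1 + eta) * tau * n%:R.
Proof.
move=> e0 e1.
have d21 : dlt ^+ 2 <= 1 by rewrite exprn_ile1 // ltW.
have th0 : 0 < theta by lra.
have th1 : theta < 1 by rewrite ltrBlDr ltrDl divr_gt0 // exprn_gt0.
have peak := kernel_diag_le_peak.
move: theta th0 th1 peak => th th0 th1 peak.
(* With m = n %/ k, the extra degree 2 m is at most (eta / 4) n. *)
have [k hk] : exists k : nat, 8 / eta < k%:R.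
  by eexists; apply: archi_boundP; rewrite divr_ge0 // ltW.
have k0 : (0 < k)%N.
  by rewrite -(ltr_nat R); apply: lt_trans hk; rewrite divr_gt0.
(* Then rho^(4 k m) = th^-m. As n <= k m + k, rho^(2 n) is O(th^-m), so th^(2 m) [S n] is O(th^m)
   and tends to 0. *)
pose rho := expR (- ln th / (4 * k)%:R).
have lth : 0 < - ln th by rewrite oppr_gt0 ln_lt0 // th0 th1.
have rho1 : 1 < rho by rewrite expR_gt1 divr_gt0 // ltr0n muln_gt0.
have rhok : rho ^+ (4 * k) = th^-1.
  rewrite -expRM_natl mulrC divfK ?pnatr_eq0 -?lt0n ?muln_gt0 //.
  by rewrite expRN lnK.
have [C C0 hC] := p_sub rho1.
have r21 : 0 < rho ^+ 2 - 1 by rewrite subr_gt0 exprn_egt1.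
pose S n := C ^+ 2 / (rho ^+ 2 - 1) * rho ^+ (2 * n).
have hS n t : -1 <= t <= 1 -> K n t t <= S n.
  move=> t1; apply: (@le_trans _ _ (\sum_(0 <= j < n) C ^+ 2 * rho ^+ (2 * j))).
    apply: ler_sum => j _; rewrite -expr2 -real_normK ?num_real // exprM -exprAC -exprMn.
    by rewrite lerXn2r ?nnegrE ?hC // mulr_ge0 ?exprn_ge0 ?(ltW C0) // expR_ge0.
  rewrite -mulr_sumr /S -mulrA ler_pM2l ?exprn_gt0 //.
  rewrite mulrC ler_pdivlMr //.
  elim: n => [|n IH]; first by rewrite big_nil mul0r exprn_ge0 // expR_ge0.
  rewrite big_nat_recr //= mulrDl mulnS exprD; lra.
pose c1 := C ^+ 2 / (rho ^+ 2 - 1) * rho ^+ (2 * k).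
have c10 : 0 < c1 by rewrite !mulr_gt0 ?exprn_gt0 ?invr_gt0 // expR_gt0.
have [M0 _ hM0] : \forall m \near \oo, th ^+ m < tau * (eta / 4) / c1.
  have /cvgrPdist_lt : GRing.exp th @ \oo --> (0 : R).
    by apply: cvg_expr; rewrite ger0_norm // ltW.
  have t0 : 0 < tau * (eta / 4) / c1 by rewrite !mulr_gt0 ?invr_gt0.
  move=> /(_ _ t0); apply: filterS => m.
  by rewrite sub0r normrN ger0_norm // exprn_ge0 // ltW.
have [N1 hN1] : exists N1 : nat, 4 * `|D| / eta < N1%:R.
  by eexists; apply: archi_boundP; rewrite divr_ge0 ?mulr_ge0 // ltW.
exists (maxn N1 (k * M0)) => // n nmax x x1 xJ xK.
have /andP[nN1 nM] : (N1 <= n)%N && (k * M0 <= n)%N by rewrite -geq_max.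
pose m := (n %/ k)%N.
have mM : (M0 <= m)%N by rewrite leq_divRL // mulnC.
apply: le_trans (peak n m x (S n) x1 xJ (xK _) (hS n)) _.
have hSn : th ^+ (2 * m) * S n <= tau * (eta / 4).
  have nk : (n <= k * m + k)%N.
    by rewrite {1}(divn_eq n k) mulnC leq_add2l ltnW // ltn_mod.
  have : S n <= c1 * th ^- m.
    rewrite /S /c1 -!mulrA; rewrite ler_pM2l ?exprn_gt0 // ler_pM2l ?invr_gt0 //.
    have -> : rho ^+ (2 * k) * th ^- m = rho ^+ (2 * k + 4 * k * m).
      by rewrite exprD exprM [rho ^+ (4 * k * m)]exprM rhok exprVn.
    rewrite ler_pM2l ?invr_gt0 // ler_eXn2l //.
    apply: leq_trans (leq_mul (leqnn 2) nk) _.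
    by rewrite mulnDr addnC leq_add2l -mulnA leq_mul.
  move=> /(ler_wpM2l (exprn_ge0 (2 * m) (ltW th0))) /le_trans; apply.
  have := hM0 m mM; rewrite ltr_pdivlMr // => /ltW; apply: le_trans.
  rewrite le_eqVlt; apply/orP; left; apply/eqP.
  by rewrite mul2n -addnn exprD; field; rewrite expf_neq0 ?gt_eqF.
have nk2 : (n + 2 * m)%:R + D <= (1 + eta / 2) * n%:R.
  have mk : m%:R * k%:R <= n%:R :> R by rewrite -natrM ler_nat leq_trunc_div.
  have : m%:R * 8 <= n%:R * eta :> R.
    rewrite ltr_pdivrMr // in hk.
    have : m%:R * 8 <= m%:R * (k%:R * eta) :> R by rewrite ler_wpM2l // ltW.
    have : m%:R * k%:R * eta <= n%:R * eta by rewrite ler_wpM2r // ltW.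
    rewrite mulrA; lra.
  have : D <= eta / 4 * n%:R.
    apply: le_trans (ler_norm D) _.
    have : N1%:R <= n%:R :> R by rewrite ler_nat.
    move: hN1; rewrite ltr_pdivrMr //; nra.
  by rewrite natrD natrM; lra.
have n0 : 0 <= n%:R :> R by [].
(* It remains that (1 + eta / 2)(1 + eta / 4) <= 1 + eta, which holds for eta < 1. *)
apply: (@le_trans _ _ ((1 + eta / 2) * n%:R * (tau + tau * (eta / 4)))).
  apply: ler_pM => //; last by rewrite lerD2l.
    by apply: le_trans (xK _); exact: kernel_diag_ge0.
  apply: addr_ge0; first exact: ltW.
  apply: mulr_ge0; first by rewrite exprn_ge0 // ltW.
  apply: mulr_ge0; first by rewrite divr_ge0 ?sqr_ge0 // ltW.
  by rewrite exprn_ge0 // expR_ge0.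
have -> : (1 + eta / 2) * n%:R * (tau + tau * (eta / 4)) =
  (1 + eta / 2) * (1 + eta / 4) * (tau * n%:R) by ring.
rewrite -[leRHS]mulrA; apply: ler_wpM2r; first by rewrite mulr_ge0 // ltW.
nra.
Qed.

End KernelUpperBound.

(** * The functionals of the arcsine measure and of mu *)

Section LeMeasureIntegral.
Import HBNNSimple.

(** A nonnegative simple function below f extended by 0 has its nonzero level sets inside J, the
    only place where the measures are compared. *)
Lemma le_integral_measure_on (d : measure_display) (T : measurableType d)
    (R : realType) (m1 m2 : {measure set T -> \bar R}) (J : set T) (f : T -> \bar R) :
  measurable J -> (forall A, measurable A -> A `<=` J -> (m1 A <= m2 A)%E) ->
  (forall x, J x -> (0 <= f x)%E) ->
  (\int[m1]_(x in J) f x <= \int[m2]_(x in J) f x)%E.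
Proof.
move=> mJ m12 f0; rewrite !ge0_integralE //= ge_ereal_sup// => _ [h/= hfS] <-.
apply: le_ereal_sup_tmp; exists (sintegral m2 h); first by exists h.
rewrite !sintegralE lee_fsum// => r [t _ <-].
have [->|ht] := eqVneq (h t) 0; first by rewrite !mul0e.
apply: lee_pmul; rewrite ?lee_fin //.
apply: m12 => // x /= hx; apply: contrapT => Jx.
have := hfS x; rewrite patchN; last by rewrite notin_setE.
rewrite hx lee_fin => h0; have : 0 <= h t by [].
by move=> h1; move/eqP: ht; apply; apply/eqP; rewrite eq_le h0 h1.
Qed.

End LeMeasureIntegral.

Section PolyFunctional.
Context (d : measure_display) (T : measurableType d) (R : realType).
Variables (m : {measure set T -> \bar R}) (D : set T) (phi : T -> R).
Hypotheses (mD : measurable D) (D_fin : (m D < +oo)%E).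
Hypotheses (mphi : measurable_fun D phi) (phi1 : forall x, D x -> -1 <= phi x <= 1).

Lemma measurable_horner (f : {poly R}) : measurable_fun D (fun x => f.[phi x]).
Proof.
apply: (measurableT_comp (f := horner f)) => //.
by apply: measurable_realfun.continuous_measurable_fun; apply: continuous_horner.
Qed.

Lemma integrable_horner (f : {poly R}) : m.-integrable D (EFin \o (fun x => f.[phi x])).
Proof.
apply: measurable_bounded_integrable => //; first exact: measurable_horner.
exists (\sum_(i < size f) `|f`_i|); split; first exact: num_real.
move=> M hM x Dx; apply: le_trans (ltW hM).
rewrite horner_coef; apply: le_trans (ler_norm_sum _ _ _) _.
apply: ler_sum => i _; rewrite normrM ler_piMr // normrX exprn_ile1 //.
by rewrite ler_norml phi1.
Qed.

(** Serves both measures: phi is the identity for mu, and the cosine on [0, pi] for the arcsine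
    measure. *)
Lemma exists_poly_functional (c : R) : 0 <= c -> exists L : {scalar {poly R}},
  (forall f, L f = c * \int[m]_(x in D) f.[phi x]) /\ positive_on_unit L.
Proof.
move=> c0; pose L0 (f : {poly R}) := c * \int[m]_(x in D) f.[phi x].
have lin : linear_for *%R L0.
  move=> a f g; rewrite /L0.
  have -> : (fun x => (a *: f + g).[phi x]) = (fun x => a * f.[phi x] + g.[phi x]).
    by apply/funext => x; rewrite hornerD hornerZ.
  rewrite RintegralD // ?RintegralZl //; first ring.
  - exact: integrable_horner.
  - have -> : (fun x => a * f.[phi x]) = (fun x => (a *: f).[phi x]).
      by apply/funext => x; rewrite hornerZ.
    exact: integrable_horner.
  - exact: integrable_horner.
pose mix := GRing.isLinear.Build R {poly R} R *%R L0 lin.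
pose L : {scalar {poly R}} := HB.pack L0 mix.
exists L; split=> // f f0; apply: mulr_ge0 => //.
by apply: Rintegral_ge0 => x Dx; apply: f0; exact: phi1.
Qed.

End PolyFunctional.

(** * The substitution x = cos t and integrals of cosines *)

Section IntegralFormulas.
Variable R : realType.
Local Notation mu := (@lebesgue_measure R).

Lemma Rintegral_FTC (f F : R -> R) (a b : R) : a <= b -> continuous f ->
  (forall x : R, is_derive x 1 F (f x)) -> \int[mu]_(x in `[a, b]) f x = F b - F a.
Proof.
move=> ab cf dF.
have cF : continuous F.
  by move=> x; apply/differentiable_continuous/derivable1_diffP; have [] := dF x.
move: ab; rewrite le_eqVlt => /orP[/eqP<-|ab].
  by rewrite set_itv1 Rintegral_set1 subrr.
rewrite /Rintegral (@continuous_FTC2 R f F) //.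
- exact: continuous_subspaceT.
- split; first by move=> x _; have [] := dF x.
    exact/cvg_at_right_filter/cF.
  exact/cvg_at_left_filter/cF.
- by move=> x _; rewrite derive1E; exact: derive_val.
Qed.

Lemma exists_primitive (f : {poly R}) : exists F : {poly R}, F^`() = f.
Proof.
exists (\poly_(i < (size f).+1) (f`_i.-1 / i%:R)).
apply/polyP => i; rewrite coef_deriv coef_poly ltnS /=.
case: ltnP => h; last by rewrite mul0rn nth_default.
by rewrite -[LHS]mulr_natr divfK // pnatr_eq0.
Qed.

Lemma is_derive_horner (F : {poly R}) (x : R) : is_derive x 1 (horner F) (F^`()).[x].
Proof.
by apply: DeriveDef; [exact: derivable_horner | rewrite derivE derive1E].
Qed.

Lemma acos_anti (x y : R) : -1 <= x -> x <= y -> y <= 1 -> acos y <= acos x.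
Proof.
move=> x1 xy y1; rewrite leNgt; apply/negP => h.
have ix : -1 <= x <= 1 by rewrite x1 (le_trans xy).
have iy : -1 <= y <= 1 by rewrite y1 (le_trans x1).
have := h; rewrite -ltr_cos ?in_itv /= ?acos_ge0 ?acos_lepi // !acosK // ?in_itv //= => yx.
by move: xy; rewrite leNgt yx.
Qed.

(** Polynomials have explicit primitives, so the substitution reduces to evaluating F on one side
    and - F(cos t) on the other. *)
Lemma Rintegral_horner_cos (f : {poly R}) (a b : R) : -1 <= a -> a <= b -> b <= 1 ->
  \int[mu]_(t in `[acos b, acos a]) (f.[cos t] * sin t) =
  \int[mu]_(x in `[a, b]) f.[x].
Proof.
move=> a1 ab b1; have [F FE] := exists_primitive f.
have dF (x : R) : is_derive x 1 (horner F) f.[x] by rewrite -FE; exact: is_derive_horner.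
rewrite (Rintegral_FTC ab _ dF); last exact: continuous_horner.
have dG (t : R) : is_derive t 1 (fun t => - F.[cos t]) (f.[cos t] * sin t).
  have h := is_deriveN (is_derive1_comp (dF (cos t)) (is_derive_cos t)).
  by apply: (is_derive_eq h); rewrite mulrN opprK.
rewrite (Rintegral_FTC (acos_anti a1 ab b1) _ dG).
  by rewrite !acosK ?in_itv /= ?a1 ?b1 ?(le_trans a1 ab) ?(le_trans ab b1) //; ring.
move=> t; apply: cvgM; last exact: continuous_sin.
by apply: continuous_comp; [exact: continuous_cos | exact: continuous_horner].
Qed.

Lemma sin_natpi n : sin (n%:R * pi) = 0 :> R.
Proof.
elim: n => [|n IH]; first by rewrite mul0r sin0.
by rewrite -natr1 mulrDl mul1r sinDpi IH oppr0.
Qed.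

Lemma Rintegral_cos_nat n : \int[mu]_(t in `[0, pi]) cos (n%:R * t) =
  if n == 0%N then pi else 0.
Proof.
case: eqP => [->|/eqP n0].
  have d1 (t : R) : is_derive t 1 id (cos (0%:R * t)).
    by rewrite mul0r cos0; exact: is_derive_id.
  rewrite (Rintegral_FTC (pi_ge0 R) _ d1) ?subr0 //.
  by move=> t; under eq_fun do rewrite mul0r cos0; exact: cvg_cst.
have d1 (t : R) : is_derive t 1 (fun t => n%:R^-1 * sin (n%:R * t)) (cos (n%:R * t)).
  have dlin : is_derive t 1 (fun t : R => n%:R * t) n%:R.
    by apply: (is_derive_eq (is_deriveZ n%:R (is_derive_id t 1)));
      rewrite /GRing.scale /= mulr1.
  have h := is_deriveZ n%:R^-1 (is_derive1_comp (is_derive_sin (n%:R * t)) dlin).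
  apply: (is_derive_eq h).
  by rewrite /GRing.scale /= mulrCA mulVf ?mulr1 // pnatr_eq0.
rewrite (Rintegral_FTC (pi_ge0 R) _ d1).
  by rewrite sin_natpi !mulr0 sin0 mulr0 subrr.
move=> t; apply: continuous_comp; last exact: continuous_cos.
exact: mulrl_continuous.
Qed.

End IntegralFormulas.

Lemma Rintegral_setD (d : measure_display) (T : measurableType d) (R : realType)
    (m : {measure set T -> \bar R}) (D J : set T) (h : T -> R) :
  measurable D -> measurable J -> J `<=` D -> m.-integrable D (EFin \o h) ->
  \int[m]_(x in D) h x = \int[m]_(x in J) h x + \int[m]_(x in D `\` J) h x.
Proof.
move=> mD mJ JD hi; rewrite -Rintegral_setU //; first by rewrite setDUK.
- exact: measurableD.
- by rewrite setDUK.
- by apply/disj_setPS => x [Jx [_ nJx]].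
Qed.

Lemma Rintegral_subset_le (d : measure_display) (T : measurableType d) (R : realType)
    (m : {measure set T -> \bar R}) (D J : set T) (h : T -> R) :
  measurable D -> measurable J -> J `<=` D -> m.-integrable D (EFin \o h) ->
  (forall x, D x -> 0 <= h x) -> \int[m]_(x in J) h x <= \int[m]_(x in D) h x.
Proof.
move=> mD mJ JD hi h0; rewrite (Rintegral_setD mD mJ) // lerDl.
by apply: Rintegral_ge0 => x [/h0].
Qed.

Lemma Rintegral_le_cst (d : measure_display) (T : measurableType d) (R : realType)
    (m : {measure set T -> \bar R}) (D : set T) (h : T -> R) (B : R) :
  measurable D -> (m D < +oo)%E -> m.-integrable D (EFin \o h) ->
  (forall x, D x -> h x <= B) -> \int[m]_(x in D) h x <= B * fine (m D).
Proof.
move=> mD D_fin hi hB; rewrite -(Rintegral_cst m mD); apply: le_Rintegral => //.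
apply: measurable_bounded_integrable => //.
by exists `|B|; split=> [|M hM x _]; [exact: num_real | exact: ltW].
Qed.

Lemma lead_coef_chebyshev (R : numDomainType) n : 0 < lead_coef (chebyshev R n).
Proof.
elim/nat_ind2: n => [||n IH IH1]; rewrite ?lead_coef1 ?lead_coefX //.
have -> : chebyshev R n.+2 = 2%:P * 'X * chebyshev R n.+1 - chebyshev R n by [].
have e : 2%:P * 'X * chebyshev R n.+1 = 2 *: ('X * chebyshev R n.+1).
  by rewrite -mulrA mul_polyC.
rewrite lead_coefDl e.
  by rewrite lead_coefZ lead_coefM lead_coefX mul1r mulr_gt0.
rewrite size_polyN size_scale ?pnatr_eq0 // mulrC size_mulX ?size_chebyshev //.
by rewrite -size_poly_gt0 size_chebyshev.
Qed.

(** * The arcsine functional and its comparison with Lebesgue measure *)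

Section Arcsine.
Variable R : realType.
Local Notation leb := (@lebesgue_measure R).

Lemma Rintegral_cosM n k : (k <= n)%N ->
  \int[leb]_(t in `[0, pi]) (cos (n%:R * t) * cos (k%:R * t)) =
  (if (n + k)%N == 0%N then pi else 0) / 2 + (if (n - k)%N == 0%N then pi else 0) / 2.
Proof.
move=> kn.
have ci j : leb.-integrable `[0, pi] (EFin \o (fun t => 2^-1 * cos (j%:R * t) : R)).
  apply: continuous_compact_integrable; first exact: segment_compact.
  apply: continuous_subspaceT => t; apply: cvgM; first exact: cvg_cst.
  by apply: continuous_comp; [exact: mulrl_continuous | exact: continuous_cos].
have ci' j : leb.-integrable `[0, pi] (EFin \o (fun t => cos (j%:R * t) : R)).
  apply: continuous_compact_integrable; first exact: segment_compact.
  apply: continuous_subspaceT => t.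
  by apply: continuous_comp; [exact: mulrl_continuous | exact: continuous_cos].
have -> : (fun t : R => cos (n%:R * t) * cos (k%:R * t)) =
    (fun t => 2^-1 * cos ((n + k)%:R * t) + 2^-1 * cos ((n - k)%:R * t)).
  by apply/funext => t; rewrite natrD natrB // mulrDl mulrBl cosB cosD; field.
rewrite RintegralD // !RintegralZl // !Rintegral_cos_nat.
by rewrite ![_ / 2]mulrC.
Qed.

(** Taking the arcsine measure as the image of dt / pi under cos avoids its density, singular at the
    endpoints, and reduces orthonormality to that of cosines. *)
Lemma exists_arcsine_functional : exists E : {scalar {poly R}},
  [/\ forall f, E f = pi^-1 * \int[leb]_(t in `[0, pi]) f.[cos t],
      positive_on_unit E & orthonormal_for E (@chebyshev_on R)].
Proof.
have lpi : (leb `[0%R, pi] < +oo)%E.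
  by rewrite lebesgue_measure_itv /=; case: ifP => _; rewrite ltry.
have mcos : measurable_fun (`[0, pi] : set (measurableTypeR R)) (@cos R).
  apply: (@measurable_funS _ _ _ _ setT) => //.
  by apply: measurable_realfun.continuous_measurable_fun; exact: continuous_cos.
have c1 (t : R) : [set` `[0, pi]] t -> -1 <= cos t <= 1.
  by rewrite cos_geN1 cos_le1.
have [||E [EE E0]] := exists_poly_functional _ lpi mcos c1 (_ : 0 <= pi^-1).
- exact: measurable_itv.
- by rewrite invr_ge0 pi_ge0.
exists E; split => //; split.
  move=> n; have c0 : (if n == 0%N then 1 else Num.sqrt 2) > 0 :> R.
    by case: ifP; rewrite ?sqrtr_gt0.
  rewrite /chebyshev_on; split; last by rewrite lead_coefZ mulr_gt0 ?lead_coef_chebyshev.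
  by rewrite size_scale ?size_chebyshev // gt_eqF.
have main n k : (k <= n)%N -> E (chebyshev_on R n * chebyshev_on R k) = (n == k)%:R.
  move=> kn; rewrite /chebyshev_on -scalerAl -scalerAr !linearZ /= EE.
  under eq_Rintegral do rewrite hornerM !chebyshev_cos.
  rewrite Rintegral_cosM //.
  have pi0 : pi != 0 :> R by rewrite gt_eqF // pi_gt0.
  move: (pi : R) pi0 => q pi0.
  rewrite subn_eq0 addn_eq0 [n == k]eqn_leq kn andbT.
  case: leqP => nk.
    have -> : k = n by apply/eqP; rewrite eqn_leq kn.
    rewrite andbb /= mulr1n; case: eqP => _; first by field.
    have : Num.sqrt 2 ^+ 2 = 2 :> R by rewrite sqr_sqrtr.
    by move: (Num.sqrt 2) => s s2; rewrite mulrA -expr2 s2; field.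
  have -> : (n == 0)%N = false by rewrite gtn_eqF // (leq_ltn_trans _ nk).
  by rewrite /= !mul0r addr0 !mulr0.
move=> n k; have [kn|nk] := leqP k n; first exact: main.
by rewrite mulrC main ?(ltnW nk) // eq_sym.
Qed.

Variable E : {scalar {poly R}}.
Hypothesis E_cos : forall f, E f = pi^-1 * \int[leb]_(t in `[0, pi]) f.[cos t].

Lemma ler_cos (x y : R) : 0 <= x <= pi -> 0 <= y <= pi -> (cos x <= cos y) = (y <= x).
Proof. by move=> x1 y1; rewrite !leNgt ltr_cos. Qed.

Section OnInterval.
Variables (a b : R) (f : {poly R}).
Hypotheses (a1 : -1 <= a) (ab : a <= b) (b1 : b <= 1).
Hypothesis f0 : forall x, -1 <= x <= 1 -> 0 <= f.[x].

Let lpi : (leb `[0%R, pi] < +oo)%E.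
Proof. by rewrite lebesgue_measure_itv /=; case: ifP => _; rewrite ltry. Qed.

Let arc := `[acos b, acos a] : set (measurableTypeR R).

Let arc_sub : arc `<=` `[0, pi].
Proof.
move=> t; rewrite /arc /= !in_itv /= => /andP[t1 t2].
rewrite (le_trans _ t1) ?(le_trans t2) ?acos_ge0 ?acos_lepi //.
  by rewrite a1 (le_trans ab).
by rewrite b1 (le_trans a1).
Qed.

Let cos_arc t : arc t -> a <= cos t <= b.
Proof.
move=> at_; have := arc_sub at_; rewrite /= in_itv /= => t1.
have [Ia Ib] : -1 <= a <= 1 /\ -1 <= b <= 1.
  by rewrite a1 b1 (le_trans ab b1) (le_trans a1 ab).
move: at_; rewrite /arc /= in_itv /= => /andP[h1 h2].
have ca : cos (acos a) <= cos t by rewrite ler_cos ?acos_ge0 ?acos_lepi.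
have cb : cos t <= cos (acos b) by rewrite ler_cos ?acos_ge0 ?acos_lepi.
by move: ca cb; rewrite !acosK ?in_itv //= => -> ->.
Qed.

Let not_cos_arc t : [set` `[0, pi]] t -> ~ arc t -> ~ (a <= cos t <= b).
Proof.
rewrite /arc /= !in_itv /= => t1 nt /andP[h1 h2]; apply: nt.
have [Ia Ib] : -1 <= a <= 1 /\ -1 <= b <= 1.
  by rewrite a1 b1 (le_trans ab b1) (le_trans a1 ab).
by apply/andP; split; rewrite -ler_cos ?acos_ge0 ?acos_lepi // acosK ?in_itv.
Qed.

Let integrable_cos (D : set (measurableTypeR R)) (g : R -> R) : measurable D -> D `<=` `[0,
  pi] ->
  continuous g -> leb.-integrable D (EFin \o (fun t => f.[cos t] * g t)).
Proof.
move=> mD Dsub cg; apply: (@integrableS _ _ _ leb [set` `[0, pi]] D _ _ mD Dsub).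
  exact: measurable_itv.
apply: continuous_compact_integrable; first exact: segment_compact.
apply: continuous_subspaceT => t; apply: cvgM; last exact: cg.
by apply: continuous_comp; [exact: continuous_cos | exact: continuous_horner].
Qed.

Let i1 (D : set (measurableTypeR R)) : measurable D -> D `<=` `[0, pi] ->
  leb.-integrable D (EFin \o (fun t => f.[cos t])).
Proof.
move=> mD Ds; have := integrable_cos mD Ds (@cst_continuous R R 1).
by congr (integrable _ _ _); apply/funext => t /=; rewrite mulr1.
Qed.

Let sin_cos (t : R) : [set` `[0, pi]] t -> sin t = Num.sqrt (1 - cos t ^+ 2).
Proof.
rewrite /= in_itv /= => /andP[t1 t2].
have -> : 1 - cos t ^+ 2 = sin t ^+ 2 by rewrite sin2cos2.
by rewrite sqrtr_sqr ger0_norm // sin_ge0_pi // t1.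
Qed.

(** On the arc, sg f(cos t) <= f(cos t) sin t, which integrates to the Lebesgue integral over
    [a, b]; off the arc f(cos t) <= B, and dt / pi has total mass 1. *)
Lemma arcsine_le sg B : 0 < sg ->
  (forall x, a <= x <= b -> sg <= Num.sqrt (1 - x ^+ 2)) -> 0 <= B ->
  (forall x, -1 <= x <= 1 -> ~ (a <= x <= b) -> f.[x] <= B) ->
  E f <= (pi * sg)^-1 * \int[leb]_(x in `[a, b]) f.[x] + B.
Proof.
move=> sg0 hsg B0 fB; rewrite E_cos.
have marc : measurable arc by exact: measurable_itv.
have m0 : measurable (`[0%R, pi] : set (measurableTypeR R)) by exact: measurable_itv.
have fc t : 0 <= f.[cos t] by apply: f0; rewrite cos_geN1 cos_le1.
rewrite (Rintegral_setD m0 marc arc_sub (i1 m0 (@subset_refl _ _))) mulrDr.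
have pi0 := pi_gt0 R.
apply: lerD.
  rewrite -(Rintegral_horner_cos f a1 ab b1) invfM -mulrA ler_pM2l ?invr_gt0 //.
  rewrite ler_pdivlMl // -RintegralZl ?i1 //.
  apply: le_Rintegral => //.
  - have := integrable_cos marc arc_sub (@cst_continuous R R sg).
    by congr (integrable _ _ _); apply/funext => t /=; rewrite mulrC.
  - exact/integrable_cos/continuous_sin.
  - move=> t ht; rewrite mulrC ler_wpM2l //.
    by rewrite sin_cos ?hsg ?cos_arc //; exact: arc_sub.
rewrite ler_pdivrMl //.
pose D : set (measurableTypeR R) := [set` `[0, pi]] `\` arc.
have mD : measurable D by exact: measurableD.
have lD : (leb D <= leb `[0%R, pi])%E by apply: le_measure; rewrite ?inE //; exact: subDsetl.
have D_fin : (leb D < +oo)%E := le_lt_trans lD lpi.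
have hB t : D t -> f.[cos t] <= B.
  by move=> [t1 t2]; apply: fB; [rewrite cos_geN1 cos_le1 | exact: not_cos_arc].
apply: le_trans (Rintegral_le_cst mD D_fin (i1 mD (@subDsetl _ _ _)) hB) _.
rewrite mulrC ler_wpM2r // -lee_fin fineK ?ge0_fin_numE //.
by apply: le_trans lD _; rewrite lebesgue_measure_itv /= lte_fin pi0 -EFinD subr0.
Qed.

Lemma Rintegral_le_arcsine sg :
  (forall x, a <= x <= b -> Num.sqrt (1 - x ^+ 2) <= sg) ->
  \int[leb]_(x in `[a, b]) f.[x] <= pi * sg * E f.
Proof.
move=> hsg; rewrite E_cos.
have marc : measurable arc by exact: measurable_itv.
have m0 : measurable (`[0%R, pi] : set (measurableTypeR R)) by exact: measurable_itv.
have fc t : 0 <= f.[cos t] by apply: f0; rewrite cos_geN1 cos_le1.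
have pi0 := pi_gt0 R.
have sg0 : 0 <= sg by apply: le_trans (hsg a _); rewrite ?sqrtr_ge0 // lexx.
have -> : pi * sg * (pi^-1 * \int[leb]_(t in `[0, pi]) f.[cos t]) =
   sg * \int[leb]_(t in `[0, pi]) f.[cos t] by rewrite [pi * sg]mulrC -mulrA mulVKf // gt_eqF.
rewrite -(Rintegral_horner_cos f a1 ab b1).
apply: (@le_trans _ _ (sg * \int[leb]_(t in arc) f.[cos t])); last first.
  apply: ler_wpM2l => //; apply: Rintegral_subset_le => //; exact: i1.
rewrite -RintegralZl ?i1 //; apply: le_Rintegral => //.
- exact/integrable_cos/continuous_sin.
- have := integrable_cos marc arc_sub (@cst_continuous R R sg).
  by congr (integrable _ _ _); apply/funext => t /=; rewrite mulrC.
- move=> t ht; rewrite [leRHS]mulrC ler_wpM2l //.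
  by rewrite sin_cos ?hsg ?cos_arc //; exact: arc_sub.
Qed.

End OnInterval.
End Arcsine.

(** L (p_n q_n) is the quotient of the two leading coefficients in either order, so this positive
    quotient is its own inverse. *)
Lemma orthonormal_lead_unique (R : realType) (L : {scalar {poly R}}) (p q : nat -> {poly R}) :
  orthonormal_for L p -> orthonormal_for L q -> forall n, lead_coef (p n) = lead_coef (q n).
Proof.
have key (p' q' : nat -> {poly R}) n : orthonormal_for L p' -> orthonormal_for L q' ->
    L (p' n * q' n) = lead_coef (q' n) / lead_coef (p' n).
  move=> hp hq; set a := _ / _.
  have [sp lp] := hp.1 n; have [sq lq] := hq.1 n.
  have low : (size (q' n - a *: p' n)%R <= n)%N.
    apply/leq_sizeP => j; rewrite leq_eqVlt => /orP[/eqP<-|nj].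
      rewrite coefB coefZ.
      have -> : (p' n)`_n = lead_coef (p' n) by rewrite lead_coefE sp.
      have -> : (q' n)`_n = lead_coef (q' n) by rewrite lead_coefE sq.
      by rewrite divfK ?subrr // gt_eqF.
    by rewrite coefB coefZ !nth_default ?mulr0 ?subrr ?sp ?sq.
  rewrite -[q' n](subrK (a *: p' n)) mulrDr linearD /= (orthonormal_low hp low) add0r.
  by rewrite -scalerAr linearZ /= hp.2 eqxx mulr1.
move=> hp hq n; have lp := (hp.1 n).2; have lq := (hq.1 n).2.
have := key p q n hp hq; rewrite mulrC (key q p n hq hp) => /eqP.
rewrite eqr_div ?lt0r_neq0 // -!expr2 eqrXn2 //; try exact: ltW.
by move/eqP.
Qed.

Lemma powR_root_cvg_le (R : realType) (l : nat -> R) : (forall n, 0 < l n) ->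
  l n `^ n%:R^-1 @[n --> \oo] --> (2 : R) ->
  forall rho, 1 < rho -> \forall n \near \oo, l n <= (2 * rho) ^+ n.
Proof.
move=> l0 l2 rho rho1.
have h : 2 < 2 * rho by lra.
have := cvgr_lt _ l2 _ h; move=> h1.
near=> n; have n0 : (0 < n)%N by near: n; exists 1%N.
have : l n `^ n%:R^-1 < 2 * rho by near: n; exact: h1.
move=> /ltW; rewrite -(@ler_pXn2r _ n) ?nnegrE ?powR_ge0 //; last by lra.
by rewrite -powR_mulrn ?powR_ge0 // -powRrM mulVf ?pnatr_eq0 -?lt0n // powRr1 // ltW.
Unshelve. all: by end_near.
Qed.

(** * The functional of mu *)

Section MuFunctional.
Variables (R : realType) (mu : {finite_measure set (measurableTypeR R) -> \bar R}).
Local Notation leb := (@lebesgue_measure R).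
Let I : set (measurableTypeR R) := [set` `](-1), 1[].

Let mI : measurable I. Proof. exact: measurable_itv. Qed.

Let I_fin : (mu I < +oo)%E.
Proof.
have := @fin_num_measure _ _ _ mu I (measurable_itv _).
by rewrite ge0_fin_numE.
Qed.

Let mid : measurable_fun I (fun x : R => x). Proof. exact: measurable_id. Qed.

Let idI : forall x : R, I x -> -1 <= x <= 1.
Proof. by move=> x; rewrite /I /= in_itv /= => /andP[/ltW-> /ltW->]. Qed.

Lemma exists_mu_functional : exists L : {scalar {poly R}},
  (forall f, L f = \int[mu]_(x in `](-1), 1[) f.[x]) /\ positive_on_unit L.
Proof.
have [L [LE L0]] := exists_poly_functional mI I_fin mid idI ler01.
by exists L; split=> // f; rewrite LE mul1r.
Qed.

Variable L : {scalar {poly R}}.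
Hypothesis L_mu : forall f, L f = \int[mu]_(x in `](-1), 1[) f.[x].

Lemma orthonormal_polynomials_for p : orthonormal_polynomials mu p -> orthonormal_for L p.
Proof.
move=> [sp op]; split=> // n m; rewrite L_mu /Rintegral.
by under eq_integral do rewrite hornerM; rewrite op.
Qed.

Lemma integrable_mu_horner (D : set (measurableTypeR R)) (f : {poly R}) :
  measurable D -> D `<=` `](-1), 1[ -> mu.-integrable D (EFin \o horner f).
Proof.
move=> mD Ds.
apply: (@integrableS _ _ _ mu I D _ mI mD Ds).
exact: (integrable_horner mI I_fin mid idI).
Qed.

Lemma integrable_leb_horner (a b : R) (f : {poly R}) :
  leb.-integrable `[a, b] (EFin \o horner f).
Proof.
apply: continuous_compact_integrable; first exact: segment_compact.
by apply: continuous_subspaceT; exact: continuous_horner.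
Qed.

Section OnInterval.
Variables (a b : R) (f : {poly R}).
Hypothesis ab_sub : `[a, b] `<=` (`](-1), 1[ : set R).
Hypothesis f0 : forall x, -1 <= x <= 1 -> 0 <= f.[x].

Let J : set (measurableTypeR R) := [set` `[a, b]].
Let mJ : measurable J. Proof. exact: measurable_itv. Qed.
Let f0J x : J x -> (0 <= (f.[x])%:E)%E.
Proof. by move=> /ab_sub /idI /f0; rewrite lee_fin. Qed.
Let mfJ : measurable_fun (J : set R) (EFin \o horner f).
Proof.
apply/measurable_EFinP; apply: (@measurable_funS _ _ _ _ setT) => //.
by apply: measurable_realfun.continuous_measurable_fun; exact: continuous_horner.
Qed.

Lemma mu_functional_ge m : 0 <= m ->
  (forall A : set (measurableTypeR R), measurable A -> A `<=` J ->
     (m%:E * leb A <= mu A)%E) ->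
  m * \int[leb]_(x in `[a, b]) f.[x] <= L f.
Proof.
move=> m0 hm; rewrite L_mu.
apply: (@le_trans _ _ (\int[mu]_(x in J) f.[x])); last first.
  apply: Rintegral_subset_le => //; first exact: integrable_mu_horner.
  by move=> x /idI /f0.
rewrite -lee_fin EFinM /Rintegral !fineK; last 2 first.
- exact/integrable_fin_num/integrable_mu_horner.
- exact/integrable_fin_num/integrable_leb_horner.
have -> : m = (NngNum m0)%:num by [].
rewrite -ge0_integral_mscale //.
by apply: le_integral_measure_on => // A mA AJ; exact: hm.
Qed.

Lemma mu_functional_le M B : 0 <= M -> 0 <= B ->
  (forall A : set (measurableTypeR R), measurable A -> A `<=` J ->
     (mu A <= M%:E * leb A)%E) ->
  (forall x, -1 <= x <= 1 -> ~ (a <= x <= b) -> f.[x] <= B) ->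
  L f <= M * \int[leb]_(x in `[a, b]) f.[x] + B * fine (mu I).
Proof.
move=> M0 B0 hM fB; rewrite L_mu.
rewrite (Rintegral_setD mI mJ ab_sub (integrable_mu_horner _ mI (@subset_refl _ _))).
have mD : measurable (I `\` J) by exact: measurableD.
have lD : (mu (I `\` J) <= mu I)%E by apply: le_measure; rewrite ?inE //; exact: subDsetl.
have D_fin := le_lt_trans lD I_fin.
apply: lerD.
  rewrite -lee_fin EFinM /Rintegral !fineK; last 2 first.
  - exact/integrable_fin_num/integrable_leb_horner.
  - exact/integrable_fin_num/integrable_mu_horner.
  have -> : M = (NngNum M0)%:num by [].
  rewrite -ge0_integral_mscale //.
  by apply: le_integral_measure_on => // A mA AJ; exact: hM.
apply: le_trans (Rintegral_le_cst mD D_fin (integrable_mu_horner _ mD (@subDsetl _ _ _)) _) _.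
  move=> x [/idI x1 Jx]; apply: fB => // xJ; apply: Jx.
by rewrite ler_wpM2l // fine_le // ge0_fin_numE.
Qed.

End OnInterval.
End MuFunctional.

Section Density.
Variables (R : realType) (mu : {finite_measure set (measurableTypeR R) -> \bar R}).
Variables (w : R -> R) (c d : R).
Local Notation leb := (@lebesgue_measure R).
Hypotheses (w_dens : ac_density mu w) (I_sub : `[c, d] `<=` (`]-1, 1[ : set R)).
Hypothesis mu_ac : mrestr mu (measurable_itv `[c, d]) `<< leb.

(** The singular part nu vanishes on A. It lives on a Lebesgue-null set N; absolute continuity gives
    mu measure 0 to the part of A in N, and nu is at most mu there. *)
Lemma mu_density (A : set (measurableTypeR R)) : measurable A -> A `<=` `[c, d] ->
  mu A = (\int[leb]_(x in A) (w x)%:E)%E.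
Proof.
move=> mA Acd; have [mw w0 [nu [[N [mN N0 nuN]] muE]]] := w_dens.
have AI := subset_trans Acd I_sub.
have mAN : measurable (A `&` N) by exact: measurableI.
have muAN : mu (A `&` N) = 0%E.
  have lAN : leb (A `&` N) = 0%E.
    by apply/eqP; rewrite eq_le measure_ge0 andbT -N0; apply: le_measure; rewrite ?inE //;
      exact: subIsetr.
  have := (null_content_dominatesP _ _).1 mu_ac _ mAN lAN.
  by rewrite /mrestr setIAC [X in mu (X `&` _) = _](_ : _ = A) //; apply/setIidPl.
have wAN : (0 <= \int[leb]_(x in A `&` N) (w x)%:E)%E.
  by apply: integral_ge0 => x [/AI xI _]; rewrite lee_fin w0.
have nuAN : nu (A `&` N) = 0%E.
  have ANI : A `&` N `<=` (`]-1, 1[ : set R) by move=> x [/AI].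
  have /eqP := etrans (esym (muE _ mAN ANI)) muAN.
  by rewrite padde_eq0 ?measure_ge0 // => /andP[_ /eqP].
have nuA : nu A = 0%E.
  apply/eqP; rewrite eq_le measure_ge0 andbT.
  have -> : nu A = nu (A `\` N) by have := measureDI nu mA mN;
    rewrite [X in (_ + X)%E]nuAN adde0.
  rewrite -nuN.
  apply: le_measure; rewrite ?inE; [exact: measurableD | exact: measurableC | by move=> x []].
by rewrite muE // nuA adde0.
Qed.

End Density.

(** * Comparison of the kernels *)

Lemma near_natr_ge (R : realType) (M : R) : \forall n \near \oo, M <= n%:R.
Proof.
have [N hN] : exists N : nat, `|M| < N%:R by eexists; apply: archi_boundP.
exists N => // n Nn; apply: le_trans (ler_norm M) (le_trans (ltW hN) _).
by rewrite ler_nat.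
Qed.

Section KernelAsymptotics.
Variables (R : realType) (L E : {scalar {poly R}}) (p : nat -> {poly R}).
Hypotheses (L_ge0 : positive_on_unit L) (E_ge0 : positive_on_unit E).
Hypothesis p_on : orthonormal_for L p.
Hypothesis E_on : orthonormal_for E (@chebyshev_on R).
Hypothesis p_sub : forall rho : R, 1 < rho -> exists2 C : R, 0 < C &
  forall n y, -1 <= y <= 1 -> `|(p n).[y]| <= C * rho ^+ n.
Variables (J : set R) (D dlt mass : R).
Hypotheses (dlt0 : 0 < dlt) (dlt1 : dlt <= 1) (D0 : 0 <= D).

Local Notation K := (reproducing_kernel p).
Local Notation KE := (reproducing_kernel (@chebyshev_on R)).

(* D bounds the error in KE_n(x,x) ~ n, uniformly over the points considered. *)
Definition well_inside (x : R) := [/\ -1 <= x <= 1,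
  forall t, `|t - x| < dlt -> J t & forall k, `|KE k x x - k%:R| <= D].

(* L is at most tau' times E, up to what f does outside J; lower_density is the
   converse comparison. *)
Definition upper_density (tau' : R) := forall (f : {poly R}) B, 0 <= B ->
  (forall x, -1 <= x <= 1 -> 0 <= f.[x]) ->
  (forall x, -1 <= x <= 1 -> ~ J x -> f.[x] <= B) -> L f <= tau' * E f + mass * B.

Definition lower_density (tau : R) := forall (f : {poly R}) B, 0 <= B ->
  (forall x, -1 <= x <= 1 -> 0 <= f.[x]) ->
  (forall x, -1 <= x <= 1 -> ~ J x -> f.[x] <= B) -> E f <= tau * L f + B.

(** E of the square is KE_n(x,x) <= n + D, and outside J Christoffel-Darboux bounds the square by (2
    / dlt)^2. *)
Lemma functional_sqr_chebyshev_kernel tau' n x : 0 <= tau' -> upper_density tau' ->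
  well_inside x ->
  L (kernel_poly (@chebyshev_on R) n x ^+ 2) <= tau' * (n%:R + D) + mass * (2 / dlt) ^+ 2.
Proof.
move=> t0 hL [x1 xJ xD].
apply: le_trans (hL _ ((2 / dlt) ^+ 2) _ _ _) _.
- exact: sqr_ge0.
- by move=> t _; rewrite horner_exp sqr_ge0.
- move=> t t1 Jt; rewrite horner_exp horner_kernel_poly -real_normK ?num_real //.
  apply: lerXn2r; rewrite ?nnegrE ?divr_ge0 ?(ltW dlt0) //.
  apply: chebyshev_kernel_off_diag => //.
  by rewrite distrC leNgt; apply/negP => /xJ.
- rewrite lerD2r; apply: ler_wpM2l => //.
  rewrite (kernel_poly_sqr E_on) -lerBlDl.
  exact: le_trans (ler_norm _) (xD n).
Qed.

(** The test polynomial KE_n(x,.) is at least n / 2 at x, and L of its square is at most 2 tau' n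
    for large n; the quotient (n / 2)^2 / (2 tau' n) is the bound. *)
Lemma kernel_diag_lower tau' : 0 < tau' -> upper_density tau' ->
  \forall n \near \oo, forall x, well_inside x -> n%:R / (8 * tau') <= K n x x.
Proof.
move=> t0 hL.
near=> n => x xW; have [x1 xJ xD] := xW.
have n1 : 1 <= n%:R :> R by near: n; exact: near_natr_ge.
have n0 : 0 < n%:R :> R by apply: lt_le_trans n1.
have nD : 2 * D <= n%:R by near: n; exact: near_natr_ge.
have nM : D + mass * (2 / dlt) ^+ 2 / tau' <= n%:R by near: n; exact: near_natr_ge.
have LK := @functional_sqr_chebyshev_kernel tau' n x (ltW t0) hL xW.
have LK2 : L (kernel_poly (@chebyshev_on R) n x ^+ 2) <= 2 * tau' * n%:R.
  apply: le_trans LK _.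
  have : (D + mass * (2 / dlt) ^+ 2 / tau') * tau' <= n%:R * tau' by rewrite ler_wpM2r // ltW.
  by rewrite mulrDl divfK ?gt_eqF //; lra.
have := sqr_horner_le L_ge0 p_on x (size_kernel_poly E_on n x).
rewrite horner_kernel_poly => main.
have lowKE : n%:R / 2 <= KE n x x.
  have := xD n; rewrite ler_norml => /andP[h _]; lra.
rewrite ler_pdivrMr ?mulr_gt0 //.
have K0 := kernel_diag_ge0 p n x.
have : (n%:R / 2) ^+ 2 <= K n x x * (2 * tau' * n%:R).
  apply: le_trans (le_trans _ main) _; last by rewrite ler_wpM2l.
  by apply: lerXn2r; rewrite ?nnegrE ?divr_ge0 // (le_trans _ lowKE) ?divr_ge0.
have -> : (n%:R / 2) ^+ 2 = n%:R * n%:R / 4 :> R by field.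
by move=> h; rewrite -(ler_pM2r n0); lra.
Unshelve. all: by end_near.
Qed.

(* Both kernels are within a factor 1 + O(eta) of n / kappa on the diagonal, so
   L ((K_n(x,.) - KE_n(x,.) / kappa)^2) = O(eta n), and evaluation at y costs
   K_n(y,y) = O(n). *)
Lemma kernel_near (eta kappa tau tau' : R) : 0 < eta -> eta < 1 -> 0 < kappa ->
  0 < tau -> 0 < tau' -> tau <= (1 + eta) / kappa -> tau' <= (1 + eta) * kappa ->
  lower_density tau -> upper_density tau' ->
  \forall n \near \oo, forall x y, well_inside x -> well_inside y ->
    (K n x y - KE n x y / kappa) ^+ 2 <= 20 * eta * (n%:R / kappa) ^+ 2.
Proof.
move=> e0 e1 k0 t0 t'0 ht ht' hE hL.
have up0 := @kernel_diag_upper R L E p L_ge0 E_ge0 p_on E_on p_sub J tau D dlt t0 dlt0 dlt1 hE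
  eta e0 e1.
(* The terms that stay bounded in n, later absorbed into eta n / kappa. *)
pose c1 := 2 * D / kappa + ((1 + eta) * kappa * D + mass * (2 / dlt) ^+ 2) / kappa ^+ 2.
near=> n => x y xW yW; have [x1 xJ xD] := xW; have [y1 yJ yD] := yW.
have nc : c1 * kappa / eta <= n%:R by near: n; exact: near_natr_ge.
have up1 z : well_inside z -> K n z z <= (1 + eta) * tau * n%:R.
  move=> [z1 zJ zD].
  have : forall x, -1 <= x <= 1 -> (forall t, `|t - x| < dlt -> J t) ->
    (forall k, KE k x x <= k%:R + D) -> K n x x <= (1 + eta) * tau * n%:R.
    by near: n; exact: up0.
  apply => // k; rewrite -lerBlDl; exact: le_trans (ler_norm _) (zD k).
have up z : well_inside z -> K n z z <= (1 + eta) ^+ 2 * (n%:R / kappa).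
  move=> /up1 /le_trans; apply.
  have e10 : 0 <= 1 + eta by lra.
  have := ler_wpM2l e10 (ler_wpM2r (ler0n R n) ht).
  by rewrite expr2; lra.
have gP y' : (kappa^-1 *: kernel_poly (@chebyshev_on R) n x).[y'] = KE n x y' / kappa.
  by rewrite hornerZ horner_kernel_poly mulrC.
have sg : (size (kappa^-1 *: kernel_poly (@chebyshev_on R) n x)%R <= n)%N.
  exact: leq_trans (size_scale_leq _ _) (size_kernel_poly E_on n x).
have := sqr_kernel_sub_le L_ge0 p_on x y sg.
rewrite !gP exprZn => /le_trans; apply.
have LK := @functional_sqr_chebyshev_kernel tau' n x (ltW t'0) hL xW.
set Q := L (kernel_poly _ n x ^+ 2) in LK.
have -> : L (kappa^-1 ^+ 2 *: kernel_poly (@chebyshev_on R) n x ^+ 2) = kappa^-1 ^+ 2 * Q.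
  by rewrite linearZ.
have n0 : 0 <= n%:R :> R by [].
have kv : 0 < kappa^-1 by rewrite invr_gt0.
(* The main terms give (1 + eta)^2 - 2 + (1 + eta) <= 4 eta and [c1] gives the fifth eta; the factor
   (1 + eta)^2 <= 4 from K_n(y,y) then turns 5 into 20. *)
have bracket : K n x x - 2 * (KE n x x / kappa) + kappa^-1 ^+ 2 * Q <= 5 * eta * (n%:R / kappa).
  have h1 := up x xW.
  have h2 : (n%:R - D) / kappa <= KE n x x / kappa.
    rewrite ler_pM2r //; have := xD n; rewrite ler_norml => /andP[h _]; lra.
  have h3 : kappa^-1 ^+ 2 * Q <= kappa^-1 ^+ 2 * ((1 + eta) * kappa * (n%:R + D) + mass * (2 /
    dlt) ^+ 2).
    rewrite ler_pM2l ?exprn_gt0 //; apply: le_trans LK _.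
    by rewrite lerD2r ler_wpM2r // addr_ge0.
  have h4 : c1 <= eta * (n%:R / kappa).
    by rewrite mulrA ler_pdivlMr // [eta * _]mulrC -ler_pdivrMr.
  have h5 : kappa^-1 ^+ 2 * ((1 + eta) * kappa * (n%:R + D) + mass * (2 / dlt) ^+ 2) =
     (1 + eta) * (n%:R / kappa) + ((1 + eta) * kappa * D + mass * (2 / dlt) ^+ 2) / kappa ^+ 2.
    by field; rewrite !lt0r_neq0.
  have h6 : (n%:R - D) / kappa = n%:R / kappa - D / kappa by field; rewrite gt_eqF.
  have h7 : (1 + eta) ^+ 2 * (n%:R / kappa) = (1 + 2 * eta) * (n%:R / kappa) + eta ^+ 2 *
    (n%:R / kappa) by ring.
  have nk0 : 0 <= n%:R / kappa by rewrite divr_ge0 // ltW.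
  have h8 : eta ^+ 2 * (n%:R / kappa) <= eta * (n%:R / kappa).
    by rewrite ler_wpM2r // expr2 ler_piMl // ltW.
  move: h1 h2 h3 h4; rewrite h5 h6 h7 /c1; move: h8.
  set A := n%:R / kappa; set B1 := D / kappa; set B2 := _ / kappa ^+ 2.
  have -> : 2 * D / kappa = 2 * B1 by rewrite /B1 mulrA.
  lra.
have br0 : 0 <= K n x x - 2 * (KE n x x / kappa) + kappa^-1 ^+ 2 * Q.
  have := functional_sqr_ge0 L_ge0 (kernel_poly p n x - kappa^-1 *: kernel_poly (@chebyshev_on
    R) n x).
  rewrite sqrrB linearD linearB /= (kernel_poly_sqr p_on) linearMn /=.
  by rewrite (kernel_poly_reproducing p_on) // gP exprZn linearZ /= mulr_natl.
have := up y yW => hy.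
have nk0 : 0 <= n%:R / kappa by rewrite divr_ge0 // ltW.
apply: (@le_trans _ _ ((1 + eta) ^+ 2 * (n%:R / kappa) * (5 * eta * (n%:R / kappa)))).
  by apply: ler_pM; [exact: kernel_diag_ge0 | exact: br0 | exact: hy | exact: bracket].
have -> : (1 + eta) ^+ 2 * (n%:R / kappa) * (5 * eta * (n%:R / kappa)) =
  5 * eta * (n%:R / kappa) ^+ 2 * (1 + eta) ^+ 2 by ring.
have -> : 20 * eta * (n%:R / kappa) ^+ 2 = 5 * eta * (n%:R / kappa) ^+ 2 * 4 by ring.
apply: ler_wpM2l; first by rewrite !mulr_ge0 ?sqr_ge0 // ltW.
by rewrite expr2; nra.
Unshelve. all: by end_near.
Qed.

End KernelAsymptotics.

(** * The sine kernel as a limit of Chebyshev kernels *)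

Section Sinc.
Variable R : realType.
Implicit Types (x y a b : R).

Lemma cos_MVT x y : x <= y ->
  exists2 c : R, x <= c <= y & cos y - cos x = - sin c * (y - x).
Proof.
move=> xy; have [|c] := @MVT_segment R cos (fun t => - sin t) x y xy.
- by apply: continuous_subspaceT; exact: continuous_cos.
- by rewrite in_itv /= => cxy ->; exists c.
Qed.

Lemma sin_MVT x y : x <= y ->
  exists2 c : R, x <= c <= y & sin y - sin x = cos c * (y - x).
Proof.
move=> xy; have [|c] := @MVT_segment R sin cos x y xy.
- by apply: continuous_subspaceT; exact: continuous_sin.
- by rewrite in_itv /= => cxy ->; exists c.
Qed.

Lemma cos_lipschitz x y : `|cos x - cos y| <= `|x - y|.
Proof.
wlog xy : x y / x <= y => [hw|].
  have [|/ltW] := leP x y; first exact: hw.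
  by rewrite (distrC (cos x)) (distrC x); exact: hw.
rewrite (distrC (cos x)) (distrC x); have [c _ ->] := cos_MVT xy.
by rewrite normrM normrN ler_piMl // ler_norml sin_geN1 sin_le1.
Qed.

Lemma sin_increment x h : `|sin (x + h) - sin x - h * cos x| <= h ^+ 2.
Proof.
have [h0|h0] := leP 0 h.
  have [|c /andP[c1 c2] ->] := @sin_MVT x (x + h); first by rewrite lerDl.
  have -> : cos c * (x + h - x) - h * cos x = h * (cos c - cos x) by ring.
  rewrite normrM ger0_norm // expr2; apply: ler_wpM2l => //.
  by apply: le_trans (cos_lipschitz _ _) _; rewrite ger0_norm; lra.
have [|c /andP[c1 c2] e] := @sin_MVT (x + h) x; first by lra.
have -> : sin (x + h) - sin x - h * cos x = h * (cos c - cos x).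
  by rewrite -[sin (x + h) - _]opprB e; ring.
rewrite normrM ltr0_norm // -sqrrN expr2; apply: ler_wpM2l; first by lra.
by apply: le_trans (cos_lipschitz _ _) _; rewrite ler0_norm; lra.
Qed.

Definition sinc (b : R) : R := if b == 0 then 1 else sin b / b.

Lemma sine_kernelE a b : sine_kernel a b = sinc (pi * (a - b)).
Proof.
rewrite /sine_kernel /sinc -subr_eq0; have pi0 : pi != 0 :> R by rewrite gt_eqF // pi_gt0.
by rewrite mulf_eq0 (negbTE pi0).
Qed.

(** With step h = b / n, h times the sum is a Riemann sum for the integral of cos over [0, b].
    Telescoping [sin_increment] costs n h^2 = b^2 / n, that is |b| / n after division by b. *)
Lemma cos_mean_sinc n b : (0 < n)%N ->
  `|n%:R^-1 * \sum_(0 <= k < n) cos (k%:R * (b / n%:R)) - sinc b| <= `|b| / n%:R.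
Proof.
move=> n0; have n0' : 0 < n%:R :> R by rewrite ltr0n.
rewrite /sinc; case: eqP => [->|/eqP b0].
  rewrite mul0r; under eq_bigr do rewrite mulr0 cos0.
  by rewrite sumr_const_nat subn0 mulVf ?gt_eqF // subrr normr0 mul0r.
set h := b / n%:R.
have tele m : `|sin (m%:R * h) - h * \sum_(0 <= k < m) cos (k%:R * h)| <= m%:R * h ^+ 2.
  elim: m => [|m IH]; first by rewrite big_nil !mul0r sin0 mulr0 subrr normr0.
  rewrite big_nat_recr //= -natr1.
  have -> : sin ((m%:R + 1) * h) - h * (\sum_(0 <= i < m) cos (i%:R * h) + cos (m%:R * h)) =
    (sin (m%:R * h + h) - sin (m%:R * h) - h * cos (m%:R * h)) +
    (sin (m%:R * h) - h * \sum_(0 <= k < m) cos (k%:R * h)).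
    by rewrite mulrDl mul1r; ring.
  apply: le_trans (ler_normD _ _) _; rewrite mulrDl mul1r addrC; apply: lerD => //.
  exact: sin_increment.
have := tele n; have -> : n%:R * h = b by rewrite /h mulrC divfK // gt_eqF.
set S := \sum_(0 <= k < n) _ => hS.
have -> : n%:R^-1 * S - sin b / b = - (sin b - h * S) / b.
  by rewrite /h; field; rewrite b0 gt_eqF.
rewrite normrM normfV normrN ler_pdivrMr ?normr_gt0 //.
apply: le_trans hS _; rewrite le_eqVlt; apply/orP; left; apply/eqP.
rewrite mulrAC -expr2 real_normK ?num_real // /h.
by field; rewrite gt_eqF.
Qed.

Lemma cos_mean_sub n a b : (0 < n)%N ->
  `|n%:R^-1 * \sum_(0 <= k < n) cos (k%:R * a) - n%:R^-1 * \sum_(0 <= k < n) cos (k%:R * b)|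
  <= n%:R * `|a - b|.
Proof.
move=> n0; have n0' : 0 < n%:R :> R by rewrite ltr0n.
rewrite -mulrBr -sumrB normrM normfV (ger0_norm (ltW n0')) ler_pdivrMl //.
apply: le_trans (ler_norm_sum _ _ _) _.
rewrite [leRHS]mulr_natl -[n in _ *+ n]subn0 -sumr_const_nat.
rewrite big_nat [leRHS]big_nat; apply: ler_sum => k /andP[_ kn].
apply: le_trans (cos_lipschitz _ _) _.
by rewrite -mulrBr normrM ger0_norm // ler_wpM2r // ler_nat ltnW.
Qed.

(** For x = cos th and y = cos ph, the mean of cos (k (ph - th)) yields sinc and the sum of cos (k
    (ph + th)) stays bounded. The point z is the cosine of a mean value point, turning ph - th into
    (x - y) / sqrt (1 - z^2); z' is the cosine of the midpoint, controlling the second sum. Both lie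
    between x and y and do not depend on b. *)
Lemma chebyshev_kernel_sinc n x y : (0 < n)%N -> -1 < x < 1 -> -1 < y < 1 ->
  exists z z' : R, [/\ `|z - x| + `|z - y| <= `|x - y|, `|z' - x| + `|z' - y| <= `|x - y| &
    forall b, `|reproducing_kernel (@chebyshev_on R) n x y / n%:R - sinc b| <=
      `|n%:R * (x - y) / Num.sqrt (1 - z ^+ 2) - b| + `|b| / n%:R +
      (n%:R * Num.sqrt (1 - z' ^+ 2))^-1].
Proof.
move=> n0; have n0' : 0 < n%:R :> R by rewrite ltr0n.
(* Expressing betweenness by distances makes the statement symmetric; exchanging x and y changes b
   to -b, and sinc is even. *)
wlog xy : x y / y <= x => [hw x1 y1|].
  have [|/ltW xy] := leP y x; first by move=> xy; exact: hw.
  have [z [z' [h1 h2 h3]]] := hw y x xy y1 x1.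
  exists z, z'; rewrite (distrC x y) ![_ + `|_ - y|]addrC; split=> // b.
  have -> : reproducing_kernel (@chebyshev_on R) n x y = reproducing_kernel (@chebyshev_on R)
    n y x.
    by apply: eq_bigr => k _; rewrite mulrC.
  have := h3 (- b); rewrite /sinc oppr_eq0 sinN invrN mulrNN normrN.
  congr (_ <= _ + _ + _); rewrite -normrN; congr (`|_|); ring.
move=> /andP[x1 x2] /andP[y1 y2].
have Ix : x \in `[-1, 1] by rewrite in_itv /= !ltW.
have Iy : y \in `[-1, 1] by rewrite in_itv /= !ltW.
set th := acos x; set ph := acos y.
have xE : x = cos th by rewrite acosK.
have yE : y = cos ph by rewrite acosK.
have thph : th <= ph by apply: acos_anti => //; exact: ltW.
have th0 : 0 < th by rewrite acos_gt0 // ltW.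
have phpi : ph < pi by rewrite acos_ltpi // y1 ltW.
have [xi /andP[xi1 xi2] E] := cos_MVT thph.
have inside t : th <= t -> t <= ph -> [/\ y <= cos t, cos t <= x &
    sin t = Num.sqrt (1 - cos t ^+ 2) /\ 0 < sin t].
  move=> t1 t2; have t0 : 0 < t := lt_le_trans th0 t1.
  have tpi : t < pi := le_lt_trans t2 phpi.
  have s0 : 0 < sin t by apply: sin_gt0_pi; rewrite t0.
  split; last split=> //.
  - by rewrite yE ler_cos ?(ltW t0) ?(ltW tpi) //= ?(ltW phpi) ?andbT //; apply: le_trans t2;
    apply: ltW.
  - by rewrite xE ler_cos ?(ltW t0) ?(ltW tpi) //= ?(ltW th0) //=; apply: le_trans t1 (ltW tpi).
  - have -> : 1 - cos t ^+ 2 = sin t ^+ 2 by rewrite sin2cos2.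
    by rewrite sqrtr_sqr gtr0_norm.
have [z1 z2 [sz sz0]] := inside xi xi1 xi2.
have [z1' z2' [sz' sz0']] := inside ((th + ph) / 2) ltac:(lra) ltac:(lra).
have btw z : y <= z -> z <= x -> `|z - x| + `|z - y| <= `|x - y|.
  by move=> h1 h2; rewrite ler0_norm ?ger0_norm ?subr_le0 ?subr_ge0 //; lra.
exists (cos xi), (cos ((th + ph) / 2)); split; [exact: btw | exact: btw | move=> b].
have al : n%:R * (x - y) / Num.sqrt (1 - cos xi ^+ 2) = n%:R * (ph - th).
  rewrite -sz; have -> : x - y = sin xi * (ph - th).
    by rewrite {1}xE {1}yE -[cos th - _]opprB E; ring.
  by field; rewrite gt_eqF.
rewrite al -sz' {1}xE {1}yE chebyshev_kernel_cos.
have -> : \sum_(0 <= k < n) cos (k%:R * (th - ph)) = \sum_(0 <= k < n) cos (k%:R * (ph - th)).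
  by apply: eq_bigr => k _; rewrite -cosN -mulrN opprB.
rewrite mulrDl [_ / n%:R]mulrC.
set A := n%:R^-1 * _; set B := \sum_(1 <= k < n) _.
have hA : `|A - sinc b| <= `|n%:R * (ph - th) - b| + `|b| / n%:R.
  have -> : A - sinc b = (A - n%:R^-1 * \sum_(0 <= k < n) cos (k%:R * (b / n%:R))) +
     (n%:R^-1 * \sum_(0 <= k < n) cos (k%:R * (b / n%:R)) - sinc b) by ring.
  apply: le_trans (ler_normD _ _) _; apply: lerD; last exact: cos_mean_sinc.
  apply: le_trans (cos_mean_sub _ _ n0) _.
  rewrite -{1}(ger0_norm (ltW n0')) -normrM mulrBr.
  by have -> : n%:R * (b / n%:R) = b by rewrite mulrC divfK // gt_eqF.
have hB : `|B / n%:R| <= (n%:R * sin ((th + ph) / 2))^-1.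
  rewrite normrM normfV (ger0_norm (ltW n0')) invfM mulrC ler_pM2l ?invr_gt0 //.
  by apply: le_trans (cos_sum_le n (lt0r_neq0 sz0')) _; rewrite gtr0_norm.
have -> : A + B / n%:R - sinc b = A - sinc b + B / n%:R by ring.
by apply: le_trans (ler_normD _ _) _; apply: lerD.
Qed.

End Sinc.

(** * Comparison of the two functionals on a subinterval of [c, d] *)

Section LocalComparison.
Variables (R : realType) (mu : {finite_measure set (measurableTypeR R) -> \bar R}).
Variables (w : R -> R) (c d : R).
Local Notation leb := (@lebesgue_measure R).
Hypotheses (w_dens : ac_density mu w) (I_sub : `[c, d] `<=` (`]-1, 1[ : set R)).
Hypothesis mu_ac : mrestr mu (measurable_itv `[c, d]) `<< leb.
Variables (L E : {scalar {poly R}}).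
Hypothesis L_mu : forall f, L f = \int[mu]_(x in `](-1), 1[) f.[x].
Hypothesis E_cos : forall f, E f = pi^-1 * \int[leb]_(t in `[0, pi]) f.[cos t].

Let measurable_w (A : set (measurableTypeR R)) : measurable A -> A `<=` `[c, d] ->
  measurable_fun A (fun x => (w x)%:E).
Proof.
move=> mA Acd; apply/measurable_EFinP.
have [mw _ _] := w_dens; apply: measurable_funS mw; first exact: measurable_itv.
exact: subset_trans Acd I_sub.
Qed.

Lemma density_measure_ge (a b m : R) : 0 <= m -> `[a, b] `<=` `[c, d] ->
  (forall x, a <= x <= b -> m <= w x) ->
  forall A : set (measurableTypeR R), measurable A -> A `<=` `[a, b] ->
    (m%:E * leb A <= mu A)%E.
Proof.
move=> m0 abcd hm A mA Aab; have Acd := subset_trans Aab abcd.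
rewrite (mu_density w_dens I_sub mu_ac mA Acd) -integral_cst //.
apply: ge0_le_integral => //.
- exact: measurable_w.
- by move=> x /Aab /=; rewrite in_itv /= lee_fin; exact: hm.
Qed.

Lemma density_measure_le (a b M : R) : `[a, b] `<=` `[c, d] ->
  (forall x, a <= x <= b -> 0 <= w x <= M) ->
  forall A : set (measurableTypeR R), measurable A -> A `<=` `[a, b] ->
    (mu A <= M%:E * leb A)%E.
Proof.
move=> abcd hM A mA Aab; have Acd := subset_trans Aab abcd.
rewrite (mu_density w_dens I_sub mu_ac mA Acd) -integral_cst //.
apply: ge0_le_integral => //.
- by move=> x /Aab /=; rewrite in_itv /= lee_fin => /hM /andP[].
- exact: measurable_w.
- by move=> x /Aab /=; rewrite in_itv /= lee_fin => /hM /andP[].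
Qed.

Let mass := fine (mu [set` `](-1), 1[]).

Section OnInterval.
Variables (a b : R).
Hypotheses (ab : a <= b) (abcd : `[a, b] `<=` `[c, d]).

Let ab_sub : `[a, b] `<=` (`]-1, 1[ : set R).
Proof. exact: subset_trans abcd I_sub. Qed.

Let a1 : -1 <= a.
Proof.
have : [set` `](-1 : R), 1[] a by apply: ab_sub; rewrite /= in_itv /= lexx ab.
by rewrite /= in_itv /= => /andP[/ltW].
Qed.

Let b1 : b <= 1.
Proof.
have : [set` `](-1 : R), 1[] b by apply: ab_sub; rewrite /= in_itv /= lexx ab.
by rewrite /= in_itv /= => /andP[_ /ltW].
Qed.

Lemma lower_density_on (m sg : R) : 0 < m -> 0 < sg ->
  (forall x, a <= x <= b -> m <= w x) ->
  (forall x, a <= x <= b -> sg <= Num.sqrt (1 - x ^+ 2)) ->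
  lower_density L E [set x | a <= x <= b] (pi * sg * m)^-1.
Proof.
move=> m0 sg0 hm hsg f B B0 f0 fB.
apply: le_trans (arcsine_le E_cos a1 ab b1 f0 sg0 hsg B0 _) _ => //.
rewrite lerD2r [(pi * sg * m)^-1]invfM -mulrA ler_pM2l ?invr_gt0 ?mulr_gt0 ?pi_gt0 //.
rewrite ler_pdivlMl //.
by apply: (mu_functional_ge L_mu ab_sub f0 (ltW m0)); apply: density_measure_ge => //;
  exact: ltW.
Qed.

Lemma upper_density_on (M sg : R) : 0 <= M ->
  (forall x, a <= x <= b -> 0 <= w x <= M) ->
  (forall x, a <= x <= b -> Num.sqrt (1 - x ^+ 2) <= sg) ->
  upper_density L E [set x | a <= x <= b] mass (pi * sg * M).
Proof.
move=> M0 hM hsg f B B0 f0 fB.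
apply: le_trans (mu_functional_le L_mu ab_sub f0 M0 B0 (density_measure_le abcd hM) _) _ => //.
rewrite [mass * B]mulrC lerD2r [pi * sg * M]mulrC -mulrA; apply: ler_wpM2l => //.
exact: (Rintegral_le_arcsine E_cos).
Qed.

End OnInterval.
End LocalComparison.

Lemma bounded_mul_cvg0 (R : realType) (a u : nat -> R) (A : R) :
  (forall n, `|a n| <= A) -> u n @[n --> \oo] --> 0 -> a n * u n @[n --> \oo] --> 0.
Proof.
move=> aA u0; have A0 : 0 <= A := le_trans (normr_ge0 _) (aA 0%N).
apply/cvgrPdist_lt => e e0.
have e1 : 0 < e / (A + 1) by rewrite divr_gt0 //; lra.
have /cvgrPdist_lt/(_ _ e1) := u0; apply: filterS => n.
rewrite !sub0r !normrN normrM ltr_pdivlMr ?ltr_wpDl // => h.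
apply: le_lt_trans h; rewrite mulrC; apply: ler_wpM2l => //.
by apply: le_trans (aA n) _; rewrite lerDl.
Qed.

Lemma le_cvg0 (R : realType) (u v : nat -> R) :
  (\forall n \near \oo, `|u n| <= v n) -> v n @[n --> \oo] --> 0 -> u n @[n --> \oo] --> 0.
Proof.
move=> uv v0; apply/cvgrPdist_lt => e e0.
have /cvgrPdist_lt/(_ _ e0) := v0; apply: filterS2 uv => n uvn.
rewrite !sub0r !normrN => h; apply: le_lt_trans uvn (le_lt_trans (ler_norm _) h).
Qed.

Lemma natr_inv_cvg0 (R : realType) : (n%:R : R)^-1 @[n --> \oo] --> (0 : R).
Proof.
apply/cvgrPdist_lt => e e0; near=> n.
have h : e^-1 + 1 <= n%:R by near: n; exact: near_natr_ge.
have ei : 0 < e^-1 by rewrite invr_gt0.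
have n0 : 0 < n%:R :> R by lra.
rewrite sub0r normrN ger0_norm ?invr_ge0 ?(ltW n0) //.
by rewrite invf_plt ?posrE //; lra.
Unshelve. all: by end_near.
Qed.

Lemma sinc_bounded (R : realType) (b : R) : `|sinc b| <= 1 + `|b|.
Proof.
have := @cos_mean_sinc R 1 b isT; rewrite big_nat1 mul0r cos0 divr1 mulr1 invr1 => h.
have -> : sinc b = 1 - (1 - sinc b) by ring.
by apply: le_trans (ler_normB _ _) _; rewrite normr1 lerD2l.
Qed.

Lemma continuous_sqrt_1Bsqr (R : realType) : continuous (fun x : R => Num.sqrt (1 - x ^+ 2)).
Proof.
move=> x; apply: continuous_comp; last exact: sqrt_continuous.
apply: cvgB; first exact: cvg_cst.
exact: exprn_continuous.
Qed.

(** * Kernel asymptotics near a continuity point of the density *)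

Section PointwiseLimit.
Variables (R : realType) (mu : {finite_measure set (measurableTypeR R) -> \bar R}).
Variables (w : R -> R) (c d : R).
Local Notation leb := (@lebesgue_measure R).
Hypotheses (w_dens : ac_density mu w) (I_sub : `[c, d] `<=` (`]-1, 1[ : set R)).
Hypothesis mu_ac : mrestr mu (measurable_itv `[c, d]) `<< leb.
Variables (L E : {scalar {poly R}}) (p : nat -> {poly R}).
Hypotheses (L_ge0 : positive_on_unit L) (E_ge0 : positive_on_unit E).
Hypothesis L_mu : forall f, L f = \int[mu]_(x in `](-1), 1[) f.[x].
Hypothesis E_cos : forall f, E f = pi^-1 * \int[leb]_(t in `[0, pi]) f.[cos t].
Hypothesis p_on : orthonormal_for L p.
Hypothesis E_on : orthonormal_for E (@chebyshev_on R).
Hypothesis p_sub : forall rho : R, 1 < rho -> exists2 C : R, 0 < C &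
  forall n y, -1 <= y <= 1 -> `|(p n).[y]| <= C * rho ^+ n.
Local Notation K := (reproducing_kernel p).
Local Notation KE := (reproducing_kernel (@chebyshev_on R)).

Section AtPoint.
Variable x0 : R.
Hypotheses (x0cd : c < x0 < d) (w0 : 0 < w x0) (w_cont : {for x0, continuous w}).
Let s0 := Num.sqrt (1 - x0 ^+ 2).
Let kappa := pi * s0 * w x0.

Let x01 : -1 < x0 < 1.
Proof.
have := @I_sub x0; rewrite /= !in_itv /=; apply.
by case/andP: x0cd => /ltW -> /ltW ->.
Qed.

Let s00 : 0 < s0.
Proof. by rewrite sqrtr_gt0; case/andP: x01 => ? ?; rewrite expr2; nra. Qed.

Let kappa0 : 0 < kappa.
Proof. by rewrite !mulr_gt0 // pi_gt0. Qed.

Lemma kernel_near_continuity_point (eps : R) : 0 < eps ->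
  exists2 dlt : R, 0 < dlt & \forall n \near \oo, forall x y,
    `|x - x0| <= dlt -> `|y - x0| <= dlt ->
    `|K n x y - KE n x y / kappa| <= eps * n%:R.
Proof.
move=> eps0.
(* [kernel_near] bounds the square of the difference by 20 eta (n / kappa)^2, to be compared with
   (eps n)^2. *)
have [eta [e0 e1 he]] : exists eta : R, [/\ 0 < eta, eta < 1 & 20 * eta <= (eps * kappa) ^+ 2].
  exists (Num.min 2^-1 ((eps * kappa) ^+ 2 / 20)); split.
  - by rewrite lt_min invr_gt0 ltr0n divr_gt0 // exprn_gt0 // mulr_gt0.
  - by rewrite gt_min; apply/orP; left; lra.
  - by rewrite -ler_pdivlMl // mulrC ge_min lexx orbT.
(* The relative variation allowed to w and to sqrt (1 - x^2): both (1 + th)^2 <= 1 + eta and 1 <= (1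
   + eta)(1 - th)^2 hold. *)
pose th := eta / 4.
have th0 : 0 < th by rewrite divr_gt0.
have [r r0 hr] : exists2 r : R, 0 < r & forall x, `|x - x0| < r ->
    [/\ c <= x <= d, w x0 * (1 - th) <= w x <= w x0 * (1 + th) &
        s0 * (1 - th) <= Num.sqrt (1 - x ^+ 2) <= s0 * (1 + th)].
  have h1 : \forall x \near x0, c < x < d.
    have x0I : x0 \in `]c, d[ by rewrite in_itv.
    by have := near_in_itvoo x0I; apply: filterS => x; rewrite in_itv.
  have h2 : \forall x \near x0, `|w x0 - w x| < w x0 * th.
    by have /cvgrPdist_lt := w_cont; apply; rewrite mulr_gt0.
  have h3 : \forall x \near x0, `|s0 - Num.sqrt (1 - x ^+ 2)| < s0 * th.
    by have /cvgrPdist_lt := @continuous_sqrt_1Bsqr R x0; apply; rewrite mulr_gt0.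
  have h123 : nbhs x0 [set x | [/\ c < x < d, `|w x0 - w x| < w x0 * th &
      `|s0 - Num.sqrt (1 - x ^+ 2)| < s0 * th]].
    by apply: filterS3 h1 h2 h3 => x.
  move: h123 => /nbhs_ballP[r /= r0 hr].
  exists r => // x xr; have [| h4 h5 h6] := hr x; first by rewrite /ball /= distrC.
  move: h5 h6; rewrite !ltr_norml => /andP[? ?] /andP[? ?].
  split; first by case/andP: h4 => /ltW -> /ltW ->.
    by apply/andP; split; lra.
  by apply/andP; split; lra.
pose dlt := Num.min 1 (r / 4).
have dlt0 : 0 < dlt by rewrite lt_min ltr01 divr_gt0.
have dlt1 : dlt <= 1 by rewrite ge_min lexx.
have dltr : 2 * dlt < r.
  have : dlt <= r / 4 by rewrite ge_min lexx orbT.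
  lra.
(* The radius is doubled so that every point within dlt of x0 has its dlt-neighbourhood inside
   [a, b]. *)
pose a := x0 - 2 * dlt; pose b := x0 + 2 * dlt.
have ab : a <= b by rewrite /a /b; lra.
have inr x : a <= x <= b -> `|x - x0| < r.
  by rewrite /a /b => /andP[? ?]; rewrite ltr_norml; apply/andP; split; lra.
have abcd : `[a, b] `<=` `[c, d].
  by move=> x; rewrite /= !in_itv /= => /inr/hr[].
pose sg := s0 * (1 - th); pose sg' := s0 * (1 + th).
pose m := w x0 * (1 - th); pose M := w x0 * (1 + th).
have th1 : th < 1 / 4 by rewrite /th; lra.
have sg0 : 0 < sg by rewrite mulr_gt0 //; lra.
have sg'0 : 0 < sg' by rewrite mulr_gt0 //; lra.
have m0 : 0 < m by rewrite mulr_gt0 //; lra.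
have M0 : 0 < M by rewrite mulr_gt0 //; lra.
have pi0 := pi_gt0 R.
have low : lower_density L E [set x | a <= x <= b] (pi * sg * m)^-1.
  apply: (lower_density_on w_dens I_sub mu_ac L_mu E_cos ab abcd m0 sg0).
  - by move=> x /inr/hr[_ /andP[]].
  - by move=> x /inr/hr[_ _ /andP[]].
have upp : upper_density L E [set x | a <= x <= b] (fine (mu [set` `](-1), 1[])) (pi * sg' * M).
  apply: (upper_density_on w_dens I_sub mu_ac L_mu E_cos ab abcd (ltW M0)).
  - move=> x /inr/hr[_ /andP[h1 h2] _]; rewrite h2 andbT; apply: le_trans h1; exact: ltW.
  - by move=> x /inr/hr[_ _ /andP[]].
pose D := sg^-1; have D0 : 0 <= D by rewrite invr_ge0 ltW.
exists dlt => //.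
have psm : 0 < pi * sg * m by apply: mulr_gt0 => //; exact: mulr_gt0.
have tau0 : 0 < (pi * sg * m)^-1 by rewrite invr_gt0.
have tau'0 : 0 < pi * sg' * M by apply: mulr_gt0 => //; exact: mulr_gt0.
have h1 : (pi * sg * m)^-1 <= (1 + eta) / kappa.
  rewrite ler_pdivlMr // mulrC ler_pdivrMr //.
  have -> : (1 + eta) * (pi * sg * m) = kappa * ((1 + eta) * (1 - th) ^+ 2) by rewrite /sg /m
    /kappa; ring.
  by rewrite -[leLHS]mulr1 ler_pM2l // /th expr2; nra.
have h2 : pi * sg' * M <= (1 + eta) * kappa.
  have -> : pi * sg' * M = (1 + th) ^+ 2 * kappa by rewrite /sg' /M /kappa; ring.
  by rewrite ler_pM2r // /th expr2; nra.
have main := kernel_near (D := D) L_ge0 E_ge0 p_on E_on p_sub dlt0 dlt1 D0 e0 e1 kappa0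
  tau0 tau'0 h1 h2 low upp.
near=> n => x y xd yd.
have wi z : `|z - x0| <= dlt -> well_inside [set x | a <= x <= b] D dlt z.
  move=> zd; have zab : a <= z <= b.
    by move: zd; rewrite ler_norml /a /b => /andP[? ?]; apply/andP; split; lra.
  have zI : -1 < z < 1.
    by have := @I_sub z; rewrite /= !in_itv /=; apply; have [] := hr z (inr z zab).
  split.
  - by case/andP: zI => /ltW -> /ltW ->.
  - move=> t; move: zd; rewrite ler_norml ltr_norml /= /a /b => /andP[? ?] /andP[? ?].
    by apply/andP; split; lra.
  - move=> k; apply: le_trans (chebyshev_kernel_diag k zI) _.
    have [_ _ /andP[h _]] := hr z (inr z zab).
    by rewrite lef_pV2 ?posrE // (lt_le_trans sg0).
have : (K n x y - KE n x y / kappa) ^+ 2 <= 20 * eta * (n%:R / kappa) ^+ 2.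
  have : forall x y, well_inside [set x | a <= x <= b] D dlt x ->
    well_inside [set x | a <= x <= b] D dlt y ->
    (K n x y - KE n x y / kappa) ^+ 2 <= 20 * eta * (n%:R / kappa) ^+ 2.
    by near: n; exact: main.
  by apply; apply: wi.
rewrite -[leLHS]real_normK ?num_real // => h.
have en0 : 0 <= eps * n%:R by rewrite mulr_ge0 // ltW.
rewrite -(@ler_pXn2r _ 2) ?nnegrE //; apply: le_trans h _.
have -> : (eps * n%:R) ^+ 2 = (eps * kappa) ^+ 2 * (n%:R / kappa) ^+ 2.
  by field; rewrite gt_eqF.
by rewrite ler_wpM2r // sqr_ge0.
Unshelve. all: by end_near.
Qed.

End AtPoint.
End PointwiseLimit.

Lemma cvg_sub0 (R : realType) (u v : nat -> R) (l : R) :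
  u n - v n @[n --> \oo] --> (0 : R) -> v n @[n --> \oo] --> l -> u n @[n --> \oo] --> l.
Proof.
move=> uv vl; have h := cvgD uv vl; rewrite add0r in h.
have -> : u = (fun n => u n - v n) + v by apply/funext => n; rewrite fctE subrK.
exact: h.
Qed.

Lemma near_eq_cvgn (R : realType) (u v : nat -> R) (l : R) :
  (\forall n \near \oo, u n = v n) -> v n @[n --> \oo] --> l -> u n @[n --> \oo] --> l.
Proof.
move=> uv; apply: cvg_trans; apply: near_eq_cvg.
by apply: filterS uv => n ->.
Qed.

Lemma cvgn_continuous (R : realType) (f : R -> R) (z : nat -> R) (l : R) :
  {for l, continuous f} -> z n @[n --> \oo] --> l -> f (z n) @[n --> \oo] --> f l.
Proof. by move=> cf zl; exact: continuous_cvg. Qed.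

(** * The rescaled kernel at a continuity point, along bounded parameters *)

Section SineKernelLimit.
Variables (R : realType) (p : nat -> {poly R}) (w : R -> R) (x0 : R).
Local Notation K := (reproducing_kernel p).
Local Notation KE := (reproducing_kernel (@chebyshev_on R)).
Hypotheses (x01 : -1 < x0 < 1) (w0 : 0 < w x0) (w_cont : {for x0, continuous w}).
Let s0 := Num.sqrt (1 - x0 ^+ 2).
Let kappa := pi * s0 * w x0.
Hypothesis K_near : forall eps : R, 0 < eps ->
  exists2 dlt : R, 0 < dlt & \forall n \near \oo, forall x y,
    `|x - x0| <= dlt -> `|y - x0| <= dlt ->
    `|K n x y - KE n x y / kappa| <= eps * n%:R.
Variables (a b : nat -> R) (A : R).
Hypotheses (aA : forall n, `|a n| <= A) (bA : forall n, `|b n| <= A).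

Let s00 : 0 < s0.
Proof. by rewrite sqrtr_gt0; case/andP: x01 => ? ?; rewrite expr2; nra. Qed.

Let kappa0 : 0 < kappa.
Proof. by rewrite /kappa mulr_gt0 // mulr_gt0 // pi_gt0. Qed.

Let Kt n := normalized_kernel p w n x0 x0.

Let KtE n : Kt n = w x0 * K n x0 x0.
Proof. by rewrite /Kt /normalized_kernel -expr2 sqr_sqrtr // ltW. Qed.

Let natr_neq0 : \forall n \near \oo, n%:R != 0 :> R.
Proof. by exists 1%N => // n n1; rewrite pnatr_eq0 -lt0n. Qed.

Lemma kernel_sub_cvg0 (x y : nat -> R) : x n @[n --> \oo] --> x0 -> y n @[n --> \oo] --> x0 ->
  K n (x n) (y n) / n%:R - KE n (x n) (y n) / n%:R / kappa @[n --> \oo] --> (0 : R).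
Proof.
move=> xc yc; apply/cvgrPdist_le => e e0.
have [dlt d0 hd] := K_near e0.
near=> n.
have n0 : 0 < n%:R :> R by rewrite ltr0n; near: n; exists 1%N.
have hx : `|x n - x0| <= dlt.
  by rewrite distrC; near: n; have /cvgrPdist_le := xc; apply.
have hy : `|y n - x0| <= dlt.
  by rewrite distrC; near: n; have /cvgrPdist_le := yc; apply.
have h : `|K n (x n) (y n) - KE n (x n) (y n) / kappa| <= e * n%:R.
  have : forall x y, `|x - x0| <= dlt -> `|y - x0| <= dlt ->
    `|K n x y - KE n x y / kappa| <= e * n%:R by near: n; exact: hd.
  by apply.
rewrite sub0r normrN.
have -> : K n (x n) (y n) / n%:R - KE n (x n) (y n) / n%:R / kappa =
   (K n (x n) (y n) - KE n (x n) (y n) / kappa) / n%:R.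
  by rewrite mulrBl; congr (_ - _); rewrite mulrAC.
by rewrite normrM normfV (ger0_norm (ltW n0)) ler_pdivrMr.
Unshelve. all: by end_near.
Qed.

Lemma kernel_diag_cvg : K n x0 x0 / n%:R @[n --> \oo] --> kappa^-1.
Proof.
have h1 : KE n x0 x0 / n%:R @[n --> \oo] --> (1 : R).
  have h : KE n x0 x0 / n%:R - 1 @[n --> \oo] --> (0 : R).
    apply: (@le_cvg0 _ _ (fun n => s0^-1 * n%:R^-1)); last first.
      rewrite -(mulr0 s0^-1); apply: cvgM; [exact: cvg_cst | exact: natr_inv_cvg0].
    apply: filterS natr_neq0 => n n0.
    have -> : KE n x0 x0 / n%:R - 1 = (KE n x0 x0 - n%:R) / n%:R by rewrite mulrBl divff.
    rewrite normrM normfV normr_nat ler_wpM2r ?invr_ge0 //.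
    exact: chebyshev_kernel_diag.
  by apply: (cvg_sub0 h); exact: cvg_cst.
have h2 : K n x0 x0 / n%:R - KE n x0 x0 / n%:R / kappa @[n --> \oo] --> (0 : R).
  by apply: (@kernel_sub_cvg0 (fun=> x0) (fun=> x0)); exact: cvg_cst.
apply: (@cvg_sub0 _ (fun n => K n x0 x0 / n%:R) (fun n => KE n x0 x0 / n%:R / kappa) _ h2);
  rewrite -[X in _ --> X]mul1r.
by apply: cvgM => //; exact: cvg_cst.
Qed.

(** The factor w x0 of the normalized kernel cancels the one in kappa, so only the arcsine density
    is left. *)
Let nKt_cvg : n%:R / Kt n @[n --> \oo] --> pi * s0.
Proof.
have h : (w x0 * (K n x0 x0 / n%:R))^-1 @[n --> \oo] --> (w x0 * kappa^-1)^-1.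
  apply: cvgV; last exact: (cvgM (cvg_cst _) kernel_diag_cvg).
  by rewrite mulf_neq0 ?invr_eq0 // gt_eqF.
have -> : pi * s0 = (w x0 * kappa^-1)^-1.
  by rewrite invfM invrK [RHS]mulrC /kappa mulfK // gt_eqF.
apply: near_eq_cvgn h; apply: filterS natr_neq0 => n n0.
by rewrite KtE !invfM invrK; ring.
Qed.

Let shift_cvg (u : nat -> R) : (forall n, `|u n| <= A) ->
  x0 + u n / Kt n @[n --> \oo] --> x0.
Proof.
move=> uA; rewrite -[X in _ --> X]addr0; apply: cvgD; first exact: cvg_cst.
apply: (bounded_mul_cvg0 uA).
have h : n%:R^-1 * (n%:R / Kt n) @[n --> \oo] --> 0 * (pi * s0).
  by apply: cvgM; [exact: natr_inv_cvg0 | exact: nKt_cvg].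
rewrite mul0r in h; apply: near_eq_cvgn h; apply: filterS natr_neq0 => n n0.
by rewrite mulKf.
Qed.

Let x n := x0 + a n / Kt n.
Let y n := x0 + b n / Kt n.
Let S n := sinc (pi * (a n - b n)).

Let abA n : `|a n - b n| <= 2 * A.
Proof. by apply: le_trans (ler_normB _ _) _; have := aA n; have := bA n; lra. Qed.

Let sqrt_cvg (z : nat -> R) : z n @[n --> \oo] --> x0 ->
  Num.sqrt (1 - z n ^+ 2) @[n --> \oo] --> s0.
Proof. exact: (cvgn_continuous (@continuous_sqrt_1Bsqr R x0)). Qed.

Let chebyshev_cvg : KE n (x n) (y n) / n%:R - S n @[n --> \oo] --> (0 : R).
Proof.
have xc : x n @[n --> \oo] --> x0 by exact: shift_cvg.
have yc : y n @[n --> \oo] --> x0 by exact: shift_cvg.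
pose good n := [/\ (0 < n)%N, -1 < x n < 1 & -1 < y n < 1].
have nearI (u : nat -> R) : u n @[n --> \oo] --> x0 -> \forall n \near \oo, -1 < u n < 1.
  move=> uc; have x0I : x0 \in `](-1), 1[ by rewrite in_itv.
  have h : \forall n \near \oo, u n \in `](-1), 1[ := uc _ (near_in_itvoo x0I).
  by apply: filterS h => n; rewrite in_itv.
have hgood : \forall n \near \oo, good n.
  have npos : \forall n \near \oo, (0 < n)%N by exists 1%N.
  by apply: filterS3 npos (nearI _ xc) (nearI _ yc) => n.
(* The intermediate points become sequences squeezed to x0, with the junk value (0, 0) at the n that
   are not [good]. *)
have /choice[z hz] : forall n, exists z : R * R, good n ->
    [/\ `|z.1 - x n| <= `|x n - y n|, `|z.2 - x n| <= `|x n - y n| &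
    `|KE n (x n) (y n) / n%:R - S n| <=
      `|n%:R * (x n - y n) / Num.sqrt (1 - z.1 ^+ 2) - pi * (a n - b n)| +
      `|pi * (a n - b n)| / n%:R + (n%:R * Num.sqrt (1 - z.2 ^+ 2))^-1].
  move=> n; have [[n0 xn yn]|ng] := pselect (good n); last by exists (0, 0).
  have [z [z' [h1 h2 h3]]] := chebyshev_kernel_sinc n0 xn yn.
  exists (z, z') => _; split => /=; last exact: h3.
    by apply: le_trans h1; rewrite lerDl.
  by apply: le_trans h2; rewrite lerDl.
have zc (f : R * R -> R) : (forall n, good n -> `|f (z n) - x n| <= `|x n - y n|) ->
    f (z n) @[n --> \oo] --> x0.
  move=> hf; have h : f (z n) - x n @[n --> \oo] --> (0 : R).
    apply: (@le_cvg0 _ _ (fun n => `|x n - y n|)).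
      by apply: filterS hgood => n /hf.
    rewrite -(@normr0 _ R) -(subrr x0); apply: cvg_norm; exact: cvgB.
  exact: (cvg_sub0 h xc).
have z1c := sqrt_cvg (@zc fst (fun n g => let: And3 h _ _ := hz n g in h)).
have z2c := sqrt_cvg (@zc snd (fun n g => let: And3 _ h _ := hz n g in h)).
have s0n : s0 != 0 by rewrite gt_eqF.
apply: le_cvg0; first by apply: filterS hgood => n /hz[_ _]; exact.
rewrite -[X in _ --> X]addr0; apply: cvgD; first rewrite -[X in _ --> X]addr0;
  first apply: cvgD.
- rewrite -(@normr0 _ R); apply: cvg_norm.
  (* Here x n - y n = (a n - b n) / [Kt n]; the limit pi s0 of n / [Kt n] loses its factor s0 to the
     square root. *)
  have h : (a n - b n) * (n%:R / Kt n / Num.sqrt (1 - (z n).1 ^+ 2) - pi) @[n --> \oo] --> (0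
    : R).
    apply: (bounded_mul_cvg0 abA).
    have -> : (0 : R) = pi * s0 / s0 - pi by rewrite mulfK // subrr.
    apply: cvgB; last exact: cvg_cst.
    by apply: cvgM => //; exact: cvgV.
  apply: near_eq_cvgn h; near=> n.
  have -> : x n - y n = (a n - b n) / Kt n by rewrite /x /y; ring.
  set sq := Num.sqrt _; ring.
- apply: (@bounded_mul_cvg0 _ _ _ (pi * (2 * A))); last exact: natr_inv_cvg0.
  by move=> n; rewrite normr_id normrM ger0_norm ?pi_ge0 // ler_wpM2l ?pi_ge0.
- have h : n%:R^-1 * (Num.sqrt (1 - (z n).2 ^+ 2))^-1 @[n --> \oo] --> 0 * s0^-1.
    by apply: cvgM; [exact: natr_inv_cvg0 | exact: cvgV].
  by rewrite mul0r in h; apply: near_eq_cvgn h; near=> n; rewrite invfM.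
Unshelve. all: by end_near.
Qed.

Lemma normalized_kernel_cvg :
  normalized_kernel p w n (x0 + a n / normalized_kernel p w n x0 x0)
      (x0 + b n / normalized_kernel p w n x0 x0) / normalized_kernel p w n x0 x0
    - sine_kernel (a n) (b n) @[n --> \oo] --> (0 : R).
Proof.
have xc : x n @[n --> \oo] --> x0 by exact: shift_cvg.
have yc : y n @[n --> \oo] --> x0 by exact: shift_cvg.
(* The rescaled kernel is u n times K_n / n. Inserting w x0 and its inverse displays the limit of u
   as 1 times kappa. *)
pose u n := Num.sqrt (w (x n)) * Num.sqrt (w (y n)) / w x0 * (n%:R / Kt n * w x0).
have uc : u n @[n --> \oo] --> kappa.
  have sc (v : nat -> R) : v n @[n --> \oo] --> x0 ->
      Num.sqrt (w (v n)) @[n --> \oo] --> Num.sqrt (w x0).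
    move=> /(cvgn_continuous w_cont) wv.
    exact: (cvgn_continuous (@sqrt_continuous R (w x0)) wv).
  have -> : kappa = Num.sqrt (w x0) * Num.sqrt (w x0) / w x0 * (pi * s0 * w x0).
    by rewrite -expr2 sqr_sqrtr ?(ltW w0) // divff ?gt_eqF // mul1r.
  apply: cvgM; last by apply: cvgM => //; exact: cvg_cst.
  by apply: cvgM; [apply: cvgM; exact: sc | exact: cvg_cst].
have vc := @kernel_sub_cvg0 x y xc yc.
have vS : K n (x n) (y n) / n%:R - S n / kappa @[n --> \oo] --> (0 : R).
  have h : K n (x n) (y n) / n%:R - KE n (x n) (y n) / n%:R / kappa +
      (KE n (x n) (y n) / n%:R - S n) / kappa @[n --> \oo] --> 0 + 0 / kappa.
    by apply: cvgD => //; apply: cvgM => //; exact: cvg_cst.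
  rewrite mul0r addr0 in h; apply: near_eq_cvgn h; near=> n.
  by rewrite mulrBl addrA subrK.
have SA n : `|S n| <= 1 + pi * (2 * A).
  apply: le_trans (sinc_bounded _) _; rewrite lerD2l normrM ger0_norm ?pi_ge0 //.
  by rewrite ler_wpM2l ?pi_ge0.
have last1 : S n * (u n / kappa - 1) @[n --> \oo] --> (0 : R).
  apply: (bounded_mul_cvg0 SA); have -> : (0 : R) = kappa / kappa - 1.
    by rewrite divff ?subrr // gt_eqF.
  by apply: cvgB; [apply: cvgM => //; exact: cvg_cst | exact: cvg_cst].
have h : u n * (K n (x n) (y n) / n%:R - S n / kappa) + S n * (u n / kappa - 1)
    @[n --> \oo] --> kappa * 0 + 0.
  by apply: cvgD => //; exact: cvgM.
rewrite mulr0 addr0 in h; apply: near_eq_cvgn h; apply: filterS natr_neq0 => n n0.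
rewrite sine_kernelE -/(S n) /normalized_kernel -/(Kt n) -/(x n) -/(y n) /u.
set sx := Num.sqrt _; set sy := Num.sqrt _.
have w0n : w x0 != 0 by rewrite gt_eqF.
have kn : kappa != 0 by rewrite gt_eqF.
move: (S n) (K n _ _) (Kt n)^-1 kappa kn => Sn k V kap kn.
by field; rewrite ?n0 ?w0n ?kn.
Unshelve. all: by end_near.
Qed.

End SineKernelLimit.

(** * Almost everywhere continuity of Riemann integrable functions *)

Section RiemannContinuity.
Variables (R : realType) (c d : R) (f : R -> R).
Hypothesis cd : c < d.
Local Notation leb := (@lebesgue_measure R).

Definition uniform_partition (h : R) (N : nat) : seq R := mkseq (fun i => c + i.+1%:R * h) N.

Lemma nth_uniform_partition h N b i : (i <= N)%N ->
  nth b (c :: uniform_partition h N) i = c + i%:R * h.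
Proof.
case: i => [|i] iN /=; first by rewrite mul0r addr0.
by rewrite nth_mkseq.
Qed.

Lemma itv_uniform_partition N : (0 < N)%N ->
  itv_partition c d (uniform_partition ((d - c) / N%:R) N).
Proof.
move=> N0; have N0' : 0 < N%:R :> R by rewrite ltr0n.
split.
  apply/(pathP d) => i; rewrite size_mkseq => iN.
  rewrite nth_uniform_partition; last exact: ltnW.
  rewrite nth_mkseq // ltrD2l ltr_pM2r ?ltr_nat //.
  by rewrite divr_gt0 // subr_gt0.
rewrite (last_nth d) size_mkseq nth_uniform_partition //.
have -> : N%:R * ((d - c) / N%:R) = d - c by rewrite mulrC divfK ?gt_eqF.
by rewrite addrC subrK.
Qed.

Definition oscillates (eta x : R) := forall r, 0 < r ->
  exists2 y, `|y - x| < r & eta <= `|f y - f x|.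

Hypothesis f_int : riemann_integrable c d f.

(* Tagging the cells where f varies by at least eta in two extreme ways changes
   the Riemann sum by at least eta times their total length. *)
Lemma oscillating_cover (eta eps : R) : 0 < eta -> 0 < eps ->
  exists U : set (measurableTypeR R), [/\ measurable U, (leb U <= eps%:E)%E &
    forall x, c < x < d -> oscillates eta x -> U x].
Proof.
move=> eta0 eps0; have [l hl] := f_int.
(* Two Riemann sums within eta eps / 2 of l differ by less than eta eps, so the bad cells have total
   length at most eps. *)
have e0 : 0 < eta * eps / 2 by rewrite divr_gt0 // mulr_gt0.
have [dlt dlt0 {}hl] := hl _ e0.
have [N hN] : exists N : nat, (d - c) / dlt < N%:R.
  by eexists; apply: archi_boundP; rewrite divr_ge0 ?subr_ge0 ?(ltW cd) ?(ltW dlt0).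
have N0' : 0 < N%:R :> R by apply: le_lt_trans hN;
  rewrite divr_ge0 ?subr_ge0 ?(ltW cd) ?(ltW dlt0).
have N0 : (0 < N)%N by rewrite -(ltr0n R).
pose h := (d - c) / N%:R.
have h0 : 0 < h by rewrite divr_gt0 // subr_gt0.
have hd : h < dlt by rewrite /h ltr_pdivrMr // mulrC -ltr_pdivrMr.
pose xi i := c + i%:R * h.
have xiS i : xi i.+1 = xi i + h by rewrite /xi -natr1; ring.
pose bad i := exists t : R * R, [/\ xi i <= t.1 <= xi i.+1, xi i <= t.2 <= xi i.+1 &
  eta <= f t.1 - f t.2].
(* Cells that are not bad receive two equal tags, so they cannot offset the contribution of the bad
   ones. *)
have /choice[T hT] : forall i, exists t : R * R, [/\ xi i <= t.1 <= xi i.+1,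
    xi i <= t.2 <= xi i.+1, 0 <= f t.1 - f t.2 & bad i -> eta <= f t.1 - f t.2].
  move=> i; have [[t [t1 t2 t3]]|nb] := pselect (bad i).
    by exists t; split=> //; apply: le_trans t3; exact: ltW.
  exists (xi i, xi i) => /=; split=> //; rewrite ?lexx ?xiS ?lerDl ?(ltW h0) //.
  by rewrite subrr.
have part := itv_uniform_partition N0; rewrite -/h in part.
have sums (t : nat -> R) : (forall i, xi i <= t i <= xi i.+1) ->
    `|\sum_(0 <= i < N) f (t i) * h - l| < eta * eps / 2.
  move=> ht; have := hl (uniform_partition h N) t part; rewrite size_mkseq => main.
  have -> : \sum_(0 <= i < N) f (t i) * h = \sum_(0 <= i < N)
      f (t i) * (nth d (c :: uniform_partition h N) i.+1 - nth d (c :: uniform_partition h N)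
        i).
    apply: eq_big_nat => i /andP[_ iN]; congr (_ * _).
    by rewrite !nth_uniform_partition ?(ltnW iN) // -/(xi _) -/(xi _) xiS; ring.
  apply: main => i iN; rewrite !nth_uniform_partition ?(ltnW iN) // -/(xi i) -/(xi i.+1).
  have /andP[t1 t2] := ht i; split=> //.
  by rewrite xiS addrC addKr.
have s1 := sums (fun i => (T i).1) (fun i => let: And4 p _ _ _ := hT i in p).
have s2 := sums (fun i => (T i).2) (fun i => let: And4 _ p _ _ := hT i in p).
have badsum : \sum_(0 <= i < N) (if `[< bad i >] then h else 0) <= eps.
  rewrite -(ler_pM2l eta0).
  apply: (@le_trans _ _ (\sum_(0 <= i < N) f (T i).1 * h - \sum_(0 <= i < N) f (T i).2 * h)).
    rewrite -sumrB mulr_sumr; apply: ler_sum => i _; rewrite -mulrBl.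
    have [_ _ p1 p2] := hT i; case: asboolP => [/p2 p|_]; first by rewrite ler_pM2r.
    by rewrite mulr0 mulr_ge0 // ltW.
  by move: s1 s2; rewrite !ltr_norml => /andP[? ?] /andP[? ?]; lra.
(* At a subdivision point the oscillation may come from either side; adding these null singletons
   avoids deciding which. *)
pose A i : set (measurableTypeR R) := (if `[< bad i >] then [set` `[xi i, xi i.+1]] else set0)
  `|` [set xi i].
have mA i : measurable (A i).
  apply: measurableU; last exact: measurable_set1.
  by case: ifP => _; [exact: measurable_itv | exact: measurable0].
have lcell i : leb [set` `[xi i, xi i.+1]] = h%:E.
  by rewrite lebesgue_measure_itv /= lte_fin xiS ltrDl h0 -EFinD addrC addKr.
exists (\big[setU/set0]_(i < N) A i); split.
- by apply: bigsetU_measurable => i _; exact: mA.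
- apply: le_trans (Boole_inequality leb (fun i _ => mA i)) _.
  apply: (@le_trans _ _ (\sum_(i < N) (if `[< bad i >] then h else 0)%:E)%E).
    apply: lee_sum => i _; apply: le_trans (measureU2 _ _ _) _.
    + by case: ifP => _; [exact: measurable_itv | exact: measurable0].
    + exact: measurable_set1.
    + rewrite [X in (_ + X)%E](_ : _ = 0%E); last exact: lebesgue_measure_set1.
      rewrite adde0; case: ifP => _; last by rewrite measure0.
      by rewrite [X in (X <= _)%E](lcell i).
  by rewrite sumEFin lee_fin -(big_mkord xpredT (fun i => if `[< bad i >] then h else 0)).
- move=> x /andP[cx xd] osc.
  have xiN : xi N = d by rewrite /xi /h mulrC divfK ?gt_eqF // addrC subrK.
  have xi_le i j : (i <= j)%N -> xi i <= xi j.
    by move=> ij; rewrite lerD2l ler_pM2r // ler_nat.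
  have ex0 : exists i, xi i <= x by exists 0%N; rewrite /xi mul0r addr0 (ltW cx).
  have bnd i : xi i <= x -> (i <= N)%N.
    move=> ix; rewrite leqNgt; apply/negP => /ltnW /xi_le; rewrite xiN => di.
    by move: (lt_le_trans xd di); rewrite ltNge ix.
  case: (ex_maxnP ex0 bnd) => i ix imax.
  have xi1 : x < xi i.+1 by rewrite ltNge; apply/negP => /imax; rewrite ltnn.
  have iN : (i < N)%N.
    rewrite ltnNge; apply/negP => /xi_le; rewrite xiN => di.
    by move: (lt_le_trans xd di); rewrite ltNge ix.
  rewrite -bigcup_mkord; exists i => //.
  have [->|xne] := eqVneq x (xi i); first by right.
  have ixl : xi i < x by rewrite lt_neqAle eq_sym xne.
  left; have -> : `[< bad i >]; last by rewrite /= in_itv /= ix (ltW xi1).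
  apply/asboolP.
  (* This radius keeps y in the cell of x, so x and y witness that the cell is bad. *)
  have r0 : 0 < Num.min (x - xi i) (xi i.+1 - x) by rewrite lt_min !subr_gt0 ixl.
  have [y] := osc _ r0; rewrite lt_min => /andP[y1 y2] fy.
  have yI : xi i <= y <= xi i.+1.
    by move: y1 y2; rewrite !ltr_norml => /andP[? ?] /andP[? ?]; apply/andP; split; lra.
  have xI : xi i <= x <= xi i.+1 by rewrite ix (ltW xi1).
  have [fxy|fxy] := leP 0 (f y - f x); first by exists (y, x); rewrite ger0_norm in fy.
  by exists (x, y); split => //=; rewrite ltr0_norm ?opprB in fy.
Qed.

(** A discontinuity oscillates by some 1 / (k + 1), and for fixed k such points lie in sets of
    arbitrarily small measure. *)
Lemma ae_continuous_of_riemann_integrable :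
  leb.-negligible [set x | c < x < d /\ ~ {for x, continuous f}].
Proof.
have osc0 (eta : R) : 0 < eta -> leb.-negligible [set x | c < x < d /\ oscillates eta x].
  move=> eta0.
  have /choice[U hU] : forall k : nat, exists U : set (measurableTypeR R),
      [/\ measurable U, (leb U <= (k.+1%:R^-1)%:E)%E &
      forall x, c < x < d -> oscillates eta x -> U x].
    by move=> k; apply: oscillating_cover; rewrite ?invr_gt0.
  exists (\bigcap_k U k); split.
  - by apply: bigcap_measurable => // k _; have [] := hU k.
  - apply/eqP; rewrite eq_le measure_ge0 andbT; apply/lee_addgt0Pr => e e0.
    rewrite add0e; have [k hk] : exists k : nat, e^-1 < k%:R.
      by eexists; apply: archi_boundP; rewrite invr_ge0 ltW.
    have [mU lU _] := hU k; apply: le_trans (_ : leb (U k) <= _)%E.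
      apply: le_measure; rewrite ?inE //.
        by apply: bigcap_measurable => // j _; have [] := hU j.
      by move=> x; apply.
    apply: le_trans lU _; rewrite lee_fin.
    rewrite invf_ple ?posrE //; apply: (le_trans (ltW hk)).
    by rewrite ler_nat.
  - by move=> x [xcd osc] k _; have [_ _] := hU k; apply.
have pos k : 0 < k.+1%:R^-1 :> R by rewrite invr_gt0.
apply: (negligibleS _ (negligible_bigcup (fun k => osc0 _ (pos k)))).
move=> x [xcd nc]; apply: contrapT => no; apply: nc.
apply/cvgrPdist_lt => e e0.
have [k hk] : exists k : nat, e^-1 < k%:R.
  by eexists; apply: archi_boundP; rewrite invr_ge0 ltW.
have ke : k.+1%:R^-1 < e.
  rewrite invf_plt ?posrE //; apply: (lt_le_trans hk); by rewrite ler_nat.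
have /existsNP[r /not_implyP[r0 hr]] : ~ oscillates (k.+1%:R^-1) x.
  by move=> osc; apply: no; exists k.
apply/nbhs_ballP; exists r => //= y; rewrite /ball /= distrC => yr.
rewrite distrC ltNge; apply/negP => le_e; apply: hr; exists y => //.
exact: le_trans (ltW ke) le_e.
Qed.

End RiemannContinuity.

(** * The universality limit *)

Lemma powR_cvg0 (R : realType) (u : nat -> R) (p : R) : 0 < p ->
  u n @[n --> \oo] --> (0 : R) -> `|u n| `^ p @[n --> \oo] --> (0 : R).
Proof.
move=> p0 u0; apply/cvgrPdist_lt => e e0.
have ep : 0 < e `^ p^-1 by rewrite powR_gt0.
have /cvgrPdist_lt/(_ _ ep) := u0; apply: filterS => n.
rewrite !sub0r !normrN (ger0_norm (powR_ge0 _ _)) => un.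
have -> : e = (e `^ p^-1) `^ p by rewrite -powRrM mulVf ?gt_eqF // powRr1 // ltW.
by apply: gt0_ltr_powR => //; rewrite nnegrE ?normr_ge0 // powR_ge0.
Qed.

Lemma compact_norm_bound (R : realType) (A : set R) : compact A ->
  exists2 M : R, 0 <= M & forall a, A a -> `|a| <= M.
Proof.
move=> /compact_bounded [M0 [_ hM]]; exists (`|M0| + 1); first by rewrite addr_ge0.
move=> a Aa; apply: (hM (`|M0| + 1)) => //.
by rewrite (le_lt_trans (ler_norm M0)) // ltrDl.
Qed.

(** * Uniform bounds and measurability on the smaller interval *)

Section UniformBounds.
Variables (R : realType) (mu : {finite_measure set (measurableTypeR R) -> \bar R}).
Variables (w : R -> R) (c d : R).
Local Notation leb := (@lebesgue_measure R).
Hypotheses (w_dens : ac_density mu w) (I_sub : `[c, d] `<=` (`]-1, 1[ : set R)).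
Hypothesis mu_ac : mrestr mu (measurable_itv `[c, d]) `<< leb.
Variables (L E : {scalar {poly R}}) (p : nat -> {poly R}).
Hypotheses (L_ge0 : positive_on_unit L) (E_ge0 : positive_on_unit E).
Hypothesis L_mu : forall f, L f = \int[mu]_(x in `](-1), 1[) f.[x].
Hypothesis E_cos : forall f, E f = pi^-1 * \int[leb]_(t in `[0, pi]) f.[cos t].
Hypothesis p_on : orthonormal_for L p.
Hypothesis E_on : orthonormal_for E (@chebyshev_on R).
Hypothesis p_sub : forall rho : R, 1 < rho -> exists2 C : R, 0 < C &
  forall n y, -1 <= y <= 1 -> `|(p n).[y]| <= C * rho ^+ n.
Variables (m M : R).
Hypotheses (m0 : 0 < m) (w_bnd : forall x, c <= x <= d -> m <= w x <= M).
Variables (c' d' : R).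
Hypotheses (cc' : c < c') (le_cd' : c' <= d') (dd' : d' < d).
Local Notation K := (reproducing_kernel p).

Let inI x : c <= x <= d -> -1 < x < 1.
Proof. by move=> xcd; have := @I_sub x; rewrite /= !in_itv /=; apply. Qed.

Let le_cd : c <= d. Proof. exact: le_trans (ltW cc') (le_trans le_cd' (ltW dd')). Qed.

Let M0 : 0 < M.
Proof.
have /w_bnd /andP[h1 h2] : c <= c <= d by rewrite lexx.
exact: lt_le_trans (le_trans h1 h2).
Qed.

(** The comparison is run on all of [c, d] with m and M in place of continuity of w. The two density
    ratios are then far from reciprocal, but the order n survives, uniformly in x. *)
Lemma kernel_diag_bounds : exists dlt C1 C2 : R, [/\ 0 < dlt, 0 < C1, 0 < C2,
  forall x, c' - dlt <= x <= d' + dlt -> c <= x <= d &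
  \forall n \near \oo, forall x, c' - dlt <= x <= d' + dlt ->
    C1 * n%:R <= K n x x <= C2 * n%:R].
Proof.
(* By concavity, 1 - x^2 attains its minimum over [c, d] at an endpoint. *)
pose sg := Num.sqrt (Num.min (1 - c ^+ 2) (1 - d ^+ 2)).
have sg0 : 0 < sg.
  have /inI /andP[c1 c2] : c <= c <= d by rewrite lexx.
  have /inI /andP[d1 d2] : c <= d <= d by rewrite lexx le_cd.
  by rewrite sqrtr_gt0 lt_min !expr2; apply/andP; split; nra.
have hsg x : c <= x <= d -> sg <= Num.sqrt (1 - x ^+ 2).
  move=> xcd; have /andP[x1 x2] := inI xcd.
  have x0 : 0 <= 1 - x ^+ 2 by rewrite expr2; nra.
  rewrite ler_sqrt // ge_min !lerD2l !lerN2 !expr2; move: xcd => /andP[h1 h2].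
  by have [x0'|x0'] := leP 0 x; apply/orP; [right|left]; nra.
(* Half of each gap, so that points within dlt of [c', d'] still have their dlt-neighbourhood in
   [c, d]. *)
pose dlt := Num.min 1 (Num.min ((c' - c) / 2) ((d - d') / 2)).
have dlt0 : 0 < dlt by rewrite !lt_min ltr01 !divr_gt0 // subr_gt0.
have dlt1 : dlt <= 1 by rewrite ge_min lexx.
have dltc : dlt <= (c' - c) / 2 by rewrite !ge_min lexx orbT.
have dltd : dlt <= (d - d') / 2 by rewrite !ge_min lexx !orbT.
have pi0 := pi_gt0 R.
have psm : 0 < pi * sg * m by rewrite mulr_gt0 // mulr_gt0.
have pM : 0 < pi * 1 * M by rewrite mulr1 mulr_gt0.
have low : lower_density L E [set x | c <= x <= d] (pi * sg * m)^-1.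
  apply: (lower_density_on w_dens I_sub mu_ac L_mu E_cos le_cd (@subset_refl _ _) m0 sg0 _ hsg).
  by move=> x /w_bnd /andP[].
have upp : upper_density L E [set x | c <= x <= d] (fine (mu [set` `](-1), 1[])) (pi * 1 * M).
  apply: (upper_density_on w_dens I_sub mu_ac L_mu E_cos le_cd (@subset_refl _ _) (ltW M0)).
    by move=> x /w_bnd /andP[h1 h2]; rewrite h2 andbT (le_trans _ h1) // ltW.
  move=> x xcd; rewrite -[leRHS]sqrtr1 ler_sqrt // lerBlDr lerDl sqr_ge0 //.
pose D := sg^-1; have D0 : 0 <= D by rewrite invr_ge0 ltW.
have inX x : c' - dlt <= x <= d' + dlt -> c <= x <= d.
  by move=> /andP[h1 h2]; apply/andP; split; lra.
have wi x : c' - dlt <= x <= d' + dlt -> well_inside [set x | c <= x <= d] D dlt x.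
  move=> xX; have xcd := inX x xX; have xI := inI xcd.
  split.
  - by case/andP: xI => /ltW -> /ltW ->.
  - move=> t; rewrite ltr_norml /= => /andP[t1 t2]; move: xX => /andP[h1 h2].
    by apply/andP; split; lra.
  - move=> k; apply: le_trans (chebyshev_kernel_diag k xI) _.
    by have h := hsg x xcd; rewrite lef_pV2 ?posrE // (lt_le_trans sg0).
have tau0 : 0 < (pi * sg * m)^-1 by rewrite invr_gt0.
have half0 : 0 < 2^-1 :> R by rewrite invr_gt0.
have half1 : 2^-1 < 1 :> R by lra.
have up := @kernel_diag_upper R L E p L_ge0 E_ge0 p_on E_on p_sub _ _ D dlt tau0 dlt0 dlt1 low
  _ half0 half1.
have dn := kernel_diag_lower L_ge0 p_on E_on D dlt0 pM upp.
exists dlt, (8 * (pi * 1 * M))^-1, ((1 + 2^-1) * (pi * sg * m)^-1); split=> //.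
- by rewrite invr_gt0 mulr_gt0.
- by rewrite mulr_gt0 //; lra.
- near=> n => x xX; have xW := wi x xX; have [x1 xJ xD] := xW.
  apply/andP; split.
    have h : forall x, well_inside [set x | c <= x <= d] D dlt x ->
      n%:R / (8 * (pi * 1 * M)) <= K n x x by near: n; exact: dn.
    by rewrite mulrC; exact: h.
  have h : forall x, -1 <= x <= 1 -> (forall t, `|t - x| < dlt -> c <= t <= d) ->
    (forall k, reproducing_kernel (@chebyshev_on R) k x x <= k%:R + D) ->
    K n x x <= (1 + 2^-1) * (pi * sg * m)^-1 * n%:R by near: n; exact: up.
  by apply: h => // k; rewrite -lerBlDl; exact: le_trans (ler_norm _) (xD k).
Unshelve. all: by end_near.
Qed.

Let Kt n x := normalized_kernel p w n x x.

(** On [c', d'] the normalized diagonal kernel is at least m C1 n, so the shifts are O(1/n) and stay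
    within dlt. Cauchy-Schwarz for the kernel and w <= M then bound the numerator by M C2 n. *)
Lemma normalized_kernel_dominated A : 0 <= A -> exists B : R,
  \forall n \near \oo, forall a b x, `|a| <= A -> `|b| <= A -> c' <= x <= d' ->
    [/\ c <= x + a / Kt n x <= d, c <= x + b / Kt n x <= d &
    `|normalized_kernel p w n (x + a / Kt n x) (x + b / Kt n x) / Kt n x
      - sine_kernel a b| <= B].
Proof.
move=> A0; have [dlt [C1 [C2 [dlt0 C10 C20 inX bnd]]]] := kernel_diag_bounds.
exists (M * C2 / (m * C1) + (1 + pi * (2 * A))).
near=> n => a b x aA bA xcd'.
have hn : forall x, c' - dlt <= x <= d' + dlt -> C1 * n%:R <= K n x x <= C2 * n%:R.
  by near: n; exact: bnd.
have n0 : 0 < n%:R :> R by rewrite ltr0n; near: n; exists 1%N.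
have nA : A / (m * C1 * dlt) <= n%:R by near: n; exact: near_natr_ge.
have xX : c' - dlt <= x <= d' + dlt by case/andP: xcd' => ? ?; apply/andP; split; lra.
have KtE y : c <= y <= d -> Kt n y = w y * K n y y.
  move=> /w_bnd /andP[h _]; rewrite /Kt /normalized_kernel -expr2 sqr_sqrtr //.
  by rewrite (le_trans _ h) // ltW.
have Klow : m * C1 * n%:R <= Kt n x.
  rewrite KtE ?inX // -mulrA; have /andP[wm _] := w_bnd (inX _ xX).
  have /andP[h _] := hn _ xX.
  by apply: ler_pM => //; rewrite ?(ltW m0) // mulr_ge0 // ltW.
have mC0 : 0 < m * C1 by rewrite mulr_gt0.
have mCn0 : 0 < m * C1 * n%:R by rewrite mulr_gt0.
have Kt0 : 0 < Kt n x := lt_le_trans mCn0 Klow.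
have shift u : `|u| <= A -> c' - dlt <= x + u / Kt n x <= d' + dlt.
  move=> uA; have : `|u / Kt n x| <= dlt.
    rewrite normrM normfV (gtr0_norm Kt0) ler_pdivrMr //.
    apply: le_trans uA _; apply: (@le_trans _ _ (dlt * (m * C1 * n%:R))); last first.
      by rewrite ler_pM2l.
    move: nA; rewrite ler_pdivrMr ?mulr_gt0 // => /le_trans; apply.
    by rewrite le_eqVlt; apply/orP; left; apply/eqP; ring.
  rewrite ler_norml => /andP[? ?]; case/andP: xcd' => ? ?; apply/andP; split; lra.
have aX := shift a aA; have bX := shift b bA.
split; [exact: inX | exact: inX | ].
apply: le_trans (ler_normB _ _) _; apply: lerD; last first.
  rewrite sine_kernelE; apply: le_trans (sinc_bounded _) _; rewrite lerD2l normrM.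
  rewrite ger0_norm ?pi_ge0 // ler_wpM2l ?pi_ge0 // (le_trans (ler_normB _ _)) //; lra.
rewrite normrM normfV (gtr0_norm Kt0).
set y := x + a / Kt n x; set z := x + b / Kt n x.
have num : `|normalized_kernel p w n y z| <= M * (C2 * n%:R).
  rewrite /normalized_kernel normrM ger0_norm ?mulr_ge0 ?sqrtr_ge0 //.
  have sq v : c <= v <= d -> Num.sqrt (w v) <= Num.sqrt M.
    by move=> /w_bnd /andP[_ h]; rewrite ler_sqrt // ltW.
  apply: ler_pM; rewrite ?normr_ge0 ?mulr_ge0 ?sqrtr_ge0 //.
    have -> : M = Num.sqrt M * Num.sqrt M by rewrite -expr2 sqr_sqrtr // ltW.
    by apply: ler_pM; rewrite ?sqrtr_ge0 // sq // inX.
  have C2n : 0 <= C2 * n%:R by rewrite mulr_ge0 // ltW.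
  rewrite -(@ler_pXn2r _ 2) ?nnegrE // real_normK ?num_real //.
  apply: le_trans (sqr_kernel_le L_ge0 p_on n y z) _; rewrite expr2.
  have /andP[_ h1] := hn y aX; have /andP[_ h2] := hn z bX.
  by apply: ler_pM => //; exact: kernel_diag_ge0.
rewrite ler_pdivrMr //; apply: le_trans num _.
apply: (@le_trans _ _ (M * C2 / (m * C1) * (m * C1 * n%:R))).
  by rewrite le_eqVlt; apply/orP; left; apply/eqP; field; rewrite !gt_eqF.
by rewrite ler_wpM2l // divr_ge0 ?mulr_ge0 ?(ltW M0) ?(ltW m0) ?(ltW C10) ?(ltW C20).
Unshelve. all: by end_near.
Qed.

(** Measurability of w is known on (-1, 1) only, whence the condition that the shifted points stay
    in [c, d]. *)
Lemma measurable_normalized_kernel n a b (pw : R) :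
  (forall x, c' <= x <= d' -> c <= x + a / Kt n x <= d /\ c <= x + b / Kt n x <= d) ->
  measurable_fun (`[c', d'] : set (measurableTypeR R))
    (fun x => (`|normalized_kernel p w n (x + a / Kt n x) (x + b / Kt n x) / Kt n x
      - sine_kernel a b| `^ pw)%:E).
Proof.
move=> hin.
pose D : set (measurableTypeR R) := [set` `[c', d']].
have mD : measurable D by exact: measurable_itv.
have [mw _ _] := w_dens.
have msq : measurable_fun (setT : set R) (@Num.sqrt R).
  by apply: continuous_measurable_fun; exact: sqrt_continuous.
have mh (f : {poly R}) : measurable_fun (setT : set R) (horner f).
  by apply: continuous_measurable_fun; exact: continuous_horner.
have mI : measurable ([set` `](-1), 1[] : set (measurableTypeR R)) by exact: measurable_itv.
have mwu (u : R -> R) : measurable_fun D u -> (forall x, D x -> c <= u x <= d) ->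
    measurable_fun D (fun x => Num.sqrt (w (u x))).
  move=> mu_ hu; apply: (measurableT_comp msq).
  apply: (measurable_comp mI _ mw mu_).
  by move=> _ [x Dx <-]; rewrite /= in_itv /=; apply: inI; exact: hu.
have mK (u v : R -> R) : measurable_fun D u -> measurable_fun D v ->
    measurable_fun D (fun x => K n (u x) (v x)).
  move=> mu_ mv; apply: measurable_sum => k.
  by apply: measurable_funM; apply: (measurableT_comp (mh _)).
have mid : measurable_fun D (fun x : R => x) by exact: measurable_id.
have D_cd x : D x -> c <= x <= d.
  by rewrite /D /= in_itv /= => /andP[h1 h2];
    rewrite (le_trans (ltW cc')) // (le_trans h2) // ltW.
have mN (u v : R -> R) : measurable_fun D u -> measurable_fun D v ->
    (forall x, D x -> c <= u x <= d) -> (forall x, D x -> c <= v x <= d) ->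
    measurable_fun D (fun x => normalized_kernel p w n (u x) (v x)).
  move=> mu_ mv hu hv; apply: measurable_funM; last exact: mK.
  by apply: measurable_funM; exact: mwu.
have mKt : measurable_fun D (Kt n) by apply: mN.
have Kt0 x : 0 <= Kt n x.
  by rewrite /Kt /normalized_kernel !mulr_ge0 ?sqrtr_ge0 ?kernel_diag_ge0.
have mKtV : measurable_fun D (fun x => (Kt n x)^-1).
  have -> : (fun x => (Kt n x)^-1) = (fun x => Kt n x `^ (-1)).
    by apply/funext => x; rewrite powR_inv1.
  exact: (measurableT_comp (measurable_powR _)).
have msh (u : R) : measurable_fun D (fun x => x + u / Kt n x).
  by apply: measurable_funD => //; apply: measurable_funM.
apply/measurable_EFinP; apply: (measurableT_comp (measurable_powR _)).
apply: (measurableT_comp (@normr_measurable _ _)).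
apply: measurable_funB => //; apply: measurable_funM => //.
by apply: mN => // x; rewrite /D /= in_itv /= => /hin[].
Qed.

End UniformBounds.

Lemma subset_interior_itv (R : realType) (c d c' d' : R) : c' <= d' ->
  `[c', d'] `<=` (`[c, d] : set R)° -> c < c' /\ d' < d.
Proof.
move=> cd' sub.
have hc : (`[c, d] : set R)° c' by apply: sub; rewrite /= in_itv /= lexx.
have hd : (`[c, d] : set R)° d' by apply: sub; rewrite /= in_itv /= lexx andbT.
move: hc hd; rewrite /interior => /nbhs_ballP[r /= r0 hr] /nbhs_ballP[s /= s0 hs]; split.
  have := hr (c' - r / 2); rewrite /ball /= opprB addrC subrK ger0_norm; last by lra.
  by rewrite in_itv /= => /(_ _)/andP[]; lra.
have := hs (d' + s / 2); rewrite /ball /= opprD addrA subrr add0r normrN ger0_norm; last by lra.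
by rewrite in_itv /= => /(_ _)/andP[]; lra.
Qed.

(* The pair witnesses the failure of S at n, if there is one in A. *)
Lemma exists_worst_pairs (R : realType) (A : set R) (M : R) (S : nat -> R -> R -> Prop) :
  0 <= M -> (forall a, A a -> `|a| <= M) ->
  exists ab : nat -> R * R, forall n, [/\ `|(ab n).1| <= M, `|(ab n).2| <= M &
    S n (ab n).1 (ab n).2 -> forall a b, A a -> A b -> S n a b].
Proof.
move=> M0 hA; suff /choice[ab hab] : forall n, exists ab : R * R, [/\ `|ab.1| <= M,
    `|ab.2| <= M & S n ab.1 ab.2 -> forall a b, A a -> A b -> S n a b] by exists ab.
move=> n; have [[[a b] [Aa Ab nS]]|no] := pselect (exists ab : R * R,
    [/\ A ab.1, A ab.2 & ~ S n ab.1 ab.2]).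
  by exists (a, b); split; [exact: hA | exact: hA | move=> /nS].
exists (0, 0); split; rewrite ?normr0 // => _ a b Aa Ab.
by apply: contrapT => nS; apply: no; exists (a, b).
Qed.

Theorem theorem1p4 (R : realType)
  (mu : {finite_measure set (measurableTypeR R) -> \bar R})
  (mu_conc : mu (~` (`]-1, 1[ : set R)) = 0%E)
  (mu_supp : infinite_set (measure_support mu))
  (mu_reg : regular_measure mu)
  (P : nat -> {poly R}) (P_orth : orthonormal_polynomials mu P)
  (w : R -> R) (w_dens : ac_density mu w)
  (p : R) (p_gt0 : 0 < p)
  (c d : R) (le_cd : c <= d) (I_sub : `[c, d] `<=` (`]-1, 1[ : set R))
  (mu_ac : mrestr mu (measurable_itv `[c, d]) `<< @lebesgue_measure R)
  (w_bnd : exists m M : R, 0 < m /\ forall x, x \in `[c, d] -> m <= w x <= M)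
  (w_riemann : riemann_integrable c d w)
  (c' d' : R) (le_cd' : c' <= d')
  (I'_sub : `[c', d'] `<=` (`[c, d] : set R)°)
  (A : set R) (A_compact : compact A) (e : R) (e_gt0 : 0 < e) :
  \forall n \near \oo, forall a b : R, A a -> A b ->
    (\int[lebesgue_measure]_(x in `[c', d'])
       (`| normalized_kernel P w n
             (x + a / normalized_kernel P w n x x)
             (x + b / normalized_kernel P w n x x)
           / normalized_kernel P w n x x
           - sine_kernel a b | `^ p)%:E < e%:E)%E.
Proof.
have [cc' dd'] := subset_interior_itv le_cd' I'_sub.
have cd : c < d by apply: lt_le_trans cc' (le_trans le_cd' (ltW dd')).
have [L [L_mu L_ge0]] := exists_mu_functional mu.
have [E [E_cos E_ge0 E_on]] := exists_arcsine_functional R.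
have P_on := orthonormal_polynomials_for L_mu P_orth.
(* Regularity names its own orthonormal polynomials; their leading coefficients are those of P. *)
have P_reg : forall rho : R, 1 < rho -> \forall n \near \oo, lead_coef (P n) <= (2 * rho) ^+ n.
  have [q q_orth q_lim] := mu_reg.
  have q_on := orthonormal_polynomials_for L_mu q_orth.
  apply: powR_root_cvg_le => [n|]; first exact: (P_on.1 n).2.
  by under eq_fun do rewrite (orthonormal_lead_unique P_on q_on).
have P_sub := orthonormal_subexponential L_ge0 P_on P_reg.
have [m [M [m0 w_bnd']]] := w_bnd.
have {}w_bnd x : c <= x <= d -> m <= w x <= M.
  by move=> xcd; apply: w_bnd'; rewrite in_itv.
have [A0 A00 hA] := compact_norm_bound A_compact.
have [B hB] := normalized_kernel_dominated w_dens I_sub mu_ac L_ge0 E_ge0 L_mu E_cos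
  P_on E_on P_sub m0 w_bnd cc' le_cd' dd' A00.
pose F n x a b := `| normalized_kernel P w n
             (x + a / normalized_kernel P w n x x)
             (x + b / normalized_kernel P w n x x)
           / normalized_kernel P w n x x
           - sine_kernel a b | `^ p.
pose small n a b := (\int[lebesgue_measure]_(x in `[c', d']) (F n x a b)%:E < e%:E)%E.
(* Uniformity over A becomes convergence along one sequence: an integral below e at the pair chosen
   for n forces it below e at every pair of A. *)
have [ab hab] := exists_worst_pairs small A00 hA.
have [N _ hN] := hB.
(* Measurability and the bound B are available from N on; earlier terms are replaced by 0 so that
   dominated convergence applies to the whole sequence. *)
pose g n x : \bar R := if (N <= n)%N then (F n x (ab n).1 (ab n).2)%:E else 0%E.
pose D : set (measurableTypeR R) := [set` `[c', d']].
have mD : measurable D by exact: measurable_itv.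
have D_fin : (lebesgue_measure D < +oo)%E.
  by rewrite lebesgue_measure_itv /=; case: ifP => _; rewrite ltry.
have xD x : D x -> c' <= x <= d' by rewrite /D /= in_itv.
have mg n : measurable_fun D (g n).
  case Nn : (N <= n)%N; rewrite /g Nn; last exact: measurable_cst.
  apply: (measurable_normalized_kernel w_dens I_sub cc' dd').
  by move=> x xcd'; have [h1 h2 _] := hab n; have [] := hN n Nn _ _ x h1 h2 xcd'.
have g0 : \forall x \ae lebesgue_measure, D x -> g n x @[n --> \oo] --> 0%E.
  apply: negligibleS (ae_continuous_of_riemann_integrable cd w_riemann).
  move=> x /not_implyP[/xD /andP[x1 x2] ng].
  have xcd : c < x < d by rewrite (lt_le_trans cc') // (le_lt_trans x2).
  split => // w_cont; apply: ng.
  have wx0 : 0 < w x.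
    have /w_bnd /andP[h _] : c <= x <= d by case/andP: xcd => /ltW -> /ltW ->.
    exact: lt_le_trans h.
  have near_x := kernel_near_continuity_point w_dens I_sub mu_ac L_ge0 E_ge0 L_mu E_cos
    P_on E_on P_sub xcd wx0 w_cont.
  have xI : -1 < x < 1.
    have := @I_sub x; rewrite /= !in_itv /=; apply.
    by case/andP: xcd => /ltW -> /ltW ->.
  have ab1 n : `|(ab n).1| <= A0 by have [] := hab n.
  have ab2 n : `|(ab n).2| <= A0 by have [] := hab n.
  have lim := normalized_kernel_cvg (a := fun n => (ab n).1) (b := fun n => (ab n).2)
    xI wx0 w_cont near_x ab1 ab2.
  have /(powR_cvg0 p_gt0) limp := lim.
  have limE : (F n x (ab n).1 (ab n).2)%:E @[n --> \oo] --> 0%E by apply: cvg_EFin => //;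
    exact: nearW.
  apply: cvg_trans limE; apply: near_eq_cvg.
  by exists N => // n Nn; rewrite /g Nn.
(* B bounds an absolute value at n = N and x = c'. Its sign is needed to raise the bound to the
   power p. *)
have B0 : 0 <= B.
  have [h1 h2 _] := hab N.
  have [_ _] := hN N (leqnn N) _ _ c' h1 h2 (introT andP (conj (lexx _) le_cd')).
  exact: le_trans.
have gB : \forall x \ae lebesgue_measure, forall n, D x -> (`|g n x| <= (B `^ p)%:E)%E.
  apply: aeW => x n Dx; rewrite /g; case: ifP => Nn; last by rewrite abse0 lee_fin powR_ge0.
  have [h1 h2 _] := hab n; have [_ _ h] := hN n Nn _ _ x h1 h2 (xD x Dx).
  rewrite abse_EFin lee_fin ger0_norm ?powR_ge0 //.
  by apply: ge0_ler_powR; rewrite ?nnegrE ?normr_ge0 // ltW.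
have cB : lebesgue_measure.-integrable D (EFin \o cst (B `^ p)).
  apply: measurable_bounded_integrable => //.
  by exists `|B `^ p|; split=> [|t ht x _]; [exact: num_real | exact: ltW].
have [_ _ lim] := dominated_convergence mD mg (measurable_cst _) g0 cB gB.
rewrite integral0 in lim.
have ev : \forall n \near \oo, (\int[lebesgue_measure]_(x in D) g n x < e%:E)%E.
  have O : nbhs (0%E : \bar R) [set y | (y < e%:E)%E].
    by apply: open_nbhs_nbhs; split; [exact: open_ereal_lt_ereal | rewrite /= lte_fin].
  exact: (lim _ O).
near=> n => a b Aa Ab.
have [_ _ worst] := hab n; apply: worst => //.
have Nn : (N <= n)%N by near: n; exists N.
have : (\int[lebesgue_measure]_(x in D) g n x < e%:E)%E by near: n; exact: ev.
by rewrite /g Nn.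
Unshelve. all: by end_near.
Qed.
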